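(* Let $T$ be a basic trigraph in $\mathcal F$ that contains no odd prism and no antihole (of any length $\ge 5$). Then: (1) $T$ is either complete or has an even pair; (2) if $T$ is favorable, then $T$ has an even pair disjoint from its switchable component.
   Context: A trigraph $T$ consists of a finite set $V(T)$ and a map $\theta:\binom{V(T)}{2}\to\{-1,0,1\}$. Two distinct vertices $u,v$ are strongly adjacent if $\theta(uv)=1$, strongly antiadjacent if $\theta(uv)=-1$, and semiadjacent (a switchable pair) if $\theta(uv)=0$; they are adjacent if $\theta(uv)\in\{0,1\}$ and antiadjacent if $\theta(uv)\in\{0,-1\}$. $N(v)$ is the set of vertices adjacent to $v$. An edge (antiedge) is an adjacent (antiadjacent) pair; a strong edge (strong antiedge) is a strongly adjacent (strongly antiadjacent) pair. A vertex/set is strongly complete (strongly anticomplete, complete, anticomplete) to a disjoint set if every pair between them is strongly adjacent (strongly antiadjacent, adjacent, antiadjacent). The complement $\overline T$ has vertex set $V(T)$ and adjacency function $-\theta$. For $X\subseteq V(T)$, $T|X$ is the trigraph on $X$ with $\theta$ restricted, and $T\setminus X=T|(V(T)\setminus X)$; $T$ contains $H$ if $H$ is isomorphic to some $T|X$. A clique (strong clique) is a set of pairwise adjacent (strongly adjacent) vertices; a stable set (strongly stable set) is a set of pairwise antiadjacent (strongly antiadjacent) vertices; $T$ is complete if $V(T)$ is a clique. $T$ is a graph if it has no switchable pair. A realization of $T$ is a graph on $V(T)$ in which every strong edge is an edge and every strong antiedge is a non-edge; the full realization is the realization in which all switchable pairs are edges. A set $X$ is connected if the full realization of $T|X$ is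 connected, and anticonnected if the graph on $X$ whose edges are the antiadjacent pairs of $T|X$ is connected; components (anticomponents) are maximal connected (anticonnected) subsets. A path is a sequence of distinct vertices $p_1,\dots,p_k$ such that $p_i,p_j$ are adjacent when $|i-j|=1$ and antiadjacent when $|i-j|>1$; its length is $k-1$, and it is even or odd according to its length. A hole of length $k\ge5$ consists of vertices $h_1,\dots,h_k$ with $h_i,h_j$ adjacent if $|i-j|\in\{1,k-1\}$ and antiadjacent otherwise; an antihole is an induced subtrigraph whose complement is a hole of $\overline T$ (length = number of vertices). $T$ is Berge if it contains no hole of odd length and no antihole of odd length. A prism is an induced subtrigraph whose full realization consists of two vertex-disjoint triangles $\{a_1,a_2,a_3\}$, $\{b_1,b_2,b_3\}$ and three vertex-disjoint paths $P_i$ from $a_i$ to $b_i$ ($i=1,2,3$) with no other edges; it is odd if all three $P_i$ have odd length. An even pair of $T$ is a strongly antiadjacent pair $\{u,v\}$ such that every path from $u$ to $v$ in $T$ has even length. $\Sigma(T)$ is the graph on $V(T)$ whose edges are the switchable pairs of $T$; a switchable component is a connected component of $\Sigma(T)$ with at least two vertices. $\mathcal F$ is the class of Berge trigraphs $T$ such that: (1) $T$ has at most one switchable component, and it has at most two edges; (2) if the switchable component has exactly one edge $xy$, then $N(x)\cap N(y)=\emptyset$ (it is called small); (3) if it has two edges, with $v$ the vertex of degree two in $\Sigma(T)$ and $x,y$ its neighbours, then $v$ is strongly anticomplete to $V(T)\setminus\{v,x,y\}$, $x$ is strongly antiadjacent to $y$, and $N(x)\cap N(y)=\{v\}$ (it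 is called light). For $T\in\mathcal F$, $D$ denotes the vertex set of its switchable component ($D=\emptyset$ if $T$ has no switchable pair). A pair $\{u,v\}$ is disjoint from the switchable component if $\{u,v\}\cap D=\emptyset$. A trigraph $T\in\mathcal F$ is favorable if (1) $|V(T)|\ge5$; (2) $T$ has a strongly antiadjacent pair $\{u,v\}$ disjoint from $D$; and (3) if $D=\{x,y\}$ is small, then at least one of $V(T)\setminus(D\cup N(x))$, $V(T)\setminus(D\cup N(y))$ is not a clique. $T$ is bipartite if $V(T)$ can be partitioned into two strongly stable sets. $T$ is a line trigraph if its full realization is the line graph of a bipartite graph and every clique of size at least $3$ in $T$ is a strong clique. $T$ is a doubled graph if it has a good partition: a partition $(X,Y)$ of $V(T)$ such that every component of $T|X$ and every anticomponent of $T|Y$ has at most two vertices, no switchable pair has one end in $X$ and the other in $Y$, and for every component $C_x$ of $T|X$ and every anticomponent $C_y$ of $T|Y$, every vertex of $C_x\cup C_y$ is incident with at most one strong edge and at most one strong antiedge between $C_x$ and $C_y$. $T$ is basic if it is bipartite, the complement of a bipartite trigraph, a line trigraph, the complement of a line trigraph, or a doubled graph. *)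

(* Defs.v *)
From mathcomp Require Import all_boot.
Set Implicit Arguments. Unset Strict Implicit. Unset Printing Implicit Defensive.

(* values of theta : -1 (Anti), 0 (Semi), 1 (Strong) *)
Inductive adj3 := Anti | Semi | Strong.

(* A trigraph on the finite vertex set V: a symmetric map theta on pairs
   of distinct vertices (values on the diagonal are irrelevant and never used). *)
Record trigraph (V : finType) := Trigraph {
  theta : V -> V -> adj3 ;
  theta_sym : forall u v, theta u v = theta v u }.

Section Trigraphs.
Variable V : finType.
Implicit Types (T : trigraph V) (X Y : {set V}) (u v x y : V) (s : seq V).

Definition neg3 (a : adj3) := match a with Anti => Strong | Semi => Semi | Strong => Anti end.

Definition compl T : trigraph V :=
  @Trigraph V (fun u v => neg3 (theta T u v))
    (fun u v => f_equal neg3 (theta_sym T u v)).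

Definition is_strong (a : adj3) := if a is Strong then true else false.
Definition is_anti (a : adj3) := if a is Anti then true else false.
Definition is_semi (a : adj3) := if a is Semi then true else false.

Definition strongly_adj T : rel V := fun u v => (u != v) && is_strong (theta T u v).
Definition strongly_anti T : rel V := fun u v => (u != v) && is_anti (theta T u v).
Definition semiadj T : rel V := fun u v => (u != v) && is_semi (theta T u v).
Definition adjacent T : rel V := fun u v => (u != v) && ~~ is_anti (theta T u v).
Definition antiadjacent T : rel V := fun u v => (u != v) && ~~ is_strong (theta T u v).

Definition N T v : {set V} := [set u | adjacent T v u].

Definition clique T X := forall u v, u \in X -> v \in X -> u != v -> adjacent T u v.
Definition strong_clique T X :=
  forall u v, u \in X -> v \in X -> u != v -> strongly_adj T u v.
Definition strongly_stable T X :=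
  forall u v, u \in X -> v \in X -> u != v -> strongly_anti T u v.
Definition complete T := clique T [set: V].

(* paths: a sequence of distinct vertices p_0..p_(k-1) with p_i, p_j adjacent
   when |i-j| = 1 and antiadjacent when |i-j| > 1; its length is size s - 1.
   (the default x0 of nth is irrelevant since indices are in range) *)
Definition is_path T s :=
  uniq s /\
  forall x0 i j, i < size s -> j < size s ->
    ((i.+1 == j) || (j.+1 == i) -> adjacent T (nth x0 s i) (nth x0 s j)) /\
    ((i.+1 < j) || (j.+1 < i) -> antiadjacent T (nth x0 s i) (nth x0 s j)).

Definition path_from_to T u v s :=
  is_path T s /\ ohead s = Some u /\ last u s = v.

Definition cyc_consec (k i j : nat) :=
  (i - j == 1) || (j - i == 1) || (i - j == k.-1) || (j - i == k.-1).

Definition is_hole T s :=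
  5 <= size s /\ uniq s /\
  forall x0 i j, i < size s -> j < size s -> i != j ->
    (cyc_consec (size s) i j -> adjacent T (nth x0 s i) (nth x0 s j)) /\
    (~~ cyc_consec (size s) i j -> antiadjacent T (nth x0 s i) (nth x0 s j)).

Definition is_antihole T s := is_hole (compl T) s.

Definition berge T :=
  (forall s, is_hole T s -> ~~ odd (size s)) /\
  (forall s, is_antihole T s -> ~~ odd (size s)).

Definition seq_edge (p : seq V) x y :=
  exists i, i.+1 < size p /\
    ((nth x p i = x /\ nth x p i.+1 = y) \/ (nth x p i = y /\ nth x p i.+1 = x)).

(* prism: three vertex-disjoint paths p1,p2,p3 from a_i = head p_i to b_i = last p_i,
   whose union X induces a trigraph whose full realization has exactly the edges
   of the three paths and of the triangles {a1,a2,a3}, {b1,b2,b3}.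
   It is odd if the three paths have odd length (even number of vertices). *)
Definition is_prism T (p1 p2 p3 : seq V) :=
  exists a1 a2 a3 b1 b2 b3,
    [/\ ohead p1 = Some a1, ohead p2 = Some a2, ohead p3 = Some a3 &
     [/\ last a1 p1 = b1, last a2 p2 = b2, last a3 p3 = b3 &
     [/\ 2 <= size p1, 2 <= size p2, 2 <= size p3, uniq (p1 ++ p2 ++ p3) &
       forall x y, x \in p1 ++ p2 ++ p3 -> y \in p1 ++ p2 ++ p3 -> x != y ->
         (adjacent T x y <->
            seq_edge p1 x y \/ seq_edge p2 x y \/ seq_edge p3 x y \/
            ((x \in [:: a1; a2; a3]) && (y \in [:: a1; a2; a3])) \/
            ((x \in [:: b1; b2; b3]) && (y \in [:: b1; b2; b3])))]]].

Definition is_odd_prism T p1 p2 p3 :=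
  is_prism T p1 p2 p3 /\ ~~ odd (size p1) /\ ~~ odd (size p2) /\ ~~ odd (size p3).

Definition switch_edges T : {set {set V}} :=
  [set e : {set V} | [exists u, exists v, semiadj T u v && (e == [set u; v])]].

(* vertex set D of the switchable component (empty if no switchable pair) *)
Definition Dset T : {set V} := [set v | [exists u, semiadj T u v]].

Definition in_F T :=
  [/\ berge T,
      (forall u v, u \in Dset T -> v \in Dset T -> connect (semiadj T) u v),
      #|switch_edges T| <= 2,
      (#|switch_edges T| = 1 ->
         forall x y, semiadj T x y -> N T x :&: N T y = set0) &
      (forall v x y, x != y -> semiadj T v x -> semiadj T v y ->
         [/\ forall w, w \notin [set v; x; y] -> strongly_anti T v w,
             strongly_anti T x y &
             N T x :&: N T y = [set v]])].

Definition even_pair T u v :=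
  strongly_anti T u v /\
  forall s, path_from_to T u v s -> ~~ odd (size s).-1.

Definition favorable T :=
  [/\ 5 <= #|V|,
      (exists u v, [/\ strongly_anti T u v, u \notin Dset T & v \notin Dset T]) &
      (forall x y, #|switch_edges T| = 1 -> semiadj T x y ->
         ~ clique T (~: (Dset T :|: N T x)) \/ ~ clique T (~: (Dset T :|: N T y)))].

Definition bipartite T :=
  exists A : {set V}, strongly_stable T A /\ strongly_stable T (~: A).

(* the full realization of T is the line graph of a bipartite graph H:
   the vertices of T are (injectively) the edges (a,b) of H, with a in one
   side and b in the other side of H, and two distinct vertices are adjacent
   iff the corresponding edges of H share an end. *)
Definition full_real_line_of_bipartite T :=
  exists f : V -> nat * nat, injective f /\
    forall u v, u != v ->
      (adjacent T u v <-> (f u).1 = (f v).1 \/ (f u).2 = (f v).2).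

Definition line_trigraph T :=
  full_real_line_of_bipartite T /\
  forall X, clique T X -> 3 <= #|X| -> strong_clique T X.

Definition comp_in T X x : {set V} :=
  [set w | connect (fun a b => [&& a \in X, b \in X & adjacent T a b]) x w].
Definition anticomp_in T Y y : {set V} :=
  [set w | connect (fun a b => [&& a \in Y, b \in Y & antiadjacent T a b]) y w].

Definition good_partition T X :=
  let Y := ~: X in
  [/\ (forall x, x \in X -> #|comp_in T X x| <= 2),
      (forall y, y \in Y -> #|anticomp_in T Y y| <= 2),
      (forall x y, x \in X -> y \in Y -> ~~ semiadj T x y) &
      (forall x y, x \in X -> y \in Y ->
         let Cx := comp_in T X x in let Cy := anticomp_in T Y y in
         (forall z, z \in Cx ->
            #|[set w in Cy | strongly_adj T z w]| <= 1 /\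
            #|[set w in Cy | strongly_anti T z w]| <= 1) /\
         (forall z, z \in Cy ->
            #|[set w in Cx | strongly_adj T z w]| <= 1 /\
            #|[set w in Cx | strongly_anti T z w]| <= 1))].

Definition doubled_graph T := exists X : {set V}, good_partition T X.

Definition basic T :=
  bipartite T \/ bipartite (compl T) \/ line_trigraph T \/
  line_trigraph (compl T) \/ doubled_graph T.

End Trigraphs.

(* Main.v *)
(** Each kind of basic trigraph has its own source of even pairs.

    - Bipartite: two vertices on the same side form an even pair.
    - Complement of a bipartite trigraph: odd paths between antiadjacent vertices have length
      three, and an even pair is a bisimplicial edge of the complement, a bipartite graph
      without holes of length at least six.  If this graph has no two edges that are pairwise
      far apart, an edge at a vertex of minimum positive degree works.  Otherwise take a maximal
      connected set [X], containing an edge, such that some edge is far from [X]: the attachments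
      of the far part in [N(X)] are complete to it and to each other, so induction applies to
      the far part.
    - Line trigraph of a bipartite graph [H]: an edge of [H] both of whose ends have degree two
      has exactly two neighbours in the line graph, and these form an even pair.  Odd prisms
      are thetas of [H] between two vertices on the same side.  After simplicial vertices are
      stripped, a minimal part [K] of [H] cut off by two vertices [p], [q] contains such an
      edge: for a shortest path [Q] from [p] to [q] through [K], the attachments on [Q] of a
      component of [K \ Q] lie on opposite sides (there is no theta), so there are at most two
      of them, against minimality; hence [K = Q].  The switchable component is kept outside
      of [K].
    - Complement of a line trigraph: odd paths again have length three; without long holes the
      root graph has no cycle of length at least six, and the first two edges of a longest path
      of the root graph, possibly after a rotation, form an even pair.
    - Doubled graph: direct inspection of the good partition. *)

Require Import Defs.
From mathcomp Require Import all_boot.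
From mathcomp Require Import zify.
Set Implicit Arguments. Unset Strict Implicit. Unset Printing Implicit Defensive.

(** * Basic facts on trigraphs *)

(** A switchable pair may occur in a path both as a consecutive and as a nonconsecutive pair, so
    parity arguments for graphs do not apply directly. In a line trigraph triangles are strong;
    hence a path with strongly antiadjacent ends has only strongly antiadjacent nonconsecutive pairs
    and is an induced path of the full realization. In the complement classes the odd paths are
    short enough to be inspected vertex by vertex. The second statement shapes much of the rest,
    because the pair must avoid the switchable component. A light component has its two switchable
    pairs at a common vertex and strongly antiadjacent ends; this is impossible in complements of
    bipartite or line trigraphs and in doubled graphs. For a small component, favorability gives two
    nonadjacent vertices that both miss the same end of the switchable pair. For line trigraphs,
    induction runs over vertex sets closed under induced paths rather than over subtrigraphs, so
    that an even pair found inside such a set is already an even pair of the whole trigraph. *)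

Section Basics.
Variables (V : finType) (T : trigraph V).
Implicit Types (u v w x y : V) (s : seq V).

Lemma adjacentC : symmetric (adjacent T).
Proof. by move=> u v; rewrite /adjacent eq_sym theta_sym. Qed.

Lemma antiadjacentC : symmetric (antiadjacent T).
Proof. by move=> u v; rewrite /antiadjacent eq_sym theta_sym. Qed.

Lemma semiadjC : symmetric (semiadj T).
Proof. by move=> u v; rewrite /semiadj eq_sym theta_sym. Qed.

Lemma strongly_adjC : symmetric (strongly_adj T).
Proof. by move=> u v; rewrite /strongly_adj eq_sym theta_sym. Qed.

Lemma strongly_antiC : symmetric (strongly_anti T).
Proof. by move=> u v; rewrite /strongly_anti eq_sym theta_sym. Qed.

Lemma strongly_antiE u v : strongly_anti T u v = (u != v) && ~~ adjacent T u v.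
Proof. by rewrite /strongly_anti /adjacent; case: eqP => //=; case: theta. Qed.

Lemma strongly_adjE u v : strongly_adj T u v = (u != v) && ~~ antiadjacent T u v.
Proof. by rewrite /strongly_adj /antiadjacent; case: eqP => //=; case: theta. Qed.

Lemma semiadjE u v : semiadj T u v = adjacent T u v && antiadjacent T u v.
Proof. by rewrite /semiadj /adjacent /antiadjacent; case: eqP => //=; case: theta. Qed.

Lemma adjacentE u v : adjacent T u v = (u != v) && ~~ strongly_anti T u v.
Proof. by rewrite strongly_antiE /adjacent; case: eqP => //=; rewrite negbK. Qed.

Lemma antiadjacentE u v : antiadjacent T u v = (u != v) && ~~ strongly_adj T u v.
Proof. by rewrite strongly_adjE /antiadjacent; case: eqP => //=; rewrite negbK. Qed.

Lemma adjacentW u v : adjacent T u v = strongly_adj T u v || semiadj T u v.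
Proof. by rewrite /strongly_adj /semiadj /adjacent; case: eqP => //=; case: theta. Qed.

Lemma antiadjacentW u v : antiadjacent T u v = strongly_anti T u v || semiadj T u v.
Proof. by rewrite /strongly_anti /semiadj /antiadjacent; case: eqP => //=; case: theta. Qed.

Lemma adjacent_neq u v : adjacent T u v -> u != v.
Proof. by case/andP. Qed.

Lemma antiadjacent_neq u v : antiadjacent T u v -> u != v.
Proof. by case/andP. Qed.

Lemma strongly_anti_neq u v : strongly_anti T u v -> u != v.
Proof. by case/andP. Qed.

Lemma strongly_adjW u v : strongly_adj T u v -> adjacent T u v.
Proof. by rewrite adjacentW => ->. Qed.

Lemma strongly_antiW u v : strongly_anti T u v -> antiadjacent T u v.
Proof. by rewrite antiadjacentW => ->. Qed.

Lemma adjacent_compl u v : adjacent (compl T) u v = antiadjacent T u v.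
Proof. by rewrite /adjacent /antiadjacent /=; case: theta. Qed.

Lemma antiadjacent_compl u v : antiadjacent (compl T) u v = adjacent T u v.
Proof. by rewrite /adjacent /antiadjacent /=; case: theta. Qed.

Lemma strongly_adj_compl u v : strongly_adj (compl T) u v = strongly_anti T u v.
Proof. by rewrite /strongly_adj /strongly_anti /=; case: theta. Qed.

Lemma notin_DsetP v : reflect (forall u, ~~ semiadj T u v) (v \notin Dset T).
Proof.
rewrite inE negb_exists; exact: forallP.
Qed.

Lemma in_Dset u v : semiadj T u v -> (u \in Dset T) && (v \in Dset T).
Proof.
move=> h; rewrite !inE; apply/andP; split; apply/existsP.
  by exists v; rewrite semiadjC.
by exists u.
Qed.

Lemma notin_Dset_anti u v : u \notin Dset T -> antiadjacent T u v -> strongly_anti T u v.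
Proof.
move/notin_DsetP/(_ v); rewrite semiadjC antiadjacentW => /negbTE ->.
by rewrite orbF.
Qed.

Lemma not_complete_anti : ~ complete T -> exists u v, strongly_anti T u v.
Proof.
move=> nc.
have [/existsP[u /existsP[v h]]|] := boolP [exists u, exists v, strongly_anti T u v].
  by exists u, v.
rewrite negb_exists => /forallP h; case: nc => u v _ _ ne.
by move: (h u); rewrite negb_exists => /forallP/(_ v); rewrite adjacentE ne.
Qed.

Lemma complete_or : complete T \/ exists u v, strongly_anti T u v.
Proof.
have [/existsP[u /existsP[v h]]|] := boolP [exists u, exists v, strongly_anti T u v].
  by right; exists u, v.
rewrite negb_exists => /forallP h; left => u v _ _ ne.
by move: (h u); rewrite negb_exists => /forallP/(_ v); rewrite adjacentE ne.
Qed.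

Lemma complete_dec : complete T \/ ~ complete T.
Proof.
case: complete_or => [|[u [v uv]]]; [by left|right => c].
by move: uv; rewrite strongly_antiE => /andP[/c ->].
Qed.

End Basics.

(* Induced paths.  The relations [a] between consecutive and [n] between other entries
   need not exclude each other: in a trigraph both hold for switchable pairs. *)
Fixpoint ipath (V : Type) (a n : rel V) (s : seq V) : bool :=
  if s is x :: (y :: t) as s' then [&& a x y, all (n x) t & ipath a n s'] else true.

Section IPath.
Variables (V : eqType).
Implicit Types (a n : rel V) (s : seq V).

Lemma ipath_cat a n s1 s2 : ipath a n (s1 ++ s2) -> ipath a n s1 && ipath a n s2.
Proof.
elim: s1 => //= x [|y t] IH.
  by case: s2 {IH} => //= y t /and3P[].
rewrite cat_cons => /and3P[-> /=]; rewrite all_cat => /andP[-> _] /IH.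
by case/andP => /= -> ->.
Qed.

Lemma ipath_path a n x s : ipath a n (x :: s) -> path a x s.
Proof. by elim: s x => //= y t IH x /and3P[-> _ /IH]. Qed.

Lemma sub_ipath a n a' n' s : subrel a a' -> subrel n n' ->
  ipath a n s -> ipath a' n' s.
Proof.
move=> sa sn; elim: s => // x [|y t] IH // /and3P[h1 h2 h3].
by apply/and3P; split; [exact: sa|apply: sub_all h2 => z; apply: sn|exact: IH].
Qed.

Lemma ipath_rev a n s : symmetric a -> symmetric n -> ipath a n (rev s) = ipath a n s.
Proof.
move=> sa sn.
suff imp t : ipath a n t -> ipath a n (rev t).
  by apply/idP/idP => [/imp|/imp //]; rewrite revK.
elim: t => //= x [|y t] IH //.
case/and3P => axy nx /IH; rewrite [rev (y :: t)]rev_cons (rev_cons x) rev_cons.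
have {nx}: all (n x) (rev t) by rewrite all_rev.
elim: (rev t) => [|z r IHr] /=; first by rewrite sa axy.
case: r IHr => [|z' r] IHr /=.
  by rewrite !andbT => nxz azy; rewrite azy sa axy sn nxz.
case/and3P => nz nz' nr /and3P[az]; rewrite all_rcons => /andP[nzy nzr] h.
rewrite az !all_rcons nzy nzr sn nz /=; apply: IHr => //.
by rewrite /= nz' nr.
Qed.

End IPath.

(** * Paths and even pairs *)

Section EvenPairs.
Variables (V : finType) (T : trigraph V).
Implicit Types (u v w x y : V) (s : seq V).

Definition tpath s := ipath (adjacent T) (antiadjacent T) s.

Lemma is_path_tpath s : is_path T s -> tpath s.
Proof.
case=> _; elim: s => //= x [|y t] IH // h.
apply/and3P; split.
- by case: (h x 0 1) => // /(_ isT).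
- apply/allP => z zt; have lt: index z t < size t by rewrite index_mem.
  case: (h x 0 (index z t).+2) => // _ /(_ isT) /=.
  by rewrite nth_index.
by apply: IH => x0 i j li lj; case: (h x0 i.+1 j.+1).
Qed.

(** Splitting off the first vertex makes [size s] the length of the path, so no predecessor remains
    in the parity. *)
Lemma even_pairP u v : strongly_anti T u v ->
  (forall s, u \notin s -> uniq s -> tpath (u :: s) -> last u s = v -> ~~ odd (size s)) ->
  even_pair T u v.
Proof.
move=> uv h; split => // s [ps [hs ls]].
case: s ps hs ls => //= x s ps [xu]; subst x => ls.
by case: (ps) => /= /andP[us us'] _; apply: h => //; apply: is_path_tpath.
Qed.

End EvenPairs.

(** * The three shapes of the switchable component *)

Section Dclass.
Variables (V : finType) (T : trigraph V).
Implicit Types (u v w x y : V).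

Variant Dspec : Prop :=
| Dempty of Dset T = set0 & (forall u v, ~~ semiadj T u v)
| Dsmall x y of semiadj T x y & Dset T = [set x; y] & N T x :&: N T y = set0 &
    #|switch_edges T| = 1
| Dlight v x y of x != y & semiadj T v x & semiadj T v y & Dset T = [set v; x; y] &
    (forall w, w \notin [set v; x; y] -> strongly_anti T v w) &
    strongly_anti T x y & N T x :&: N T y = [set v].

Lemma mem_switch_edges u v : semiadj T u v -> [set u; v] \in switch_edges T.
Proof.
by move=> h; rewrite inE; apply/existsP; exists u; apply/existsP; exists v; rewrite h /=.
Qed.

(** Two switchable pairs with a common vertex already exhaust the bound of two on [switch_edges],
    which gives the light shape. If no two of them meet, they form a matching. *)
Lemma in_F_Dspec : in_F T -> Dspec.
Proof.
case=> _ conn sw small light.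
have [/existsP[x /existsP[y xy]]|] := boolP [exists x, exists y, semiadj T x y]; last first.
  rewrite negb_exists => /forallP h.
  have h' u v : ~~ semiadj T u v by move: (h u); rewrite negb_exists => /forallP.
  apply: Dempty => //.
  by apply/eqP; rewrite -subset0; apply/subsetP => v; rewrite inE => /existsP[u]; rewrite (negbTE (h' _ _)).
have [/existsP[v /existsP[a /existsP[b /and3P[ab va vb]]]]|] :=
  boolP [exists v, exists a, exists b, [&& a != b, semiadj T v a & semiadj T v b]].
  have [l1 l2 l3] := light _ _ _ ab va vb.
  have /andP[vD aD] := in_Dset va; have /andP[_ bD] := in_Dset vb.
  apply: (@Dlight v a b) => //.
  have nva := andP va; have nvb := andP vb.
  have e12: [set v; a] != [set v; b].
    apply/eqP => /setP/(_ a); rewrite !inE eqxx (negbTE ab) orbT orbF => /esym/eqP e.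
    by case: nva; rewrite e eqxx.
  have sE: switch_edges T = [set [set v; a]; [set v; b]].
    apply/esym/eqP; rewrite eqEcard cards2 e12 sw andbT.
    by apply/subsetP => e; rewrite !inE => /orP[]/eqP->; move: (mem_switch_edges va) (mem_switch_edges vb); rewrite !inE.
  apply/setP => w; apply/idP/idP; last by rewrite !in_setU !in_set1 -orbA => /or3P[]/eqP->.
  rewrite inE => /existsP[u /mem_switch_edges]; rewrite sE !inE => /orP[]/eqP/setP/(_ w); rewrite !inE eqxx orbT.
    by case/esym/orP => ->; rewrite ?orbT.
  by case/esym/orP => ->; rewrite ?orbT.
(* From here on the switchable pairs form a matching, so connectedness of [Dset] leaves room for
   only one of them. *)
rewrite negb_exists => /forallP mat.
have {}mat v a b : semiadj T v a -> semiadj T v b -> a = b.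
  move=> va vb; apply/eqP; apply/negPn/negP => ab.
  move: (mat v); rewrite negb_exists => /forallP/(_ a); rewrite negb_exists => /forallP/(_ b).
  by rewrite ab va vb.
have /andP[xD yD] := in_Dset xy.
have DE: Dset T = [set x; y].
  apply/setP => w; apply/idP/idP; last by rewrite !in_set2 => /orP[]/eqP->.
  move=> wD; have {}wD := conn _ _ xD wD.
  have clo z : connect (semiadj T) x z -> z \in [set x; y].
    case/connectP => p; move: {2}(size p) (leqnn (size p)) => n.
    elim: n p z => [|n IH] p z; first by case: p => //= _ _ ->; rewrite !inE eqxx.
    case/lastP: p => [|p t]; first by move=> _ _ /= ->; rewrite !inE eqxx.
    rewrite size_rcons ltnS => lp; rewrite rcons_path last_rcons => /andP[pp lt] ->.
    have := IH _ _ lp pp erefl; rewrite !inE => /orP[]/eqP e; move: lt; rewrite e => lt.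
      by rewrite (mat _ _ _ lt xy) eqxx orbT.
    by rewrite semiadjC in xy; rewrite (mat _ _ _ lt xy) eqxx.
  exact: clo.
have sE: switch_edges T = [set [set x; y]].
  apply/setP => e; rewrite in_set1; apply/idP/eqP; last by move=> ->; apply: mem_switch_edges.
  rewrite inE => /existsP[u /existsP[v /andP[uv /eqP->]]].
  have /andP[] := in_Dset uv; rewrite DE !inE.
  have := proj1 (andP uv); move=> /eqP ne.
  by case/orP => /eqP h1; case/orP => /eqP h2; subst u v => //; rewrite setUC.
have c1: #|switch_edges T| = 1 by rewrite sE cards1.
by apply: (Dsmall xy) => //; apply: small.
Qed.

End Dclass.

(** * Bipartite trigraphs *)

Section Goals.
Variables (V : finType) (T : trigraph V).

Definition has_even_pair := exists u v, even_pair T u v.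
Definition has_free_even_pair :=
  exists u v, [/\ even_pair T u v, u \notin Dset T & v \notin Dset T].

Lemma Dset0_free : Dset T = set0 -> has_even_pair -> has_free_even_pair.
Proof. by move=> D0 [u [v h]]; exists u, v; rewrite D0 !inE. Qed.

Lemma favorable_not_complete : favorable T -> ~ complete T.
Proof.
case=> _ [u [v [uv _ _]]] _ c; move: uv; rewrite strongly_antiE => /andP[ne].
by rewrite c.
Qed.

End Goals.

Section Bipartite.
Variables (V : finType) (T : trigraph V) (A : {set V}).
Hypotheses (stA : strongly_stable T A) (stB : strongly_stable T (~: A)).

Lemma adjacent_sides u v : adjacent T u v -> (u \in A) = (v \notin A).
Proof.
rewrite adjacentE => /andP[ne]; apply: contraNeq.
case: (boolP (v \in A)) => vA /=; case: (boolP (u \in A)) => //= uA _.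
  exact: stA.
by apply: stB; rewrite ?inE.
Qed.

Lemma bip_odd u s : tpath T (u :: s) -> odd (size s) = (u \in A) (+) (last u s \in A).
Proof.
move/ipath_path; elim: s u => [|v s IH] u /=; first by rewrite addbb.
by case/andP => /adjacent_sides -> /IH ->; case: (v \in A); case: (_ \in A).
Qed.

Lemma bip_same u v : u != v -> (u \in A) = (v \in A) -> even_pair T u v.
Proof.
move=> ne e; apply: even_pairP.
  case: (boolP (u \in A)) => uA; first by apply: stA; rewrite -?e.
  by apply: stB; rewrite ?inE // -e.
by move=> s _ _ /bip_odd -> ->; rewrite e addbb.
Qed.

Lemma no_nbr_even u v : strongly_anti T u v -> (forall w, ~~ adjacent T u w) -> even_pair T u v.
Proof.
move=> uv h; apply: even_pairP => // -[|w s] //= _ _ /ipath_path /= /andP[].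
by rewrite (negbTE (h w)).
Qed.

(** If neither side has two vertices, then [u] and [v] are the only vertices, and no path joins
    them. *)
Lemma bip_even_pair : complete T \/ has_even_pair T.
Proof.
case: (complete_or T) => [|[u [v uv]]]; [by left|right].
have [/existsP[x /existsP[y /andP[ne /eqP e]]]|] :=
  boolP [exists x, exists y, (x != y) && ((x \in A) == (y \in A))].
  by exists x, y; apply: bip_same.
rewrite negb_exists => /forallP h.
have {}h x y : x != y -> (x \in A) != (y \in A).
  by move=> ne; move: (h x); rewrite negb_exists => /forallP/(_ y); rewrite ne.
have ne := strongly_anti_neq uv.
exists u, v; apply: no_nbr_even => // w; apply/negP => uw.
case: (eqVneq w v) uw => [->|wv uw]; first by rewrite adjacentE uv andbF.
have := h _ _ wv; have := h _ _ ne; have := h _ _ (adjacent_neq uw).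
by case: (u \in A); case: (v \in A); case: (w \in A).
Qed.

(** If no two vertices off the switchable component lie on the same side, then the trigraph consists
    of [Dset] and [u], [v]. Five vertices force the component to be light. *)
Lemma bip_free_even_pair : Dspec T -> favorable T -> has_free_even_pair T.
Proof.
move=> ds []  V5 [u [v [uv uD vD]]] _.
have ne := strongly_anti_neq uv.
have [/existsP[x /existsP[y /and5P[xy /eqP e xD yD _]]]|] :=
  boolP [exists x, exists y, [&& x != y, (x \in A) == (y \in A), x \notin Dset T, y \notin Dset T & true]].
  by exists x, y; split=> //; apply: bip_same.
rewrite negb_exists => /forallP h.
have {}h x y : x != y -> x \notin Dset T -> y \notin Dset T -> (x \in A) != (y \in A).
  move=> xy xD yD; move: (h x); rewrite negb_exists => /forallP/(_ y).
  by rewrite xy xD yD /= andbT.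
have cV: [set: V] = Dset T :|: [set u; v].
  apply/esym/setP => w; rewrite !inE; case: (boolP (w \in Dset T)) => wD; first by move: wD; rewrite inE => ->.
  move: (wD); rewrite inE => /negbTE -> /=.
  apply/negPn/negP; rewrite negb_or => /andP[wu wv].
  have := h _ _ wu wD uD; have := h _ _ wv wD vD; have := h _ _ ne uD vD.
  by case: (u \in A); case: (v \in A); case: (w \in A).
have cV5: 5 <= #|Dset T| + 2.
  rewrite -cardsT cV in V5; apply: (leq_trans V5); rewrite cardsU cards2 ne.
  exact: leq_subr.
case: ds => [D0|x y _ DE _ _|c x y xy cx cy DE lw sxy _].
- by move: cV5; rewrite D0 cards0.
- by move: cV5; rewrite DE cards2; case: (x != y).
have cN w : w \notin Dset T -> strongly_anti T c w by rewrite DE => /lw.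
have xA : (x \in A) = (c \notin A) by apply: adjacent_sides; rewrite adjacentC adjacentW cx orbT.
have yA : (y \in A) = (c \notin A) by apply: adjacent_sides; rewrite adjacentC adjacentW cy orbT.
have vA: (v \in A) = (u \notin A) by have := h _ _ ne uD vD; case: (u \in A); case: (v \in A).
(* The one of [u], [v] on the side of [x] and [y] is isolated: [c] has no neighbour off the
   component, and [x], [y] lie on its own side. *)
have iso z z' : [set u; v] = [set z; z'] -> (z \in A) != (c \in A) -> even_pair T z z'.
  move=> e zc; have zD : z \notin Dset T.
    have : z \in [set u; v] by rewrite e set21.
    by rewrite in_set2 => /orP[] /eqP->.
  have z'E : z' = if z == u then v else u.
    have: z \in [set u; v] by rewrite e set21.
    have: u \in [set z; z'] by rewrite -e set21.
    have: v \in [set z; z'] by rewrite -e set22.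
    rewrite !inE ![z == _]eq_sym; case: (eqVneq u z) => [<-|uz] /=.
      by rewrite eq_sym (negbTE ne) => /eqP.
    by move=> _ /eqP.
  have sz : strongly_anti T z z'.
    rewrite z'E; case: (eqVneq z u) => [->//|zu].
    have: z \in [set u; v] by rewrite e set21.
    by rewrite !inE (negbTE zu) => /eqP ->; rewrite strongly_antiC.
  apply: no_nbr_even => // w; apply/negP => zw.
  have wI : w \in Dset T :|: [set z; z'] by rewrite -e -cV inE.
  move: wI; rewrite DE !in_setU !in_set1 -!orbA => /or4P[/eqP e1|/eqP e1|/eqP e1|/orP[/eqP e1|/eqP e1]]; subst w.
  - by move: zw; rewrite adjacentC adjacentE cN ?andbF.
  - by move: zw => /adjacent_sides; rewrite xA negbK => e1; rewrite e1 eqxx in zc.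
  - by move: zw => /adjacent_sides; rewrite yA negbK => e1; rewrite e1 eqxx in zc.
  - by move: (adjacent_neq zw); rewrite eqxx.
  - by move: zw; rewrite adjacentE sz andbF.
case: (boolP ((u \in A) == (c \in A))) => uc.
  exists v, u; split => //; apply: iso; first by rewrite setUC.
  by rewrite vA (eqP uc); case: (c \in A).
by exists u, v; split => //; apply: iso.
Qed.

End Bipartite.

(** * Bisimplicial edges of bipartite graphs without long holes *)

Definition nonrel (V : eqType) (e : rel V) : rel V := fun u v => (u != v) && ~~ e u v.

Lemma split_last (T : Type) (P : pred T) s : has P s ->
  exists s1 w s2, [/\ s = s1 ++ w :: s2, P w & ~~ has P s2].
Proof.
elim: s => //= x s IH; case: (boolP (has P s)) => [/IH[s1 [w [s2 [-> Pw h]]]] _|h].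
  by exists (x :: s1), w, s2.
by rewrite orbF => Px; exists [::], x, s.
Qed.

Lemma path_targets (T : Type) (e : rel T) (P : pred T) x p :
  (forall u v, e u v -> P v) -> path e x p -> all P p.
Proof. by move=> h; elim: p x => //= y p IH x /andP[/h -> /IH]. Qed.

Section Shortest.
Variables (V : finType) (r : rel V).
Implicit Types (x y : V).

(** The tail is made induced first. Then either it passes through [x], and the part from [x] on is
    kept, or [x] jumps to its last neighbour on it. *)
Lemma shortest_path x p : path r x p ->
  exists p', [/\ ipath r (nonrel r) (x :: p'), uniq (x :: p') & last x p' = last x p].
Proof.
elim: p x => [|z p IH] x /=; first by exists [::].
case/andP => xz /IH[p' [ip up <-]].
case: (boolP (x \in z :: p')) => [xp|xp].
  have [s1 [s2 e]] : exists s1 s2, z :: p' = s1 ++ x :: s2.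
    by case/splitPr: xp => s1 s2; exists s1, s2.
  rewrite e in ip up; exists s2; split.
  - by case/ipath_cat/andP: ip.
  - by move: up; rewrite cat_uniq => /and3P[].
  - by have := congr1 (last x) e; rewrite last_cat /= => ->.
have /split_last[s1 [w [s2 [e xw ns]]]] : has (r x) (z :: p') by rewrite /= xz.
rewrite e in ip up xp; exists (w :: s2); split.
- case/ipath_cat/andP: ip => _ ip; apply/and3P; split => //.
  apply/allP => y ys; rewrite /nonrel; apply/andP; split.
    by apply: contraNneq xp => ->; rewrite mem_cat inE ys !orbT.
  by apply: contraNN ns => xy; apply/hasP; exists y.
- move: xp up; rewrite mem_cat negb_or cat_uniq => /andP[_ h] /and3P[_ _ h'].
  by apply/andP; split.
- by have := congr1 (last x) e; rewrite last_cat /= => ->.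
Qed.

Lemma shortest_connect x y : connect r x y ->
  exists p, [/\ ipath r (nonrel r) (x :: p), uniq (x :: p) & last x p = y].
Proof. by case/connectP => p /shortest_path[p' [h1 h2 h3]] ->; exists p'. Qed.

End Shortest.

(** * Holes from induced paths *)

Section MkHole.
Variables (V : finType) (T : trigraph V).

Lemma ipath_nth (a n : rel V) s x0 i j : ipath a n s -> i < j -> j < size s ->
  (j = i.+1 -> a (nth x0 s i) (nth x0 s j)) /\ (j <> i.+1 -> n (nth x0 s i) (nth x0 s j)).
Proof.
elim: s i j => // x [|y t] IH i j; first by case: j i => [|j] [].
case/and3P => xy xt ip; case: j => // j; case: i => [|i] ij jl; last first.
  by have [h1 h2] := IH i j ip ij jl; split => e; [apply: h1 | apply: h2]; lia.
split=> [[->]//|ne]; case: j jl ij ne => [|j] // jl _ _ /=.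
by apply: (allP xt); apply: mem_nth; move: jl => /=; lia.
Qed.

(** The vertex [y] closes the path from [x] to [l]; two inner vertices in [q] make the length at
    least five. *)
Lemma mk_hole y x q l : tpath T (x :: rcons q l) -> adjacent T y x -> adjacent T y l ->
  all (antiadjacent T y) q -> uniq (y :: x :: rcons q l) -> 2 <= size q ->
  is_hole T (y :: x :: rcons q l).
Proof.
move=> ip yx yl yq un q2; split; first by rewrite /= size_rcons; lia.
split => // x0.
set s := _ :: _.
have nthlt i j : i < j -> j < size s ->
   (cyc_consec (size s) i j -> adjacent T (nth x0 s i) (nth x0 s j)) /\
   (~~ cyc_consec (size s) i j -> antiadjacent T (nth x0 s i) (nth x0 s j)).
  rewrite /cyc_consec /= size_rcons; case: j => // j; case: i => [|i] ij jl.
    case: j ij jl => [|j] _ jl /=; first by split => //; lia.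
    rewrite nth_rcons; case: (ltnP j (size q)) => jq.
      split; first lia; move=> _; apply: (allP yq); exact: mem_nth.
    by have -> : j == size q; [lia | split => //; lia].
  have [h1 h2] := ipath_nth x0 ip (i := i) (j := j) ij ltac:(by rewrite /= size_rcons).
  by split => c; [apply: h1 | apply: h2]; lia.
move=> i j li lj ne; case: (ltngtP i j) => // ij; first exact: nthlt.
  have [h1 h2] := nthlt _ _ ij li.
  rewrite adjacentC antiadjacentC; move: h1 h2; rewrite /cyc_consec.
  move=> h1 h2; split => c; [apply: h1 | apply: h2]; lia.
by move: ne; rewrite ij eqxx.
Qed.

End MkHole.

Section Bisimplicial.
Variables (V : finType) (e : rel V) (sd : V -> bool).
Hypotheses (eC : symmetric e) (e_sd : forall x y, e x y -> sd x != sd y).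
Hypothesis noHole : forall y x q l, ipath e (nonrel e) (x :: rcons q l) ->
  e y x -> e y l -> all (nonrel e y) q -> uniq (y :: x :: rcons q l) -> 2 <= size q -> False.

Implicit Types (W X : {set V}).

Definition far W X := [set w in W | (w \notin X) && [forall x in X, ~~ e x w]].
Definition sub_conn X := [forall x in X, forall y in X, connect (fun a b => [&& a \in X, b \in X & e a b]) x y].
Definition spread W X := [&& X \subset W, X != set0, sub_conn X &
  [exists a in far W X, exists b in far W X, e a b]].

Lemma farP W X w : reflect [/\ w \in W, w \notin X & forall x, x \in X -> ~~ e x w] (w \in far W X).
Proof.
rewrite inE; apply: (iffP and3P) => -[h1 h2 h3]; split=> //.
  by move=> x xX; move/forallP/(_ x): h3; rewrite xX.
by apply/forallP => x; apply/implyP => /h3.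
Qed.

(* A nonadjacent pair of opposite sides attached to both ends of an edge far from the
   connected set [X] closes up, through [X], to a hole of length at least six. *)
Lemma attachments_complete W X s t a b : sub_conn X -> s \notin X -> t \notin X ->
  (exists2 x, x \in X & e s x) -> (exists2 y, y \in X & e t y) ->
  a \in far W X -> b \in far W X -> e a b -> e b s -> e a t -> e s t.
Proof.
move=> cX sX tX [x xX sx] [y yX ty] /farP[_ aX aF] /farP[_ bX bF] ab bs at_.
apply/negPn/negP => st.
pose r : rel V := fun u v => [&& u \in s |: (t |: X), v \in s |: (t |: X) & e u v].
have : connect r t s.
  apply: (@connect_trans _ _ y); first by apply: connect1; rewrite /r !inE eqxx yX ty !orbT.
  apply: (@connect_trans _ _ x); last by apply: connect1; rewrite /r !inE eqxx xX eC sx !orbT.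
  move/forall_inP/(_ y yX)/forall_inP/(_ x xX): cX.
  apply: connect_sub => u v /and3P[uX vX uv]; apply: connect1.
  by rewrite /r !inE uX vX uv !orbT.
case/shortest_connect => p [ip up lp].
have sub z : z \in t :: p -> z \in s |: (t |: X).
  have: path r t p by apply: ipath_path ip.
  move=> pp; rewrite inE => /orP[/eqP->|]; first by rewrite !inE eqxx orbT.
  by apply: (allP (path_targets _ pp)) => u v /and3P[].
have ts : t != s by apply: contraNneq st => e1; move: (e_sd bs) (e_sd at_) (e_sd ab); rewrite e1; case: (sd a); case: (sd b); case: (sd s).
case/lastP: p ip up lp sub => [|p l]; first by move=> _ _ /= e1; rewrite e1 eqxx in ts.
rewrite last_rcons => ip up ls sub; subst l.
have pX z : z \in p -> z \in X.
  move=> zp; have: z \in s |: (t |: X) by apply: sub; rewrite inE mem_rcons inE zp !orbT.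
  rewrite !inE => /or3P[/eqP zs|/eqP zt|//]; subst z; move: up.
    by rewrite cons_uniq rcons_uniq zp /= andbF.
  by rewrite cons_uniq mem_rcons inE zp orbT.
have inr : {in t :: rcons p s &, forall u v, r u v = e u v}.
  by move=> u v /sub us /sub vs; rewrite /r us vs.
have ip' : ipath e (nonrel e) (t :: rcons p s).
  elim: (t :: rcons p s) ip inr => // z1 [|z2 l] IH // /and3P[h1 h2 h3] inr.
  apply/and3P; split.
  - by rewrite -inr ?inE ?eqxx ?orbT.
  - apply/allP => w wl; have := allP h2 _ wl; rewrite /nonrel inr //.
      by rewrite inE eqxx.
    by rewrite !inE wl !orbT.
  - by apply: IH => // u v ul vl; apply: inr; rewrite inE ?ul ?vl orbT.
have sda : sd s = sd a by have := e_sd ab; have := e_sd bs; case: (sd a); case: (sd b); case: (sd s).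
have sdb : sd t = sd b by have := e_sd ab; have := e_sd at_; case: (sd a); case: (sd b); case: (sd t).
have nes u v : sd u = sd v -> ~~ e u v by move=> h; apply/negP => /e_sd; rewrite h eqxx.
have neX u v : u \in X -> v \notin X -> v != u by move=> uX; apply: contraNneq => ->.
have sa : a != s by apply: contraTneq xX => e1; apply/negP => /aF; rewrite eC e1 sx.
have tb : b != t by apply: contraTneq yX => e1; apply/negP => /bF; rewrite eC e1 ty.
have ta : a != t by apply: contraTneq at_ => ->; apply: nes.
have bns : b != s by apply: contraTneq bs => ->; apply: nes.
have ab' : b != a by apply: contraTneq ab => ->; apply: nes.
(* The hole is [b], [a], [t], [p], [s]; the part [p] inside [X] is nonempty because [s] and [t] are
   not adjacent. *)
apply: (@noHole b a (t :: p) s).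
- apply/and3P; split => //; apply/allP => z; rewrite mem_rcons inE /nonrel => /orP[/eqP->|zp].
    by rewrite sa nes.
  by rewrite (neX _ _ (pX _ zp) aX) eC (aF _ (pX _ zp)).
- by rewrite eC.
- done.
- apply/andP; split; first by rewrite /nonrel tb nes.
  by apply/allP => z zp; rewrite /nonrel (neX _ _ (pX _ zp) bX) eC (bF _ (pX _ zp)).
- rewrite rcons_cons.
  have apX: a \notin p by apply: contraNN aX => /pX.
  have bpX: b \notin p by apply: contraNN bX => /pX.
  move: up => /= up; rewrite up andbT !inE !mem_rcons !inE !negb_or.
  by rewrite ab' tb bns ta sa apX bpX.
case: p ip' {ip up sub pX inr} => //=; rewrite andbT.
by rewrite eC (negbTE st).
Qed.

(** As [e] is bipartite, this says that the edge [u v] is not the middle edge of an induced path on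
    four vertices of [W]. In the complement such a path becomes a path of length three from [u] to
    [v]. *)
Definition bisimplicial W u v :=
  [/\ u \in W, v \in W, e u v & forall a b, a \in W -> b \in W -> e v a -> e u b -> e a b].

Lemma bisimplicial_edge W u0 v0 : u0 \in W -> v0 \in W -> e u0 v0 -> exists u v, bisimplicial W u v.
Proof.
move: {2}#|W| (leqnn #|W|) => n; elim: n W u0 v0 => [|n IH] W u0 v0 cW u0W v0W uv0.
  by move: cW; rewrite leqn0 cards_eq0 => /eqP e0; rewrite e0 inE in u0W.
have [/existsP[X0 sX0]|] := boolP [exists X, spread W X]; last first.
  rewrite negb_exists => /forallP ns.
  pose nbr b := [set a in W | e b a].
  pose P b := (b \in W) && (nbr b != set0).
  have Pu0 : P u0 by rewrite /P u0W; apply/set0Pn; exists v0; rewrite inE v0W.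
  case: (arg_minnP (fun b => #|nbr b|) Pu0) => b /andP[bW /set0Pn[a]].
  rewrite inE => /andP[aW ba] minb; exists b, a; split=> // b' a' b'W a'W ab' ba'.
  apply/negPn/negP => nb'a'.
  have nb' : P b' by rewrite /P b'W; apply/set0Pn; exists a; rewrite inE aW eC.
  (* Since [a'] is in [nbr b] but not in [nbr b'], minimality gives a neighbour [a''] of [b'] that
     misses [b]. The edge [b' a''] is then far from the edge [b a']. *)
  have: ~~ (nbr b' \subset nbr b).
    apply/negP => sub; have := minb _ nb'; rewrite leqNgt => /negP; apply.
    apply: proper_card; apply/properP; split=> //; exists a'; rewrite !inE ?a'W ?ba' //=.
  case/subsetPn => a''; rewrite !inE => /andP[a''W b'a'']; rewrite a''W /= => nba''.
  have := ns [set b; a']; rewrite /spread; case/negP.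
  have sdb : sd b' = sd b by have := e_sd ab'; have := e_sd ba; case: (sd a); case: (sd b); case: (sd b').
  have sda' : sd a' = ~~ sd b by have := e_sd ba'; case: (sd a'); case: (sd b).
  have sda'' : sd a'' = ~~ sd b by have := e_sd b'a''; rewrite sdb; case: (sd a''); case: (sd b).
  have nes u v : sd u = sd v -> ~~ e u v by move=> h; apply/negP => /e_sd; rewrite h eqxx.
  apply/and4P; split.
  - by apply/subsetP => z; rewrite !inE => /orP[]/eqP->.
  - by apply/set0Pn; exists b; rewrite !inE eqxx.
  - apply/forall_inP => x; rewrite !inE => hx; apply/forall_inP => y; rewrite !inE => hy.
    case/orP: hx => /eqP->; case/orP: hy => /eqP->; rewrite ?connect0 //; apply: connect1;
      by rewrite !inE !eqxx !orbT // eC.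
  - apply/exists_inP; exists b'.
      apply/farP; split=> //.
        rewrite !inE; apply/norP; split.
          by apply: contraNneq nba'' => <-.
        by apply/eqP => e1; move: sdb; rewrite e1 sda'; case: (sd b).
      move=> x; rewrite !inE => /orP[]/eqP->; first exact: nes.
      by apply: contraNN nb'a'; rewrite eC.
    apply/exists_inP; exists a'' => //.
    apply/farP; split=> //.
      rewrite !inE; apply/norP; split.
        by apply/eqP => e1; move: sda''; rewrite e1; case: (sd b).
      by apply: contraNneq nba'' => ->.
    by move=> x; rewrite !inE => /orP[]/eqP-> //; apply: nes; rewrite sda'.
case: (arg_maxnP (fun X : {set V} => #|X|) sX0) => X sX maxX {X0 sX0}.
case/and4P: (sX) => XW X0 cX /exists_inP[a0 a0F /exists_inP[b0 b0F ab0]].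
(* Isolated vertices of the far part are dropped. A neighbour of [C] outside [C] is therefore not
   far, so it is adjacent to [X]. *)
pose C := [set a in far W X | [exists b in far W X, e a b]].
have CF z : z \in C -> z \in far W X by rewrite inE => /andP[].
have FW z : z \in far W X -> z \in W by case/farP.
have a0C : a0 \in C by rewrite inE a0F; apply/exists_inP; exists b0.
have b0C : b0 \in C by rewrite inE b0F; apply/exists_inP; exists a0; rewrite // eC.
have prC : #|C| < #|W|.
  apply: proper_card; apply/properP; split; first by apply/subsetP => z /CF /FW.
  case/set0Pn: X0 => x xX; exists x; first by apply: (subsetP XW).
  by apply/negP => /CF /farP[_ /negP].
have [u [v [uC vC uv bs]]] := IH C a0 b0 (leq_trans prC cW) a0C b0C ab0.
have att s z : z \in C -> s \in W -> e z s -> s \notin C ->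
    [/\ s \notin X, (exists2 x, x \in X & e s x) & forall a b, a \in C -> b \in C -> e a b -> sd a != sd s -> e a s].
  move=> zC sW zs sC; have [zW zX zF] := farP _ _ _ (CF _ zC).
  have sX' : s \notin X by apply/negP => /zF; rewrite eC zs.
  have [x xX sx] : exists2 x, x \in X & e s x.
    have sF : s \notin far W X.
      apply: contraNN sC => sF; rewrite inE sF; apply/exists_inP; exists z; first exact: CF.
      by rewrite eC.
    move: sF; rewrite inE sW sX' /= negb_forall => /existsP[x]; rewrite negb_imply negbK => /andP[xX xs].
    by exists x; rewrite // eC.
  split=> //; first by exists x.
  move=> a b aC bC ab sdas; apply/negPn/negP => nas.
  have : #|s |: X| <= #|X|.
    apply: maxX; apply/and4P; split.
    - by rewrite subUset sub1set sW.
    - by apply/set0Pn; exists s; rewrite !inE eqxx.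
    - have lift1 y1 y2 : y1 \in X -> y2 \in X -> connect (fun a0 b1 => [&& a0 \in s |: X, b1 \in s |: X & e a0 b1]) y1 y2.
        move=> h1 h2; move/forall_inP/(_ y1 h1)/forall_inP/(_ y2 h2): cX.
        apply: connect_sub => w1 w2 /and3P[k1 k2 k3]; apply: connect1.
        by rewrite !inE k1 k2 k3 !orbT.
      apply/forall_inP => y1; rewrite !inE => /orP[/eqP->|h1]; apply/forall_inP => y2; rewrite !inE => /orP[/eqP->|h2].
      + exact: connect0.
      + apply: (connect_trans _ (lift1 x y2 xX h2)); apply: connect1.
        by rewrite !inE eqxx xX sx orbT.
      + apply: (connect_trans (lift1 y1 x h1 xX)); apply: connect1.
        by rewrite !inE eqxx xX eC sx orbT.
      + exact: lift1.
    - apply/exists_inP; exists a; [|apply/exists_inP; exists b => //].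
        have [aW aX aF] := farP _ _ _ (CF _ aC).
        apply/farP; split=> //.
          rewrite !inE negb_or aX andbT.
          by apply: contraNneq sC => <-.
        by move=> y; rewrite !inE => /orP[/eqP->|/aF//]; rewrite eC.
      have [bW bX bF] := farP _ _ _ (CF _ bC).
      apply/farP; split=> //.
        rewrite !inE negb_or bX andbT.
        by apply: contraNneq sC => <-.
      move=> y; rewrite !inE => /orP[/eqP->|/bF//].
      apply/negP => /e_sd; have := e_sd ab; move: sdas.
      by case: (sd a); case: (sd b); case: (sd s).
  by rewrite cardsU1 sX' add1n ltnn.
exists u, v; split=> //; [exact/FW/CF|exact/FW/CF|].
move=> a b aW bW va ub.
have sua : sd u = sd a by have := e_sd uv; have := e_sd va; case: (sd a); case: (sd u); case: (sd v).
have svb : sd v = sd b by have := e_sd uv; have := e_sd ub; case: (sd b); case: (sd u); case: (sd v).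
have sab : sd a != sd b by rewrite -sua -svb; apply: e_sd.
have vu : e v u by rewrite eC.
case: (boolP (a \in C)) => aC; case: (boolP (b \in C)) => bC.
- exact: bs.
- have [_ _] := att _ _ uC bW ub bC.
  by apply; [exact: aC|exact: vC| rewrite eC|].
- have [_ _] := att _ _ vC aW va aC; rewrite [e a b]eC.
  by apply; [exact: bC|exact: uC| rewrite eC| rewrite eq_sym].
have [aX aXe _] := att _ _ vC aW va aC.
have [bX bXe _] := att _ _ uC bW ub bC.
by apply: (attachments_complete (W := W) (X := X) (a := u) (b := v)) => //; apply: CF.
Qed.

End Bisimplicial.

(** * Complements of bipartite trigraphs *)

Section CoBipartite.
Variables (V : finType) (T : trigraph V).
Hypothesis noAH : forall s, ~ is_antihole T s.

Definition co_bip (A : {set V}) := strongly_stable (compl T) A /\ strongly_stable (compl T) (~: A).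

Lemma co_bipC A : co_bip A -> co_bip (~: A).
Proof. by case=> h1 h2; split; rewrite // setCK. Qed.

Lemma anti_sides A u v : co_bip A -> antiadjacent T u v -> (u \in A) = (v \notin A).
Proof. by case=> h1 h2; rewrite -adjacent_compl; apply: adjacent_sides. Qed.

Lemma same_side_adj A u v : co_bip A -> u != v -> (u \in A) = (v \in A) -> strongly_adj T u v.
Proof.
move=> cA ne e; rewrite strongly_adjE ne; apply/negP => /(anti_sides cA).
by rewrite e; case: (v \in A).
Qed.

(* Three pairwise antiadjacent vertices cannot exist, so an odd path has length three. *)
Lemma co_bip_even A u v : co_bip A -> strongly_anti T u v ->
  (forall a b, adjacent T u a -> adjacent T a b -> adjacent T b v ->
     antiadjacent T u b -> antiadjacent T a v -> False) -> even_pair T u v.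
Proof.
move=> cA uv no4; apply: even_pairP => // s _ _.
case: s => [|a [|b [|c s]]] //= p lv; rewrite ?lv //.
  by case/andP: p => h _; move: uv; rewrite -lv strongly_antiE h andbF.
case/and3P: p => ua /andP[ub nus] /and3P[ab /andP[ac nas] ip].
case: s nus nas ip lv => [|d s] nus nas ip lv.
  move: lv => /= lv; subst c; case/andP: ip => bc _.
  by have := no4 a b; rewrite ua ab ub; case.
case/and3P: ip => bc nbs _.
have bv: antiadjacent T b v.
  by rewrite -lv; apply: (allP nbs) => /=; rewrite mem_last.
have := anti_sides cA bv; have := anti_sides cA ub; have := anti_sides cA (strongly_antiW uv).
by case: (u \in A); case: (b \in A); case: (v \in A).
Qed.

Lemma co_bip_even_pair0 A : co_bip A -> (forall u v, ~~ semiadj T u v) ->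
  ~ complete T -> has_even_pair T.
Proof.
move=> cA ns nc; have [u0 [v0 uv0]] := not_complete_anti nc.
have anE : antiadjacent T =2 strongly_anti T.
  by move=> u v; rewrite antiadjacentW (negbTE (ns _ _)) orbF.
have sdP x y : antiadjacent T x y -> (x \in A) != (y \in A).
  by move/(anti_sides cA) => ->; case: (y \in A).
have noH y x q l : ipath (antiadjacent T) (nonrel (antiadjacent T)) (x :: rcons q l) ->
    antiadjacent T y x -> antiadjacent T y l -> all (nonrel (antiadjacent T) y) q ->
    uniq (y :: x :: rcons q l) -> 2 <= size q -> False.
  have sub a b : nonrel (antiadjacent T) a b -> antiadjacent (compl T) a b.
    by case/andP => ne; rewrite antiadjacent_compl anE adjacentE ne.
  move=> ip yx yl yq un q2; apply: (noAH (@mk_hole _ (compl T) _ _ _ _ _ _ _ _ un q2)).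
  - by apply: sub_ipath ip => // a b; rewrite adjacent_compl.
  - by rewrite adjacent_compl.
  - by rewrite adjacent_compl.
  - by apply: sub_all yq => z; apply: sub.
have [u [v [_ _ uv bis]]] := bisimplicial_edge (@antiadjacentC _ T) sdP noH
  (in_setT u0) (in_setT v0) (strongly_antiW uv0).
exists u, v; apply: (co_bip_even cA); first by rewrite -anE.
move=> a b _ ab _ ub av.
have := bis a b (in_setT _) (in_setT _); rewrite antiadjacentC av ub => /(_ isT isT).
by rewrite anE strongly_antiE ab andbF.
Qed.

(** Smallness makes [x] and [y] strongly antiadjacent to all other vertices of the opposite side.
    With [b] on the side of [y] having fewest antineighbours in [A] other than [x], the pair [x],
    [b] is even: a path [x], [a], [b'], [b] would have [a] antiadjacent to both [b] and [b']. *)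
Lemma co_bip_small_pair A x y b0 : co_bip A -> semiadj T x y -> Dset T = [set x; y] ->
  N T x :&: N T y = set0 -> x \in A -> y \notin A -> b0 \notin A -> b0 != y ->
  has_even_pair T.
Proof.
move=> cA sxy DE Nxy xA yA b0A b0y.
have xA_y z : z \in A -> z != x -> strongly_anti T z y.
  move=> zA zx; have xz : adjacent T x z.
    by apply: strongly_adjW; apply: (same_side_adj cA); rewrite ?zA // eq_sym.
  rewrite strongly_antiE; apply/andP; split; first by apply: contraNneq yA => <-.
  by apply/negP => zy; move/setP/(_ z): Nxy; rewrite !inE xz adjacentC zy.
have yB_x z : z \notin A -> z != y -> strongly_anti T z x.
  move=> zA zx; have yz : adjacent T y z.
    by apply: strongly_adjW; apply: (same_side_adj cA); rewrite ?(negbTE zA) ?(negbTE yA) // eq_sym.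
  rewrite strongly_antiE; apply/andP; split; first by apply: contraNneq zA => ->.
  by apply/negP => zy; move/setP/(_ z): Nxy; rewrite !inE yz adjacentC zy.
pose nb b := [set a in A | (a != x) && antiadjacent T a b].
pose P b := (b \notin A) && (b != y).
have Pb0 : P b0 by rewrite /P b0A.
case: (arg_minnP (fun b => #|nb b|) Pb0) => b /andP[bA byy] minb.
(* If [a] is not antiadjacent to [b'], minimality of [b] gives an antineighbour [a'] of [b'] that is
   not one of [b]. *)
have cl a b' : a \in nb b -> P b' -> antiadjacent T a b'.
  move=> anb Pb'; apply/negPn/negP => nab'.
  have: ~~ (nb b' \subset nb b).
    apply/negP => sub; have := minb _ Pb'; rewrite leqNgt => /negP; apply.
    apply: proper_card; apply/properP; split=> //; exists a => //.
    by rewrite !inE (negbTE nab') !andbF.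
  case/subsetPn => a'; move: anb; rewrite !inE => /and3P[aA ax ab] /and3P[a'A a'x a'b'].
  rewrite a'A a'x /= => na'b; case/andP: Pb' => b'A b'y.
  have ad u v : u != v -> ~~ antiadjacent T u v -> adjacent T u v.
    by move=> ne; rewrite antiadjacentE ne negbK; apply: strongly_adjW.
  have adA u v : u \in A -> v \in A -> u != v -> adjacent T u v.
    by move=> uA vA ne; apply: strongly_adjW; apply: (same_side_adj cA); rewrite ?uA ?vA.
  have adB u v : u \notin A -> v \notin A -> u != v -> adjacent T u v.
    by move=> uA vA ne; apply: strongly_adjW; apply: (same_side_adj cA); rewrite ?(negbTE uA) ?(negbTE vA).
  have neAB u v : u \in A -> v \notin A -> u != v by move=> uA; apply: contraNneq => <-.
  have aa' : a != a' by apply: contraNneq nab' => ->.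
  have bb' : b != b' by apply: contraNneq nab' => <-.
  have xy : adjacent T x y by rewrite adjacentW sxy orbT.
  have anbx : antiadjacent T b x := strongly_antiW (yB_x _ bA byy).
  have anxb' : antiadjacent T x b' by rewrite antiadjacentC (strongly_antiW (yB_x _ b'A b'y)).
  have anb'a' : antiadjacent T b' a' by rewrite antiadjacentC.
  have anya : antiadjacent T y a by rewrite antiadjacentC (strongly_antiW (xA_y _ aA ax)).
  have anya' : antiadjacent T y a' by rewrite antiadjacentC (strongly_antiW (xA_y _ a'A a'x)).
  have adba' : adjacent T b a' by rewrite adjacentC ad // neAB.
  have adyx : adjacent T y x by rewrite adjacentC.
  have h1 : tpath (compl T) [:: a; b; x; b'; a'].
    rewrite /tpath /= !adjacent_compl !antiadjacent_compl ab anbx anxb' anb'a' adba'.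
    by rewrite (adA a x) // (adA a a') // (ad a b') ?neAB // (adB b b') // (adA x a') // eq_sym.
  (* The cycle [y], [a], [b], [x], [b'], [a'] of antiadjacent pairs is an antihole of length six. *)
  apply: (noAH (@mk_hole _ (compl T) y a [:: b; x; b'] a' h1 _ _ _ _ _)) => //.
  - by rewrite adjacent_compl.
  - by rewrite adjacent_compl.
  - by rewrite /= !antiadjacent_compl adyx (adB y b) // 1?eq_sym // (adB y b') // eq_sym.
  - have neBA u v : u \notin A -> v \in A -> u != v by rewrite eq_sym => *; apply: neAB.
    have a'x' : x != a' by rewrite eq_sym.
    rewrite /= !inE !negb_or aa' ax bb' ![y == b]eq_sym ![y == b']eq_sym byy b'y a'x' /= !andbT.
    rewrite (neBA y a yA aA) (neBA y x yA xA) (neBA y a' yA a'A) (neAB a b aA bA).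
    by rewrite (neAB a b' aA b'A) (neBA b x bA xA) (neBA b a' bA a'A) (neAB x b' xA b'A) neBA.
have xD : x \in Dset T by rewrite DE set21.
exists x, b; apply: (co_bip_even cA).
  by rewrite strongly_antiC; apply: yB_x.
move=> a b' xa ab' b'b xb' ab.
have aA : a \in A by rewrite (anti_sides cA ab) bA.
have b'A : b' \notin A by rewrite -(anti_sides cA xb').
have ax : a != x by rewrite eq_sym (adjacent_neq xa).
case: (eqVneq b' y) => [e1|b'y].
  by have := xA_y _ aA ax; rewrite -e1 strongly_antiE ab' andbF.
have aD : a \notin Dset T.
  by rewrite DE !inE negb_or ax; apply: contraNneq yA => <-.
have : antiadjacent T a b'.
  by apply: cl; rewrite ?inE ?aA ?ax ?ab // /P b'A.
by move/(notin_Dset_anti aD); rewrite strongly_antiE ab' andbF.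
Qed.

Lemma co_bip_pairs : bipartite (compl T) -> Dspec T ->
  (complete T \/ has_even_pair T) /\ (favorable T -> has_free_even_pair T).
Proof.
move=> [A cA] ds.
have [cT|nc] := complete_dec T.
  by split; [left | move=> /favorable_not_complete].
case: ds => [D0 ns|x y sxy DE Nxy sw|c x y xy cx cy _ _ sxy _].
- have h := co_bip_even_pair0 cA ns nc.
  by split; [right|move=> _; apply: Dset0_free].
- have sd : (x \in A) = (y \notin A).
    by apply: (anti_sides cA); rewrite antiadjacentW sxy orbT.
  have syx : semiadj T y x by rewrite semiadjC.
  split.
    right.
    have [z zx zy] : exists2 z, z != x & z != y.
      have [/existsP[z /andP[]]|] := boolP [exists z, (z != x) && (z != y)]; first by exists z.
      rewrite negb_exists => /forallP h; case: nc => u v _ _ ne.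
      move: (h u) (h v); rewrite !negb_and !negbK.
      have axy : adjacent T x y by rewrite adjacentW sxy orbT.
      by case/orP => /eqP e1; case/orP => /eqP e2; subst u v; rewrite ?eqxx // ?axy // adjacentC axy in ne *.
    (* The end of the switchable pair on the side of [z] takes the role of [y] in
       [co_bip_small_pair]. *)
    case: (boolP (x \in A)) sd => xA; case: (boolP (y \in A)) => yA // _;
      case: (boolP (z \in A)) => zA.
    + apply: (@co_bip_small_pair (~: A) y x z) => //; rewrite ?inE ?negbK //; first exact: co_bipC.
      * by rewrite DE setUC.
      * by rewrite setIC.
    + exact: (@co_bip_small_pair A x y z).
    + by apply: (@co_bip_small_pair (~: A) x y z) => //; rewrite ?inE ?negbK //; exact: co_bipC.
    + by apply: (@co_bip_small_pair A y x z) => //; [rewrite DE setUC | rewrite setIC].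
  case=> _ _ /(_ x y sw sxy).
  (* The vertices off the component that miss [w] lie on the side opposite to [w], hence form a
     clique; so the trigraph is not favorable. *)
  have cl w : w \in Dset T -> clique T (~: (Dset T :|: N T w)).
    move=> wD a b; rewrite !in_setC !in_setU !negb_or ![_ \in N T _]inE => /andP[aD nwa] /andP[bD nwb] ne.
    have opp z : z \notin Dset T -> ~~ adjacent T w z -> (z \in A) = (w \notin A).
      move=> zD nwz; have wz : w != z by apply: contraNneq zD => <-.
      case e : (z \in A); case e': (w \in A) => //=; case/negP: nwz;
        apply: strongly_adjW; apply: (same_side_adj cA) => //; by rewrite e e'.
    by apply: strongly_adjW; apply: (same_side_adj cA); rewrite // (opp a) // (opp b).
  by rewrite DE in cl *; case; case; apply: cl; rewrite ?set21 ?set22.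
- move: sxy; rewrite strongly_antiE => /andP[ne] /negP; case.
  apply: strongly_adjW; apply: (same_side_adj cA) => //.
  have h1 : (c \in A) = (x \notin A) by apply: (anti_sides cA); rewrite antiadjacentW cx orbT.
  have h2 : (c \in A) = (y \notin A) by apply: (anti_sides cA); rewrite antiadjacentW cy orbT.
  by move: h1 h2; case: (c \in A); case: (x \in A); case: (y \in A).
Qed.
End CoBipartite.

(** * Doubled graphs *)

Lemma card_le1_inj (U : finType) (A : {set U}) : #|A| <= 1 ->
  forall a b, a \in A -> b \in A -> a = b.
Proof. by move/card_le1_eqP => h a b aA bA; apply: h. Qed.

Lemma card_le2_third (U : finType) (A : {set U}) : #|A| <= 2 ->
  forall a b c, a \in A -> b \in A -> c \in A -> a != b -> a != c -> b = c.
Proof.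
move=> cA a b c aA bA cA' ab ac; apply/eqP/negPn/negP => bc.
have: #|[set a; b; c]| <= #|A|.
  by apply: subset_leq_card; apply/subsetP => z; rewrite !inE -orbA => /or3P[]/eqP->.
rewrite setUC cardsU1 cards2 ab !inE negb_or ![c == _]eq_sym ac bc /=.
by move/leq_trans/(_ cA).
Qed.

Section Doubled.
Variables (V : finType) (T : trigraph V) (X : {set V}).
Implicit Types (u v w x y z : V).
Hypothesis gpX : good_partition T X.
Hypothesis noAH : forall s, ~ is_antihole T s.

Lemma X_nbr x a b : x \in X -> a \in X -> b \in X -> adjacent T x a -> adjacent T x b -> a = b.
Proof.
case: gpX => c2 _ _ _ xX aX bX xa xb; apply: (card_le2_third (c2 _ xX)) (adjacent_neq xa) (adjacent_neq xb).
- by rewrite inE connect0.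
- by rewrite inE connect1 // xX aX.
- by rewrite inE connect1 // xX bX.
Qed.

Lemma Y_antinbr x a b : x \notin X -> a \notin X -> b \notin X ->
  antiadjacent T x a -> antiadjacent T x b -> a = b.
Proof.
case: gpX => _ c2 _ _ xX aX bX xa xb.
have xY : x \in ~: X by rewrite inE.
apply: (card_le2_third (c2 _ xY)) (antiadjacent_neq xa) (antiadjacent_neq xb).
- by rewrite inE connect0.
- by rewrite inE connect1 // !in_setC xX aX.
- by rewrite inE connect1 // !in_setC xX bX.
Qed.

Lemma cross_strong x y : x \in X -> y \notin X -> adjacent T x y -> strongly_adj T x y.
Proof.
case: gpX => _ _ ns _ xX yX; rewrite adjacentW => /orP[//|].
by rewrite (negbTE (ns _ _ xX _)) // inE.
Qed.

Lemma cross_anti x y : x \in X -> y \notin X -> ~~ adjacent T x y -> strongly_anti T x y.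
Proof.
move=> xX yX nxy; rewrite strongly_antiE nxy andbT.
by apply: contraNneq yX => <-.
Qed.

(** No pair between the two parts is switchable, and between [x] and an anticomponent there is at
    most one strong edge and at most one strong antiedge; so [x] sees exactly one of two
    antiadjacent vertices. *)
Lemma cross_antipair x y1 y2 : x \in X -> y1 \notin X -> y2 \notin X -> antiadjacent T y1 y2 ->
  adjacent T x y1 = ~~ adjacent T x y2.
Proof.
move=> xX y1X y2X y12; case: (gpX) => _ _ _ /(_ x y1 xX).
rewrite inE => /(_ y1X) [/(_ x) h _].
have [h1 h2] : #|[set w in anticomp_in T (~: X) y1 | strongly_adj T x w]| <= 1 /\
   #|[set w in anticomp_in T (~: X) y1 | strongly_anti T x w]| <= 1.
  by apply: h; rewrite inE connect0.
have m1 : y1 \in anticomp_in T (~: X) y1 by rewrite inE connect0.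
have m2 : y2 \in anticomp_in T (~: X) y1 by rewrite inE connect1 // !in_setC y1X y2X.
have ne := antiadjacent_neq y12.
case: (boolP (adjacent T x y1)) => a1; case: (boolP (adjacent T x y2)) => a2 //.
  have := card_le1_inj h1 (a := y1) (b := y2); rewrite !inE in m1 m2 *; rewrite m1 m2.
  by rewrite !cross_strong // => /(_ isT isT) e; rewrite e eqxx in ne.
have := card_le1_inj h2 (a := y1) (b := y2); rewrite !inE in m1 m2 *; rewrite m1 m2.
by rewrite !cross_anti // => /(_ isT isT) e; rewrite e eqxx in ne.
Qed.

Lemma cross_pair y x1 x2 : y \notin X -> x1 \in X -> x2 \in X -> adjacent T x1 x2 ->
  adjacent T x1 y = ~~ adjacent T x2 y.
Proof.
move=> yX x1X x2X x12; case: (gpX) => _ _ _ /(_ x1 y x1X).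
rewrite inE => /(_ yX) [_ /(_ y) h].
have [h1 h2] : #|[set w in comp_in T X x1 | strongly_adj T y w]| <= 1 /\
   #|[set w in comp_in T X x1 | strongly_anti T y w]| <= 1.
  by apply: h; rewrite inE connect0.
have m1 : x1 \in comp_in T X x1 by rewrite inE connect0.
have m2 : x2 \in comp_in T X x1 by rewrite inE connect1 // x1X x2X.
have ne := adjacent_neq x12.
case: (boolP (adjacent T x1 y)) => a1; case: (boolP (adjacent T x2 y)) => a2 //.
  have := card_le1_inj h1 (a := x1) (b := x2); rewrite !inE in m1 m2 *; rewrite m1 m2.
  by rewrite ![strongly_adj T y _]strongly_adjC !cross_strong // => /(_ isT isT) e; rewrite e eqxx in ne.
have := card_le1_inj h2 (a := x1) (b := x2); rewrite !inE in m1 m2 *; rewrite m1 m2.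
by rewrite ![strongly_anti T y _]strongly_antiC !cross_anti // => /(_ isT isT) e; rewrite e eqxx in ne.
Qed.

(** On a path of length at least three the second vertex is antiadjacent to [v], so only length two
    remains. *)
Lemma nbrs_even_pair (T' : trigraph V) u v : strongly_anti T' u v ->
  (forall z, adjacent T' u z -> strongly_adj T' z v) -> even_pair T' u v.
Proof.
move=> uv h; apply: even_pairP => // -[|z [|w s]] //= _ _.
  by case/andP => uz _ zv; move: uv; rewrite strongly_antiE -zv uz andbF.
case/and3P => uz _ ip lv; have zv := h _ uz.
case: s ip lv => // w' s; case/and3P => _ nz _ lv.
have : antiadjacent T' z v by rewrite -lv; apply: (allP nz); rewrite /= mem_last.
by rewrite antiadjacentE zv andbF.
Qed.

Definition single y := forall y', y' \notin X -> ~~ antiadjacent T y y'.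

Lemma single_strong y y' : y \notin X -> y' \notin X -> y' != y -> single y -> strongly_adj T y' y.
Proof. by move=> yX y'X ne /(_ y' y'X); rewrite strongly_adjE antiadjacentC ne. Qed.

(** Every neighbour of [x] is strongly adjacent to [y]: one in [X] by [cross_pair], since [x] misses
    [y], and one outside [X] because [y] is alone in its anticomponent. *)
Lemma single_even_pair x y : x \in X -> y \notin X -> single y -> ~~ adjacent T x y -> even_pair T x y.
Proof.
move=> xX yX sy nxy; apply: nbrs_even_pair; first exact: cross_anti.
move=> z xz; case: (boolP (z \in X)) => zX.
  by apply: cross_strong => //; move: (cross_pair yX xX zX xz); rewrite (negbTE nxy) => /esym/negbFE.
by apply: single_strong => //; apply: contraNneq nxy => <-.
Qed.

(** One side is [y1] with its nonneighbours in [X]. Each vertex of [X] sees exactly one of [y1],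
    [y2], and exactly one end of an edge in [X] sees [y1]. *)
Lemma pair_bipartite y1 y2 : y1 \notin X -> y2 \notin X -> antiadjacent T y1 y2 ->
  (forall y, y \notin X -> (y == y1) || (y == y2)) -> bipartite T.
Proof.
move=> y1X y2X y12 Y12; exists (y1 |: [set x in X | ~~ adjacent T x y1]).
have ne := antiadjacent_neq y12.
have XX x x' : x \in X -> x' \in X -> adjacent T x x' -> adjacent T x y1 = ~~ adjacent T x' y1.
  exact: cross_pair.
split=> u v; rewrite ?in_setC !in_setU1 !in_set ?negb_or ?(negb_and (_ \in X)) ?negbK.
  move=> hu hv uv; rewrite strongly_antiE uv; apply/negP => auv.
  case/orP: hu => [/eqP e1|/andP[uX nu]]; case/orP: hv => [/eqP e2|/andP[vX nv]].
  - by rewrite e1 e2 eqxx in uv.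
  - by case/negP: nv; rewrite adjacentC -e1.
  - by case/negP: nu; rewrite -e2.
  - by move: (XX _ _ uX vX auv); rewrite (negbTE nu) (negbTE nv).
case/andP => u1 hu /andP[v1 hv] uv; rewrite strongly_antiE uv; apply/negP => auv.
have cl w : w != y1 -> (w \notin X) || adjacent T w y1 -> w = y2 \/ (w \in X) && adjacent T w y1.
  move=> w1; case: (boolP (w \in X)) => wX /=; first by right.
  by have := Y12 _ wX; rewrite (negbTE w1) => /eqP; left.
have nX w : (w \in X) && adjacent T w y1 -> ~~ adjacent T w y2.
  by case/andP => wX; rewrite (cross_antipair wX y1X y2X y12).
case: (cl _ u1 hu) => [e1|hu']; case: (cl _ v1 hv) => [e2|hv'].
- by rewrite e1 e2 eqxx in uv.
- by move: (nX _ hv'); rewrite adjacentC -e1 auv.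
- by move: (nX _ hu'); rewrite -e2 auv.
- case/andP: hu' => uX hu'; case/andP: hv' => vX hv'.
  by move: (XX _ _ uX vX auv); rewrite hu' hv'.
Qed.

Lemma noY_even_pair u v : (forall y, y \in X) -> strongly_anti T u v -> even_pair T u v.
Proof.
move=> aX uv; apply: even_pairP => // -[|z [|w s]] //= /[!inE].
  by move=> _ _ /andP[uz _] zv; move: uv; rewrite strongly_antiE -zv uz andbF.
move=> us _ /and3P[uz _ ip] _.
have zw : adjacent T z w by case: s ip us => [|? ?] /andP[].
have e : u = w by apply: (@X_nbr z) => //; rewrite adjacentC.
by move: us; rewrite e eqxx !orbT.
Qed.

(** Two antiadjacent pairs [a], [a'] and [b], [b'] outside [X], named so that [x1] sees [a] and [b],
    form with the edge [x1 x2] the antihole [x2], [a], [a'], [x1], [b'], [b] of length six. *)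
Lemma one_antipair x1 x2 y1 y2 y3 : x1 \in X -> x2 \in X -> adjacent T x1 x2 ->
  y1 \notin X -> y2 \notin X -> antiadjacent T y1 y2 -> y3 \notin X -> y3 != y1 -> y3 != y2 -> single y3.
Proof.
move=> x1X x2X x12 y1X y2X y12 y3X y31 y32 y4 y4X; apply/negP => y34.
have orient y y' : y \notin X -> y' \notin X -> antiadjacent T y y' -> exists z z',
   [/\ z \notin X, z' \notin X, antiadjacent T z z', adjacent T x1 z &
    (z, z') = (y, y') \/ (z, z') = (y', y)].
  move=> yX y'X yy'; case: (boolP (adjacent T x1 y)) => a.
    by exists y, y'; split => //; left.
  exists y', y; split => //; [by rewrite antiadjacentC| |by right].
  by move: (cross_antipair x1X yX y'X yy'); rewrite (negbTE a) => /esym/negbFE.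
have [a [a' [aX a'X aa' x1a ea]]] := orient _ _ y1X y2X y12.
have [b [b' [bX b'X bb' x1b eb]]] := orient _ _ y3X y4X y34.
have y41 : y4 != y1.
  by apply: contraNneq y32 => e; rewrite (@Y_antinbr y1 y3 y2) // -e antiadjacentC.
have y42 : y4 != y2.
  apply: contraNneq y31 => e; rewrite (@Y_antinbr y2 y3 y1) //; first by rewrite -e antiadjacentC.
  by rewrite antiadjacentC.
have ne4 : [/\ a != b, a != b', a' != b & a' != b'].
  by case: ea => [[-> ->]|[-> ->]]; case: eb => [[-> ->]|[-> ->]]; split => //; rewrite eq_sym.
case: ne4 => ab ab' a'b a'b'.
have adY u v w : u \notin X -> v \notin X -> w \notin X -> antiadjacent T u w -> v != u -> v != w -> adjacent T u v.
  move=> uX vX wX uw vu vw; apply: strongly_adjW; rewrite strongly_adjE eq_sym vu.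
  by apply: contraNN vw => uv; rewrite (@Y_antinbr u v w).
have n1a' : ~~ adjacent T x1 a' by rewrite -(cross_antipair x1X aX a'X aa').
have n1b' : ~~ adjacent T x1 b' by rewrite -(cross_antipair x1X bX b'X bb').
have n2a : ~~ adjacent T x2 a by rewrite -(cross_pair aX x1X x2X x12).
have n2b : ~~ adjacent T x2 b by rewrite -(cross_pair bX x1X x2X x12).
have x2a' : adjacent T x2 a' by move: (cross_pair a'X x1X x2X x12); rewrite (negbTE n1a') => /esym/negbFE.
have x2b' : adjacent T x2 b' by move: (cross_pair b'X x1X x2X x12); rewrite (negbTE n1b') => /esym/negbFE.
have an x y : x \in X -> y \notin X -> ~~ adjacent T x y -> antiadjacent T x y.
  by move=> *; apply: strongly_antiW; apply: cross_anti.
have h1 : tpath (compl T) [:: a; a'; x1; b'; b].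
  have [a'a b'b] : antiadjacent T a' a /\ antiadjacent T b' b by rewrite (antiadjacentC T a') (antiadjacentC T b').
  have [ba b'a ba' b'a'] : [/\ b != a, b' != a, b != a' & b' != a'] by rewrite ![_ == a]eq_sym ![_ == a']eq_sym.
  apply/and3P; rewrite /= !adjacent_compl !antiadjacent_compl aa' b'b; split => //.
    by rewrite adjacentC x1a (adY a b' a') // (adY a b a').
  rewrite antiadjacentC (an x1 a') // (an x1 b') // x1b !andbT /=.
  by rewrite (adY a' b' a) // (adY a' b a).
apply: (noAH (@mk_hole _ (compl T) x2 a [:: a'; x1; b'] b h1 _ _ _ _ _)) => //.
- by rewrite adjacent_compl an.
- by rewrite adjacent_compl an.
- by rewrite /= !antiadjacent_compl x2a' (adjacentC T x2 x1) x12 x2b'.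
have neX u v : u \in X -> v \notin X -> u != v by move=> uX; apply: contraNneq => <-.
have neX' u v : u \notin X -> v \in X -> u != v by move=> uX; apply: contraTneq => <-.
rewrite /= !inE !negb_or ab ab' a'b a'b' (antiadjacent_neq aa') [b' == b]eq_sym (antiadjacent_neq bb').
rewrite [x2 == x1]eq_sym (adjacent_neq x12).
by rewrite (neX x2 a) // (neX x2 a') // (neX x2 b') // (neX x2 b) // (neX' a x1) // (neX' a' x1) // (neX x1 b') // (neX x1 b).
Qed.

Lemma semi_same_part x y : semiadj T x y -> (x \in X) = (y \in X).
Proof.
case: gpX => _ _ ns _ xy; case: (boolP (x \in X)) => xX; case: (boolP (y \in X)) => yX //.
  by move: (ns x y xX); rewrite inE xy => /(_ yX).
by move: (ns y x yX); rewrite inE semiadjC xy => /(_ xX).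
Qed.

(** On a longer path [y1], [z], [w], ..., if [z] is in [X] then [w] is outside and antiadjacent to
    [y1], hence equals [y2], while [z] sees only one of [y1], [y2]. If [z] is outside [X], being
    antiadjacent to [y2] it equals [y1]. *)
Lemma antipair_even y1 y2 : (forall x x', x \in X -> x' \in X -> ~~ adjacent T x x') ->
  y1 \notin X -> y2 \notin X -> strongly_anti T y1 y2 -> even_pair T y1 y2.
Proof.
move=> stX y1X y2X y12; have a12 := strongly_antiW y12.
apply: even_pairP => // s _ _; case: s => [|z [|w [|t s]]] //=.
  by case/andP => y1z _ zv; move: y12; rewrite strongly_antiE -zv y1z andbF.
case/and3P => y1z /andP[y1w _] /and3P[zw nz ip] lv.
case: (boolP (z \in X)) => zX.
  have wX : w \notin X by apply: contraTN zw => wX; apply: stX.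
  have e := Y_antinbr y1X wX y2X y1w a12; move: zw; rewrite e.
  by rewrite (cross_antipair zX y2X y1X) 1?antiadjacentC // adjacentC y1z.
have zy2 : antiadjacent T z y2 by rewrite -lv; apply: (allP nz); apply: mem_last.
rewrite antiadjacentC in a12.
have e : y1 = z by apply: (Y_antinbr y2X y1X zX a12); rewrite antiadjacentC.
by move: y1z; rewrite e => /adjacent_neq; rewrite eqxx.
Qed.

(** Assume that every singleton anticomponent is complete to [X]. An edge in [X] then rules out such
    singletons, so the complement of [X] is empty or one antiadjacent pair. Without edges in [X],
    either an antiadjacent pair outside [X] is even, or all vertices outside [X] are adjacent to
    everything. *)
Lemma doubled_empty : (forall u v, ~~ semiadj T u v) -> ~ complete T -> has_even_pair T.
Proof.
move=> ns nc; have [u0 [v0 uv0]] := not_complete_anti nc.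
have sA u v : antiadjacent T u v -> strongly_anti T u v.
  by rewrite antiadjacentW (negbTE (ns _ _)) orbF.
have [/existsP[x /existsP[y /and4P[xX yX nxy /forallP sy]]]|noxy] :=
  boolP [exists x, exists y, [&& x \in X, y \notin X, ~~ adjacent T x y & [forall y', (y' \notin X) ==> ~~ antiadjacent T y y']]].
  by exists x, y; apply: single_even_pair => // y' y'X; move: (sy y'); rewrite y'X.
have {}noxy x y : x \in X -> y \notin X -> single y -> adjacent T x y.
  move=> xX yX sy; apply/negPn/negP => nxy; case/negP: noxy.
  apply/existsP; exists x; apply/existsP; exists y; rewrite xX yX nxy /=.
  by apply/forallP => y'; apply/implyP => /sy.
have [/existsP[x1 /existsP[x2 /and3P[x1X x2X x12]]]|] :=
  boolP [exists x1, exists x2, [&& x1 \in X, x2 \in X & adjacent T x1 x2]].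
  have nosing y : y \notin X -> ~ single y.
    by move=> yX sy; have := cross_pair yX x1X x2X x12; rewrite !noxy.
  have [/existsP[y1 y1X]|] := boolP [exists y, y \notin X]; last first.
    rewrite negb_exists => /forallP h; exists u0, v0; apply: noY_even_pair => // y.
    by rewrite -[_ \in _]negbK.
  have [/existsP[y2 /andP[y2X y12]]|] := boolP [exists y2, (y2 \notin X) && antiadjacent T y1 y2]; last first.
    rewrite negb_exists => /forallP h; case: (nosing _ y1X) => y' y'X.
    by move: (h y'); rewrite y'X.
  have bp : bipartite T.
    apply: (pair_bipartite y1X y2X y12) => y yX; apply/norP => -[n1 n2].
    by apply: (nosing _ yX); apply: (one_antipair x1X x2X x12 y1X y2X).
  by case: bp => A [h1 h2]; case: (bip_even_pair h1 h2).
rewrite negb_exists => /forallP h.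
have {}h x x' : x \in X -> x' \in X -> ~~ adjacent T x x'.
  by move=> xX x'X; move: (h x); rewrite negb_exists => /forallP/(_ x'); rewrite xX x'X.
have [/existsP[y1 /existsP[y2 /and3P[y1X y2X y12]]]|] :=
  boolP [exists y1, exists y2, [&& y1 \notin X, y2 \notin X & antiadjacent T y1 y2]].
  by exists y1, y2; apply: antipair_even => //; apply: sA.
rewrite negb_exists => /forallP hY.
have sing y : y \notin X -> single y.
  by move=> yX y' y'X; move: (hY y); rewrite negb_exists => /forallP/(_ y'); rewrite yX y'X.
exists u0, v0; apply: nbrs_even_pair => // z uz.
have [ne nuv] : u0 != v0 /\ ~~ adjacent T u0 v0 by move: uv0; rewrite strongly_antiE => /andP.
have u0X : u0 \in X.
  apply/negPn/negP => uX; case: (boolP (v0 \in X)) => vX.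
    by case/negP: nuv; rewrite adjacentC noxy //; apply: sing.
  by have := sing _ uX _ vX; rewrite strongly_antiW.
have v0X : v0 \in X.
  apply/negPn/negP => vX.
  by case/negP: nuv; rewrite noxy //; apply: sing.
have zX : z \notin X by apply: contraTN uz; apply: h.
by rewrite strongly_adjC cross_strong // noxy //; apply: sing.
Qed.

(** A light component would lie in one part, where its middle vertex would have two neighbours
    inside [X] or two antineighbours outside [X]. The ends of a small component also lie in one
    part, and the two parts are treated separately. *)
Lemma doubled_pairs : Dspec T ->
  (complete T \/ has_even_pair T) /\ (favorable T -> has_free_even_pair T).
Proof.
move=> ds.
have [cT|nc] := complete_dec T.
  by split; [left | move=> /favorable_not_complete].
have bipc : bipartite T -> (complete T \/ has_even_pair T) /\ (favorable T -> has_free_even_pair T).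
  by case=> A [h1 h2]; split; [exact: bip_even_pair h1 h2 | exact: bip_free_even_pair h1 h2 ds].
case: (ds) => [D0 ns|s1 s2 s12 DE Ns sw|c x y xy cx cy DE _ sxy _].
- have h := doubled_empty ns nc.
  by split; [right | move=> _; apply: Dset0_free].
- have [as1 ns1] : adjacent T s1 s2 /\ antiadjacent T s1 s2 by move: s12; rewrite semiadjE => /andP.
  have es := semi_same_part s12.
  case: (boolP (s1 \in X)) => s1X; last first.
    have s2X : s2 \notin X by rewrite -es.
    (* Any further vertex outside [X] would be a common neighbour of [s1] and [s2]. *)
    apply: bipc; apply: (pair_bipartite s1X s2X ns1) => y yX; apply/norP => -[n1 n2].
    have a1 : adjacent T s1 y.
      apply: strongly_adjW; rewrite strongly_adjE eq_sym n1; apply: contraNN n2 => h.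
      by rewrite (Y_antinbr s1X yX s2X).
    have a2 : adjacent T s2 y.
      apply: strongly_adjW; rewrite strongly_adjE eq_sym n2; apply: contraNN n1 => h.
      by rewrite (Y_antinbr s2X yX s1X) // antiadjacentC.
    by move/setP/(_ y): Ns; rewrite !inE a1 a2.
  have s2X : s2 \in X by rewrite -es.
  have DX z : z \in Dset T -> z \in X by rewrite DE !inE => /orP[]/eqP->.
  have offX z : z \notin X -> z \notin Dset T by apply: contraNN => /DX.
  have sA u v : u \notin Dset T -> antiadjacent T u v -> strongly_anti T u v by apply: notin_Dset_anti.
  have [/existsP[y0 /andP[y0X /forallP sy0]]|] :=
    boolP [exists y, (y \notin X) && [forall y', (y' \notin X) ==> ~~ antiadjacent T y y']]; last first.
    rewrite negb_exists => /forallP h.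
    have nosing y : y \notin X -> ~ single y.
      move=> yX sy; move: (h y); rewrite yX; case/negP; apply/forallP => y'.
      by apply/implyP => /sy.
    have [/existsP[y1 y1X]|] := boolP [exists y, y \notin X]; last first.
      rewrite negb_exists => /forallP hX.
      have aX y : y \in X by rewrite -[_ \in _]negbK.
      split.
        by right; have [u [v uv]] := not_complete_anti nc; exists u, v; apply: noY_even_pair.
      by case=> _ [u [v [uv uD vD]]] _; exists u, v; split=> //; apply: noY_even_pair.
    have [/existsP[y2 /andP[y2X y12]]|] := boolP [exists y2, (y2 \notin X) && antiadjacent T y1 y2]; last first.
      rewrite negb_exists => /forallP h'; case: (nosing _ y1X) => y' y'X.
      by move: (h' y'); rewrite y'X.
    apply: bipc; apply: (pair_bipartite y1X y2X y12) => y yX; apply/norP => -[n1 n2].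
    by apply: (nosing _ yX); apply: (one_antipair s1X s2X as1 y1X y2X).
  have {}sy0 : single y0 by move=> y' y'X; move: (sy0 y'); rewrite y'X.
  split.
    (* Exactly one of [s1], [s2] sees [y0]; the other one forms an even pair with it. *)
    right; have := cross_pair y0X s1X s2X as1.
    case: (boolP (adjacent T s1 y0)) => a1 a2.
      by exists s2, y0; apply: single_even_pair => //; rewrite -a2.
    by exists s1, y0; apply: single_even_pair.
  move=> fav.
  have [/existsP[x /existsP[y /and5P[xX yX xD nxy /forallP sy]]]|noxy] :=
    boolP [exists x, exists y, [&& x \in X, y \notin X, x \notin Dset T, ~~ adjacent T x y & [forall y', (y' \notin X) ==> ~~ antiadjacent T y y']]].
    exists x, y; split => //; last exact: offX.
    by apply: single_even_pair => // y' y'X; move: (sy y'); rewrite y'X.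
  have {}noxy x y : x \in X -> x \notin Dset T -> y \notin X -> single y -> adjacent T x y.
    move=> xX xD yX sy; apply/negPn/negP => nxy; case/negP: noxy.
    apply/existsP; exists x; apply/existsP; exists y; rewrite xX yX xD nxy /=.
    by apply/forallP => y'; apply/implyP => /sy.
  (* An edge of [X] off the component would have, by [cross_pair], an end that misses [y0]. *)
  have iso x x' : x \in X -> x \notin Dset T -> x' \in X -> ~~ adjacent T x x'.
    move=> xX xD x'X; apply/negP => xx'.
    have x'D : x' \notin Dset T.
      apply: contraNN xD; rewrite DE !inE => /orP[]/eqP e; subst x'.
        by rewrite (@X_nbr s1 x s2) ?eqxx ?orbT // adjacentC.
      by rewrite (@X_nbr s2 x s1) ?eqxx ?orbT // adjacentC.
    by have := cross_pair y0X xX x'X xx'; rewrite !noxy.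
  have twin x x' : x \in X -> x' \in X -> x \notin Dset T -> x' \notin Dset T -> x != x' ->
     (forall y, y \notin X -> adjacent T x y -> adjacent T x' y) -> has_free_even_pair T.
    move=> xX x'X xD x'D ne sub; exists x, x'; split => //.
    apply: nbrs_even_pair; first by rewrite strongly_antiE ne iso.
    move=> z xz; have zX : z \notin X by apply: contraTN xz => zX; apply: iso.
    by rewrite strongly_adjC cross_strong // sub.
  have [/existsP[y1 /existsP[y2 /and3P[y1X y2X y12]]]|] :=
    boolP [exists y1, exists y2, [&& y1 \notin X, y2 \notin X & antiadjacent T y1 y2]]; last first.
    rewrite negb_exists => /forallP hY.
    have sing y : y \notin X -> single y.
      by move=> yX y' y'X; move: (hY y); rewrite negb_exists => /forallP/(_ y'); rewrite yX y'X.
    case: fav => _ [u [v [uv uD vD]]] _.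
    have [ne nuv] : u != v /\ ~~ adjacent T u v by move: uv; rewrite strongly_antiE => /andP.
    have uX : u \in X.
      apply/negPn/negP => uX; case: (boolP (v \in X)) => vX.
        by case/negP: nuv; rewrite adjacentC noxy //; apply: sing.
      by have := sing _ uX _ vX; rewrite strongly_antiW.
    have vX : v \in X.
      by apply/negPn/negP => vX; case/negP: nuv; rewrite noxy //; apply: sing.
    by apply: (twin u v) => // y yX _; apply: noxy => //; apply: sing.
  have sing y : y \notin X -> y != y1 -> y != y2 -> single y.
    exact: (one_antipair s1X s2X as1 y1X y2X).
  have [/existsP[x /andP[xX xD]]|] := boolP [exists x, (x \in X) && (x \notin Dset T)]; last first.
    rewrite negb_exists => /forallP h; case: fav => _ _ /(_ _ _ sw s12).
    have XD x : x \in X -> x \in Dset T by move=> xX; move: (h x); rewrite xX negbK.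
    (* Here [X] is the switchable pair. As [s] sees one of any two antiadjacent vertices outside
       [X], those it misses form a clique, against favorability. *)
    have cl s : s \in X -> clique T (~: (Dset T :|: N T s)).
      move=> sX a b; rewrite !in_setC !in_setU !negb_or ![_ \in N T _]inE => /andP[aD na] /andP[bD nb] ab.
      have aX : a \notin X by apply: contraNN aD => /XD.
      have bX : b \notin X by apply: contraNN bD => /XD.
      apply: strongly_adjW; rewrite strongly_adjE ab; apply/negP => anab.
      by have := cross_antipair sX aX bX anab; rewrite (negbTE na) (negbTE nb).
    by case; case; apply: cl.
  (* The neighbours of [x] are the single vertices and [z1]; a path from [x] to [z2]
     avoiding the former must continue through both ends of the switchable pair. *)
  have key z1 z2 : z1 \notin X -> z2 \notin X -> antiadjacent T z1 z2 ->
     (forall y, y \notin X -> y != z1 -> y != z2 -> single y) -> adjacent T x z1 -> has_free_even_pair T.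
    move=> z1X z2X z12 sg xz1.
    have nxz2 : ~~ adjacent T x z2 by rewrite -(cross_antipair xX z1X z2X z12).
    have [/existsP[x' /and4P[x'X x'D x'x x'z1]]|] :=
      boolP [exists x', [&& x' \in X, x' \notin Dset T, x' != x & adjacent T x' z1]].
      apply: (twin x x') => //; first by rewrite eq_sym.
      move=> y yX xy; case: (eqVneq y z1) => [->//|n1].
      by apply: noxy => //; apply: sg => //; apply: contraNneq nxz2 => <-.
    rewrite negb_exists => /forallP only.
    exists x, z2; split=> //; last exact: offX.
    apply: even_pairP; first exact: cross_anti.
    move=> s us un; case: s us un => [|z [|w [|t s]]] //= us un.
      by case/andP => xz _ zv; move: nxz2; rewrite -zv xz.
    case/and3P => xz /and3P[xw xt xs] /and3P[zw nz ip] lv.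
    have zX : z \notin X by apply: contraTN xz => zX; apply: iso.
    have znz2 : z != z2 by apply: contraNneq nxz2 => <-.
    have az2 : antiadjacent T z z2 by rewrite -lv; apply: (allP nz); apply: mem_last.
    have ez : z = z1 by apply: (@Y_antinbr z2) => //; rewrite antiadjacentC.
    subst z.
    have singx y : y \notin X -> antiadjacent T x y -> y = z2.
      move=> yX xy; have nxy : ~~ adjacent T x y.
        by have := sA _ _ xD xy; rewrite strongly_antiE => /andP[].
      have n1 : y != z1 by apply: contraNneq nxy => ->.
      by apply/eqP/negPn/negP => n2; case/negP: nxy; apply: noxy => //; apply: sg.
    have wz2 : w != z2.
      move: us un; rewrite !inE -lv => _ /and4P[_ h _ _].
      by apply: contraNneq h => ->; apply: mem_last.
    have wX : w \in X by apply/negPn/negP => wX; rewrite (singx _ wX xw) eqxx in wz2.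
    have wt : adjacent T w t by case: (s) ip => [|? ?] /andP[].
    have wnz2 : ~~ adjacent T w z2 by rewrite -(cross_antipair wX z1X z2X z12) adjacentC.
    have tz2 : t != z2 by apply: contraNneq wnz2 => <-.
    have tX : t \in X by apply/negPn/negP => tX; rewrite (singx _ tX xt) eqxx in tz2.
    have tz1 : ~~ adjacent T t z1 by rewrite -(cross_pair z1X wX tX wt) adjacentC.
    have atz2 : adjacent T t z2 by move: (cross_antipair tX z1X z2X z12); rewrite (negbTE tz1) => /esym/negbFE.
    case: s us un xs nz ip lv => [|q s] us un xs nz ip lv; first by move: tz2; rewrite -lv eqxx.
    case: s us un xs nz ip lv => [|r s] us un xs nz ip lv //.
    case/and3P: ip => _ _ /and3P[_ nt _].
    have : antiadjacent T t z2 by rewrite -lv; apply: (allP nt); rewrite /= mem_last.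
    by rewrite antiadjacentE (cross_strong tX z2X atz2) andbF.
  case: (boolP (adjacent T x y1)) => a1; first exact: (key y1 y2).
  apply: (key y2 y1) => //.
  + by rewrite antiadjacentC.
  + by move=> y yX n2 n1; apply: sing.
  + by move: (cross_antipair xX y1X y2X y12); rewrite (negbTE a1) => /esym/negbFE.
- have ecx := semi_same_part cx; have ecy := semi_same_part cy.
  have [a1 n1] : adjacent T c x /\ antiadjacent T c x by move: cx; rewrite semiadjE => /andP.
  have [a2 n2] : adjacent T c y /\ antiadjacent T c y by move: cy; rewrite semiadjE => /andP.
  case: (boolP (c \in X)) => cX; rewrite ?cX ?(negbTE cX) in ecx ecy.
    by move: xy; rewrite (@X_nbr c x y) ?eqxx -?ecx -?ecy.
  by move: xy; rewrite (@Y_antinbr c x y) ?eqxx -?ecx -?ecy.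
Qed.

End Doubled.

(** * Adjacent vertices of degree two in theta-free bipartite graphs *)

Lemma connect_sym_of (U : finType) (r : rel U) : symmetric r -> connect_sym r.
Proof. by move=> h; apply: sym_connect_sym. Qed.

Lemma perm_ear (U : eqType) (s t : U) l p1 p2 :
  perm_eq (s :: t :: l ++ p1 ++ rev p2) (l ++ s :: p1 ++ t :: p2).
Proof. apply/permP => P; do 3 rewrite ?count_cat ?count_rev /=; lia. Qed.

Lemma perm_closed (U : eqType) (p q : U) O Q :
  perm_eq (p :: O ++ q :: rev Q) (rcons (p :: O) q ++ Q).
Proof. apply/permP => P; rewrite -cats1; do 3 rewrite ?count_cat ?count_rev /=; lia. Qed.

Section Chain.
Variables (U : finType) (e : rel U) (sd : U -> bool).
Hypotheses (eC : symmetric e) (e_sd : forall x y, e x y -> sd x != sd y).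
Hypothesis noTheta : forall s t P1 P2 P3, sd s = sd t ->
  path e s (rcons P1 t) -> path e s (rcons P2 t) -> path e s (rcons P3 t) ->
  uniq (s :: t :: P1 ++ P2 ++ P3) -> False.
Implicit Types (B K : {set U}) (a b c d k p q s t u w : U).

Definition inside B : rel U := fun a b => [&& a \in B, b \in B & e a b].

Lemma inside_sym B : symmetric (inside B).
Proof. by move=> a b; rewrite /inside eC andbCA. Qed.

(** The two arcs of the cycle between [s] and [t] and a path through [B] would be the three paths of
    a theta. *)
Lemma no_ear (cs : seq U) s t B b1 b2 : uniq cs -> cycle e cs -> s \in cs -> t \in cs ->
  [disjoint B & cs] -> b1 \in B -> b2 \in B -> e s b1 -> e t b2 ->
  connect (inside B) b1 b2 -> sd s = sd t -> s = t.
Proof.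
move=> uc cc sc tc dB b1B b2B sb1 tb2 cB sdst; apply/eqP/negPn/negP => st.
have [i p1 p2 _ _ rE] := rot_to_arc uc sc tc st.
have := uc; rewrite -(rot_uniq i) rE => uc'.
have := cc; rewrite -(rot_cycle i) rE /= rcons_cat cat_path /= => /and3P[h1 h2 h3].
have [r [ir ur lr]] := shortest_connect cB.
have pr := ipath_path ir.
have rB : all (mem B) (b1 :: r).
  rewrite /= b1B /=; apply: (path_targets _ pr) => ? ? /and3P[]//.
have er : path e s (b1 :: r).
  by rewrite /= sb1; apply: sub_path pr => ? ? /and3P[].
apply: (@noTheta s t (b1 :: r) p1 (rev p2)) => //.
- by rewrite rcons_path er /= lr eC.
- by rewrite rcons_path h1.
- rewrite -rev_cons; have := rev_path e t (rcons p2 s).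
  rewrite last_rcons belast_rcons => ->; rewrite (eq_path (e' := e)) // => ? ?; exact: eC.
have memc z : z \in s :: p1 ++ t :: p2 -> z \in cs by rewrite -rE mem_rot.
have dis z : z \in b1 :: r -> z \notin s :: p1 ++ t :: p2.
  move=> /(allP rB) zB; apply/negP => /memc zc.
  by move/pred0P/(_ z): dB; rewrite /= zc andbT => h; rewrite /= h in zB.
rewrite (perm_uniq (perm_ear s t (b1 :: r) p1 p2)) cat_uniq ur uc' andbT andTb.
apply/hasPn => z zc; apply/negP => zr.
by move: (dis z zr); rewrite zc.
Qed.

Definition leafless K := forall k, k \in K -> exists u w, [/\ u != w, e k u & e k w].

(** The last condition says that both ends of the edge [b c] have degree two. *)
Definition is_chain K a b c d :=
  [/\ b \in K, c \in K, e a b /\ e b c /\ e c d, a != c /\ b != d &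
      (forall u, e b u -> u = a \/ u = c) /\ (forall u, e c u -> u = b \/ u = d)].

Lemma leaflessW K K' : {subset K' <= K} -> leafless K -> leafless K'.
Proof. by move=> sub lK k /sub/lK. Qed.

Lemma is_chainW K K' a b c d : {subset K' <= K} -> is_chain K' a b c d -> is_chain K a b c d.
Proof. by move=> sub [/sub h1 /sub h2 h3 h4 h5]; split. Qed.

(** The vertices [p] and [q], possibly equal, are the only attachments of [K]. The connection
    outside [K] closes a path through [K] to a cycle, so that [no_ear] applies to whatever remains
    of [K]. *)
Lemma chain_exists K p q : leafless K -> 2 <= #|K| -> p \notin K -> q \notin K ->
  (forall k u, k \in K -> e k u -> [|| u \in K, u == p | u == q]) ->
  connect (inside (~: K)) p q -> exists a b c d, is_chain K a b c d.
Proof.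
move: {2}#|K| (leqnn #|K|) => n; elim: n K p q => [|n IH] K p q cK lK K2 pK qK clo out.
  by move: K2; rewrite leqNgt (leq_ltn_trans cK).
have irr z : ~~ e z z by apply/negP => /e_sd; rewrite eqxx.
have other k z : k \in K -> exists2 w, w != z & e k w.
  case/lK => u [w [uw ku kw]]; case: (eqVneq u z) => [e1|]; last by exists u.
  by exists w => //; rewrite -e1 eq_sym.
(* A nonempty part of [K] with a single attachment [w] yields a smaller instance, obtained
   by moving one of its vertices to the boundary. *)
have one_att K' w : {subset K' <= K} -> K' != set0 -> w \notin K' ->
    (forall k u, k \in K' -> e k u -> (u \in K') || (u == w)) -> exists a b c d, is_chain K a b c d.
  move=> sub /set0Pn[k0 k0K] wK clo'.
  have step k p' : k \in K' -> connect (inside (~: (K' :\ k))) p' k -> p' \notin K' :\ k ->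
      (forall k1 u, k1 \in K' :\ k -> e k1 u -> u \in K' \/ u = p') ->
      2 <= #|K' :\ k| -> exists a b c d, is_chain K a b c d.
    move=> kK cn p'K cl c2.
    have sub2 : {subset K' :\ k <= K} by move=> z; rewrite !inE => /andP[_ /sub].
    have [||||a [b [c [d h]]]] := IH (K' :\ k) p' k _ _ c2 p'K _ _ cn.
    - have : #|K' :\ k| < #|K|.
        apply: (@leq_trans #|K'|); first by rewrite (cardsD1 k K') kK add1n.
        by apply: subset_leq_card; apply/subsetP.
      by move/leq_trans/(_ cK).
    - exact: leaflessW lK.
    - by rewrite !inE eqxx.
    - move=> k1 u k1K k1u; case: (cl _ _ k1K k1u) => [uK|->]; last by rewrite eqxx orbT.
      by rewrite !inE uK; case: eqP => //; rewrite ?orbT.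
    by exists a, b, c, d; apply: is_chainW h.
  have two z1 z2 (A : {set U}) : z1 != z2 -> z1 \in A -> z2 \in A -> 2 <= #|A|.
    move=> ne h1 h2; have <- : #|[set z1; z2]| = 2 by rewrite cards2 ne.
    by apply: subset_leq_card; apply/subsetP => z; rewrite !inE => /orP[]/eqP->.
  have [/existsP[k /andP[kK wk]]|] := boolP [exists k, (k \in K') && e w k].
    have [k2 k2w kk2] := other k w (sub _ kK).
    have k2K : k2 \in K' by move: (clo' _ _ kK kk2); rewrite (negbTE k2w) orbF.
    have [k3 k3k k2k3] := other k2 k (sub _ k2K).
    have k3K : k3 \in K'.
      move: (clo' _ _ k2K k2k3) => /orP[//|/eqP e1].
      have := e_sd k2k3; have := e_sd kk2; have := e_sd wk; rewrite e1.
      by case: (sd w); case: (sd k); case: (sd k2).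
    apply: (step k w) => //.
    - apply: connect1; rewrite /inside !inE eqxx wk andbT.
      by rewrite (negbTE wK) andbF.
    - by rewrite !inE (negbTE wK) andbF.
    - move=> k1 u; rewrite !inE => /andP[_ k1K] /(clo' _ _ k1K)/orP[|/eqP]; by [left|right].
    - apply: (two k2 k3); rewrite ?inE ?k2K ?k3K ?andbT //.
        by apply: contraNneq (irr k2) => e1; rewrite {2}e1.
      by apply: contraNneq (irr k) => e1; rewrite -{2}e1.
  rewrite negb_exists => /forallP h.
  have clo2 k u : k \in K' -> e k u -> u \in K'.
    move=> kK ku; move: (clo' _ _ kK ku) => /orP[//|/eqP e1].
    by move: (h k); rewrite kK -e1 eC ku.
  have [k2 [k3 [k23 kk2 kk3]]] := lK _ (sub _ k0K).
  apply: (step k0 k0) => //.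
  - by rewrite !inE eqxx.
  - by move=> k1 u; rewrite !inE => /andP[_ k1K] /(clo2 _ _ k1K); left.
  apply: (two k2 k3) => //; rewrite !inE ?(clo2 _ _ k0K kk2) ?(clo2 _ _ k0K kk3) andbT.
    by apply: contraNneq (irr k0) => e1; rewrite -{2}e1.
  by apply: contraNneq (irr k0) => e1; rewrite -{2}e1.
pose S := p |: (q |: K).
(* The edge between [p] and [q], if there is one, is removed so that a path from [p] to [q] must
   pass through [K]. *)
pose r : rel U := fun u w => inside S u w && ~~ (((u == p) && (w == q)) || ((u == q) && (w == p))).
have r_e u w : r u w -> e u w by case/andP => /and3P[].
have rC : symmetric r.
  by move=> u w; rewrite /r inside_sym orbC [(w == q) && _]andbC [(w == p) && _]andbC.
have rS u w : r u w -> w \in S by case/andP => /and3P[].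
(* If no such path exists or [p] equals [q], the part of [K] reached from [p] is attached only to
   [p]; if that part is empty, [K] is attached only to [q]. Both cases are settled by [one_att]. *)
case: (boolP ((p != q) && connect r p q)) => [/andP[pq cpq]|ncon]; last first.
  pose K1 := [set k in K | connect r p k].
  have K1K : {subset K1 <= K} by move=> z; rewrite inE => /andP[].
  have K1p k u : k \in K1 -> e k u -> (u \in K1) || (u == p).
    rewrite inE => /andP[kK cpk] ku; rewrite inE.
    have := clo _ _ kK ku; case: (eqVneq u p) => [->|up] /=; first by rewrite !orbT.
    have kp : k != p by apply: contraNneq pK => <-.
    have kq : k != q by apply: contraNneq qK => <-.
    have cpu : u \in S -> connect r p u.
      move=> uS; apply: (connect_trans cpk); apply: connect1.
      by rewrite /r /inside uS ku !inE kK (negbTE kp) (negbTE kq) /= ?orbT.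
    case/orP => [uK|/eqP uq].
      by rewrite uK cpu // !inE uK !orbT.
    by move: ncon; rewrite -uq eq_sym up cpu // uq !inE eqxx orbT.
  case: (eqVneq K1 set0) => [K10|K1n].
    apply: (one_att K q) => //.
      by apply/set0Pn; apply/card_gt0P; apply: leq_trans K2.
    move=> k u kK ku; case/or3P: (clo _ _ kK ku) => [->//|/eqP up|->]; last by rewrite orbT.
    have kp : k != p by apply: contraNneq pK => <-.
    have kq : k != q by apply: contraNneq qK => <-.
    move/setP/(_ k): K10; rewrite !inE kK /= connect1 //.
    rewrite /r /inside !inE eqxx kK -up (eC u) ku (negbTE kq) !orbT /=.
    by rewrite up (negbTE kp) andbF.
  apply: (one_att K1 p K1K K1n) => //.
  by apply: contraNN pK => /K1K.
have [Q0 [iQ uQ lQ]] := shortest_connect cpq.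
case/lastP: Q0 iQ uQ lQ => [|Q z]; first by move=> _ _ /= e1; rewrite e1 eqxx in pq.
rewrite last_rcons => iQ uQ lQ; subst z.
have pathQ := ipath_path iQ.
have QK z : z \in Q -> z \in K.
  move=> zQ; have : z \in S by apply: (allP (path_targets rS pathQ)); rewrite mem_rcons inE zQ orbT.
  rewrite !inE => /or3P[/eqP zp|/eqP zq|//]; subst z; move: uQ.
    by rewrite cons_uniq mem_rcons inE zQ orbT.
  by rewrite cons_uniq rcons_uniq zQ /= andbF.
have Qn : Q != [::].
  apply: contraTneq pathQ => ->; rewrite /= andbT /r !eqxx /= andbF //.
have [O0 [iO uO lO]] := shortest_connect out.
case/lastP: O0 iO uO lO => [|O z]; first by move=> _ _ /= e1; rewrite e1 eqxx in pq.
rewrite last_rcons => iO uO lO; subst z.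
have pathO := ipath_path iO.
have OK z : z \in O -> z \notin K.
  move=> zO; rewrite -in_setC; apply: (allP (path_targets _ pathO) z); last by rewrite mem_rcons inE zO orbT.
  by move=> ? ? /and3P[].
(* The cycle made of the outer path [O] and the inner path [Q]. *)
pose C := p :: O ++ q :: rev Q.
have uC : uniq C.
  rewrite (perm_uniq (perm_closed p q O Q)) cat_uniq rcons_cons uO /=.
  move: uQ; rewrite cons_uniq rcons_uniq => /and3P[_ _ ->]; rewrite andbT.
  apply/hasPn => z zQ; rewrite /= inE mem_rcons inE; apply/or3P => -[/eqP h|/eqP h|h].
  - by move: pK; rewrite -h QK.
  - by move: qK; rewrite -h QK.
  - by move: (OK _ h); rewrite QK.
have cC : cycle e C.
  move: (pathO); rewrite rcons_path => /andP[h1 h2]; rewrite /C /= rcons_cat cat_path /=.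
  apply/and3P; split.
  - by apply: sub_path h1 => ? ? /and3P[].
  - by case/and3P: h2.
  have := rev_path e p (rcons Q q); rewrite last_rcons belast_rcons rev_cons => ->.
  by apply: sub_path pathQ => u w /r_e; rewrite eC.
have QC z : z \in p :: rcons Q q -> z \in C.
  rewrite !inE mem_rcons !inE mem_cat inE mem_rev => /or3P[->|->|->]; by rewrite ?orbT.
have [/existsP[k /andP[kK kQ]]|] := boolP [exists k, (k \in K) && (k \notin Q)].
  pose M : {set U} := [set z in K | z \notin Q].
  pose B := [set z | connect (inside M) k z].
  have kM : k \in M by rewrite inE kK.
  have kB : k \in B by rewrite inE connect0.
  have BM z : z \in B -> z \in M.
    rewrite inE => /connectP[l pl ->]; case/lastP: l pl => [|l z'] //=.
    by rewrite rcons_path last_rcons => /andP[_ /and3P[]].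
  have BK : {subset B <= K} by move=> z /BM; rewrite inE => /andP[].
  have Bclo z u : z \in B -> e z u -> (u \in B) || (u \in p :: rcons Q q).
    move=> zB zu; have zM := BM _ zB.
    case: (boolP (u \in M)) => uM.
      rewrite inE (connect_trans (y := z)) //; first by rewrite inE in zB.
      by apply: connect1; rewrite /inside zM uM.
    rewrite in_cons mem_rcons in_cons; case/or3P: (clo _ _ (BK _ zB) zu) => [uK|->|->]; rewrite ?orbT //.
    by move: uM; rewrite inE uK negbK => ->; rewrite !orbT.
  have dM : [disjoint M & C].
    apply/pred0P => z /=; apply/negbTE/negP => /andP[]; rewrite inE => /andP[zK zQ].
    rewrite /C inE mem_cat inE mem_rev (negbTE zQ) orbF => /or3P[/eqP h|h|/eqP h].
    - by move: pK; rewrite -h zK.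
    - by move: (OK _ h); rewrite zK.
    - by move: qK; rewrite -h zK.
  (* Two attachments of [B] on [Q] that lie on the same side are ends of an ear of [C], hence
     equal. *)
  have att s t z1 z2 : s \in p :: rcons Q q -> t \in p :: rcons Q q -> z1 \in B -> z2 \in B ->
      e z1 s -> e z2 t -> sd s = sd t -> s = t.
    move=> sQ tQ z1B z2B z1s z2t; apply: (no_ear uC cC (QC _ sQ) (QC _ tQ) dM (BM _ z1B) (BM _ z2B)); rewrite 1?eC //.
    apply: (connect_trans (y := k)); last by rewrite inE in z2B.
    by rewrite (connect_sym_of (@inside_sym M)); rewrite inE in z1B.
  have outB z : z \in p :: rcons Q q -> z \notin B.
    move/QC => zC; apply/negP => /BM zM.
    by move/pred0P/(_ z): dM; rewrite /= zM zC.
  pose attach (o : bool) z := [&& z \in p :: rcons Q q, sd z == o & [exists w in B, e w z]].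
  have attE o : exists2 u, u \in p :: rcons Q q & forall z w, w \in B -> e w z -> z \in p :: rcons Q q -> sd z = o -> z = u.
    have [/existsP[u /and3P[uQ' /eqP su /exists_inP[w wB wu]]]|] := boolP [exists u, attach o u].
      exists u => // z w' w'B w'z zQ sz; apply: (att _ _ w' w) => //; by rewrite sz.
    (* Without an attachment on side [o], the vertex [p] serves as a placeholder. *)
    rewrite negb_exists => /forallP h; exists p; first exact: mem_head.
    move=> z w wB wz zQ sz.
    move: (h z); rewrite /attach zQ sz eqxx /=; case/negP.
    by apply/exists_inP; exists w.
  have [u1 u1Q att1] := attE true; have [u2 u2Q att2] := attE false.
  have Battach z w : w \in B -> e w z -> [|| z \in B, z == u1 | z == u2].
    move=> wB wz; case/orP: (Bclo _ _ wB wz) => [->//|zQ].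
    case sz: (sd z); first by rewrite (att1 _ _ wB wz zQ sz) eqxx orbT.
    by rewrite (att2 _ _ wB wz zQ sz) eqxx !orbT.
  have [||||a [b [c [d h]]]] := IH B u1 u2 _ (leaflessW BK lK) _ (outB _ u1Q) (outB _ u2Q) _ _.
  - have : #|B| < #|K|.
      apply: proper_card; apply/properP; split; first by apply/subsetP.
      have [z zQ] : exists z, z \in Q by case: (Q) Qn => // z Q' _; exists z; rewrite mem_head.
      by exists z; [exact: QK | apply/negP => /BM; rewrite inE zQ andbF].
    by move/leq_trans/(_ cK).
  (* A one-vertex [B] would have two distinct neighbours on [Q], on the same side. *)
  - rewrite leqNgt; apply/negP; rewrite ltnS => B1.
    have onlyk z : z \in B -> z = k by move=> zB; exact: (card_le1_inj B1 zB kB).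
    have [u [w [uw ku kw]]] := lK _ kK.
    have toQ z : e k z -> z \in p :: rcons Q q.
      move=> kz; case/orP: (Bclo _ _ kB kz) => // /onlyk e1.
      by move: kz; rewrite e1 (negbTE (irr k)).
    case/eqP: uw; apply: (att _ _ k k) => //; try exact: toQ.
    by have := e_sd ku; have := e_sd kw; case: (sd k); case: (sd u); case: (sd w).
  - by move=> z w zB zw; apply: (Battach w z).
  (* The new boundary vertices are joined outside [B] along [Q]. *)
  - have conn z : z \in p :: rcons Q q -> connect (inside (~: B)) p z.
      rewrite inE => /orP[/eqP->|zQ]; first exact: connect0.
      have sub : {subset p :: rcons Q q <= ~: B} by move=> w /outB; rewrite in_setC.
      have pI : path (inside (~: B)) p (rcons Q q).
        elim: (rcons Q q) (p) pathQ sub => //= w l IHl p' /andP[h1 h2] sub.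
        have p'B : p' \in ~: B by apply: sub; rewrite mem_head.
        have wB : w \in ~: B by apply: sub; rewrite in_cons mem_head orbT.
        rewrite /inside p'B wB (r_e _ _ h1) /=.
        by apply: IHl => // w' w'l; apply: sub; rewrite in_cons w'l orbT.
      case/splitPr: zQ pI => l1 l2; rewrite cat_path /= => /and3P[h1 h2 _].
      apply: (connect_trans (y := last p l1)); last exact: connect1.
      by apply/connectP; exists l1.
    apply: (connect_trans (y := p)); last exact: conn.
    by rewrite (connect_sym_of (@inside_sym _)); apply: conn.
  by exists a, b, c, d; apply: is_chainW h.
rewrite negb_exists => /forallP KQ0.
have KQ z : z \in K -> z \in Q by move=> zK; move: (KQ0 z); rewrite zK negbK.
have rE b z : b \in K -> z \in S -> r b z = e b z.
  move=> bK zS; have bp : b != p by apply: contraNneq pK => <-.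
  have bq : b != q by apply: contraNneq qK => <-.
  by rewrite /r /inside zS (negbTE bp) (negbTE bq) /= andbT !inE bK !orbT.
(* Now [K] is the interior of the induced path [Q], so its first two vertices have only their path
   neighbours; if [Q] has just these two, the vertex [d] is [q]. *)
case: Q iQ uQ QK {Qn uC cC QC C pathQ KQ0} KQ => [|b [|c Q']] iQ uQ QK KQ.
- case/card_gt0P: (ltnW K2) => z /KQ; by rewrite in_nil.
- move: K2; rewrite ltnNge => /negP; case.
  by rewrite -(cards1 b); apply: subset_leq_card; apply/subsetP => z /KQ; rewrite !inE.
have bK : b \in K by apply: QK; rewrite inE eqxx.
have cK' : c \in K by apply: QK; rewrite !inE eqxx orbT.
have SQ z : z \in rcons Q' q -> z \in S.
  rewrite mem_rcons inE => /orP[/eqP->|zQ]; first by rewrite !inE eqxx orbT.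
  by rewrite !inE QK ?orbT // !inE zQ !orbT.
have pS : p \in S by rewrite !inE eqxx.
have clo' k u : k \in K -> e k u -> [|| u == p, u == b, u == c | u \in rcons Q' q].
  move=> kK ku; rewrite mem_rcons inE; case/or3P: (clo _ _ kK ku) => [/KQ|->|->]; rewrite ?orbT // !inE.
  by case/or3P => ->; rewrite ?orbT.
rewrite !rcons_cons in iQ uQ.
case/and3P: iQ => pb pn; case/and3P => bc bn ic.
have {pn} /= /andP[npc _] := pn.
have {npc} npc : ~~ e p c by rewrite eC -rE // rC; case/andP: npc.
case ER: (rcons Q' q) => [|d R]; first by case: (Q') ER.
rewrite ER in ic bn uQ clo' SQ.
have [cd cn] : r c d /\ all (nonrel r c) R.
  by case/and3P: ic.
exists p, b, c, d; split => //.
- by split; [exact: r_e | split; exact: r_e].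
- split; first by apply: contraTneq uQ => ->; rewrite /= !inE eqxx !orbT.
  by apply: contraTneq uQ => ->; rewrite /= !inE eqxx !orbT /= andbF.
split=> u h.
- case/or4P: (clo' _ _ bK h) => [/eqP->|/eqP e1|/eqP->|uR].
  + by left.
  + by move: h; rewrite e1 (negbTE (irr b)).
  + by right.
  + by have /andP[_] := allP bn _ uR; rewrite rE ?h // SQ.
case/or4P: (clo' _ _ cK' h) => [/eqP e1|/eqP->|/eqP e1|uR].
- by move: h; rewrite e1 eC (negbTE npc).
- by left.
- by move: h; rewrite e1 (negbTE (irr c)).
move: uR; rewrite inE => /orP[/eqP->|uR]; first by right.
by have /andP[_] := allP cn _ uR; rewrite rE ?h // SQ // inE uR orbT.
Qed.
End Chain.

(** * Odd prisms in line trigraphs *)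

Section Prism.
Variables (V : finType) (T : trigraph V) (p : nat -> seq V) (a b : nat -> V).
Hypothesis pa : forall i, i < 3 -> ohead (p i) = Some (a i).
Hypothesis pb : forall i, i < 3 -> last (a i) (p i) = b i.
Hypothesis p2 : forall i, i < 3 -> 2 <= size (p i) /\ uniq (p i).
Hypothesis cross : forall i j x y, i < 3 -> j < 3 -> i != j -> x \in p i -> y \in p j ->
  x <> y /\ (adjacent T x y <-> (x = a i /\ y = a j) \/ (x = b i /\ y = b j)).
Hypothesis same : forall i x y, i < 3 -> x \in p i -> y \in p i -> x != y ->
  (adjacent T x y <-> seq_edge (p i) x y).

Lemma seq_edge_mem (s : seq V) x y : seq_edge s x y -> (x \in s) && (y \in s).
Proof.
case=> i [li]; have li' := ltnW li.
have m z : (nth z s i \in s) && (nth z s i.+1 \in s) by rewrite !mem_nth.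
case=> -[e1 e2].
  by have := m x; rewrite e1; case/andP => ->; rewrite -e2 mem_nth.
by have := m x; rewrite e2; case/andP => h ->; rewrite -e1 mem_nth.
Qed.

(** Indexing the paths by numbers below three reduces all pairs of vertices to two cases, same path
    and different paths. *)
Lemma prism_of_family : is_prism T (p 0) (p 1) (p 2).
Proof.
have disj i j x : i < 3 -> j < 3 -> x \in p i -> x \in p j -> i = j.
  move=> i3 j3 xi xj; apply/eqP/negPn/negP => ij.
  by case: (cross i3 j3 ij xi xj).
have am i : i < 3 -> a i \in p i.
  by move=> /pa; case: (p i) => //= z s [->]; rewrite mem_head.
have bm i : i < 3 -> b i \in p i.
  move=> i3; rewrite -(pb i3); have := pa i3; case: (p i) => //= z s [->]; exact: mem_last.
have lists c x : x \in [:: c 0; c 1; c 2] <-> exists2 k, k < 3 & x = c k :> V.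
  split; first by rewrite !inE => /or3P[]/eqP->; [exists 0 | exists 1 | exists 2].
  by case=> -[|[|[|//]]] _ ->; rewrite !inE eqxx ?orbT.
exists (a 0), (a 1), (a 2), (b 0), (b 1), (b 2); split; [exact: pa|exact: pa|exact: pa|].
split; [exact: pb|exact: pb|exact: pb|].
split; [by case: (p2 (i := 0))|by case: (p2 (i := 1))|by case: (p2 (i := 2))| |].
  have h i j : i < 3 -> j < 3 -> i != j -> ~~ has (mem (p i)) (p j).
    move=> i3 j3 ij; apply/hasPn => x xj; apply/negP => xi.
    by rewrite (disj _ _ _ i3 j3 xi xj) eqxx in ij.
  rewrite !cat_uniq has_cat !(negbTE (h _ _ _ _ _)) //=.
  by case: (p2 (i := 0)); case: (p2 (i := 1)); case: (p2 (i := 2)) => // *; apply/and3P; split.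
have mem3 x : x \in p 0 ++ p 1 ++ p 2 -> exists2 k, k < 3 & x \in p k.
  by rewrite !mem_cat => /or3P[]; [exists 0|exists 1|exists 2].
move=> x y /mem3[i i3 xi] /mem3[j j3 yj] xy.
have edges : seq_edge (p 0) x y \/ seq_edge (p 1) x y \/ seq_edge (p 2) x y <-> i = j /\ seq_edge (p i) x y.
  split=> [h|[_ h]].
    have [k k3 sk] : exists2 k, k < 3 & seq_edge (p k) x y.
      by case: h => [|[]]; [exists 0|exists 1|exists 2].
    have /andP[xk yk] := seq_edge_mem sk.
    by rewrite (disj _ _ _ i3 k3 xi xk) (disj _ _ _ j3 k3 yj yk).
  by case: i i3 h {xi} => [|[|[|//]]] _; [left|right; left|right; right].
have ends c : (forall k, k < 3 -> c k \in p k) ->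
    ((x \in [:: c 0; c 1; c 2]) && (y \in [:: c 0; c 1; c 2])) <-> i <> j /\ x = c i /\ y = c j.
  move=> cm; split=> [/andP[/lists[k k3 xk] /lists[l l3 yl]]|[_ [-> ->]]].
    have ik : i = k by apply: (disj _ _ x) => //; rewrite xk cm.
    have jl : j = l by apply: (disj _ _ y) => //; rewrite yl cm.
    by rewrite ik jl; split=> // e; move: xy; rewrite xk yl e eqxx.
  by apply/andP; split; apply/lists; [exists i | exists j].
have {}ea := ends _ am; have {}eb := ends _ bm.
have [e|/eqP ij] := eqVneq i j.
  rewrite -e in yj; have sE := same i3 xi yj xy.
  split; first by move/sE => h; case: edges => _ /(_ (conj e h)); tauto.
  move=> h; apply/sE; have : i = j /\ seq_edge (p i) x y \/ i <> j by tauto.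
  by case=> [[]//|].
have [_ cE] := cross i3 j3 (introN eqP ij) xi yj.
split; first by move/cE; tauto.
by move=> h; apply/cE; tauto.
Qed.

End Prism.

(** * The bipartite root graph of a line trigraph *)

Section Rook.
Variables (V I : finType) (T : trigraph V) (en : bool -> V -> I).
Hypothesis en_inj : forall u v, en false u = en false v -> en true u = en true v -> u = v.
Hypothesis enP : forall u v, u != v ->
  adjacent T u v = (en false u == en false v) || (en true u == en true v).
Hypothesis strong3 : forall X : {set V}, clique T X -> 3 <= #|X| -> strong_clique T X.

Implicit Types (u v w x y z : V) (W D : {set V}).
Notation node := (bool * I)%type.

(** A vertex [v] of the trigraph is an edge of the root graph, with one end [en o v] on each side
    [o]. Here two edges meet in an end on side [o]. *)
Definition share_side o u v := (u != v) && (en o u == en o v).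

Lemma shareC o : symmetric (share_side o).
Proof. by move=> u v; rewrite /share_side eq_sym [en o u == _]eq_sym. Qed.

Lemma adjacent_share o u v : adjacent T u v = share_side o u v || share_side (~~ o) u v.
Proof.
rewrite /share_side; case: (eqVneq u v) => [->|ne] /=; first by rewrite /adjacent eqxx.
by rewrite enP //; case: o => //=; rewrite orbC.
Qed.

Lemma share_adj o u v : share_side o u v -> adjacent T u v.
Proof. by rewrite (adjacent_share o) => ->. Qed.

Lemma adj_share u v : adjacent T u v -> exists o, share_side o u v.
Proof. by rewrite (adjacent_share true) => /orP[]; [exists true | exists false]. Qed.

Lemma share_excl o u v : share_side o u v -> ~~ share_side (~~ o) u v.
Proof.
case/andP => ne /eqP e1; apply/negP => /andP[_ /eqP e2]; case/eqP: ne.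
by case: o e1 e2 => /= e1 e2; apply: en_inj.
Qed.

Lemma share_trans o u v w : share_side o u v -> share_side o v w -> u != w -> share_side o u w.
Proof. by case/andP => _ /eqP e1 /andP[_ /eqP e2] ne; rewrite /share_side ne e1 e2 eqxx. Qed.

Lemma triangle_strong x y z : adjacent T x y -> adjacent T x z -> adjacent T y z -> strongly_adj T x y.
Proof.
move=> xy xz yz; apply: (@strong3 [set x; y; z]).
- move=> u v; rewrite !inE -!orbA => /or3P[]/eqP-> /or3P[]/eqP-> //; rewrite ?eqxx // => _;
  by rewrite // adjacentC.
- by rewrite setUC cardsU1 cards2 !inE negb_or ![z == _]eq_sym (adjacent_neq xy) (adjacent_neq xz) (adjacent_neq yz).
- by rewrite !inE eqxx.
- by rewrite !inE eqxx orbT.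
- exact: adjacent_neq xy.
Qed.

Definition incident (k : node) v := en k.1 v == k.2.

(** Adjacency in the subgraph of the root graph whose edges are the vertices in [W]. *)
Definition root_adj W : rel node :=
  fun k l => (k.1 != l.1) && [exists v in W, incident k v && incident l v].

Lemma hadjC W : symmetric (root_adj W).
Proof.
move=> k l; rewrite /root_adj eq_sym; congr andb; apply: eq_existsb => v.
by rewrite [incident k v && _]andbC.
Qed.

Lemma hadj_side W k l : root_adj W k l -> k.1 != l.1.
Proof. by case/andP. Qed.

(** The edge joining [k] and [l]; the default [v0] is not reached when these nodes are adjacent. *)
Definition eg W (v0 : V) k l := odflt v0 [pick v in W | incident k v && incident l v].

Lemma egP W v0 k l : root_adj W k l -> [/\ eg W v0 k l \in W, incident k (eg W v0 k l) & incident l (eg W v0 k l)].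
Proof.
case/andP => _ /existsP[v hv]; rewrite /eg; case: pickP => [w /and3P[] //|/(_ v)].
by rewrite hv.
Qed.

Local Opaque eg.

Lemma inc_node o v : incident (o, en o v) v.
Proof. exact: eqxx. Qed.

Lemma inc_two k l m v : k.1 != l.1 -> incident k v -> incident l v -> incident m v = (m == k) || (m == l).
Proof.
rewrite /incident; case: k => ok k; case: l => ol l; case: m => om m /= ne /eqP<- /eqP<-.
rewrite !xpair_eqE; case: (eqVneq om ok) => [->|n1] /=.
  by rewrite (negbTE ne) orbF eq_sym.
have -> : om = ol by move: ne n1; case: om; case: (ok); case: (ol).
by rewrite eqxx eq_sym.
Qed.

Lemma inc_eq k l u v : k.1 != l.1 -> incident k u -> incident l u -> incident k v -> incident l v -> u = v.
Proof.
rewrite /incident; case: k => ok k; case: l => ol l /= ne /eqP e1 /eqP e2 /eqP e3 /eqP e4.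
have h o : en o u = en o v.
  have [->|->] : o = ok \/ o = ol by move: ne; case: (o); case: (ok); case: (ol) => //=; auto.
    by rewrite e1 e3.
  by rewrite e2 e4.
exact: en_inj.
Qed.

Lemma adj_inc u v : u != v -> adjacent T u v = [exists k, incident k u && incident k v].
Proof.
move=> ne; apply/idP/existsP => [/adj_share[o /andP[_ /eqP e]]|[k /andP[/eqP e1 /eqP e2]]].
  by exists (o, en o u); rewrite inc_node /incident /= e eqxx.
by apply: (@share_adj k.1); rewrite /share_side ne e1 e2 eqxx.
Qed.

Lemma hadj_path_parity W k l : path (root_adj W) k l -> (last k l).1 = k.1 (+) odd (size l).
Proof.
elim: l k => [|m l IH] k /=; first by rewrite addbF.
case/andP => /hadj_side ne /IH ->; move: ne.
by case: (k.1); case: (m.1) => //=; case: (odd _).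
Qed.

(** * The edges of a theta form an odd prism *)

Section Theta.
Variables (W : {set V}) (v0 : V) (s t : node) (P : nat -> seq node).
Hypothesis st : s.1 = t.1.
Hypothesis pathP_ : forall i, i < 3 -> path (root_adj W) s (rcons (P i) t).
Hypothesis uniqP_ : forall i, i < 3 -> uniq (s :: rcons (P i) t).
Hypothesis disjP : forall i j k, i < 3 -> j < 3 -> k \in P i -> k \in P j -> i = j.

(** The node at position [k] of path [i]: [s] is at position 0 and [t] at position [L i].
    Accordingly [E i k] joins positions [k] and [k.+1]. *)
Let N i k := nth s (s :: rcons (P i) t) k.
Let L i := (size (P i)).+1.
Let E i k := eg W v0 (N i k) (N i k.+1).
Let pp i := pairmap (eg W v0) s (rcons (P i) t).

Lemma size_pp i : size (pp i) = L i.
Proof. by rewrite size_pairmap size_rcons. Qed.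

Lemma nth_pp i k : k < L i -> nth v0 (pp i) k = E i k.
Proof. by move=> lk; rewrite (nth_pairmap s) ?size_rcons. Qed.

Lemma N_adj i k : i < 3 -> k < L i -> root_adj W (N i k) (N i k.+1).
Proof. by move=> i3 lk; have /(pathP s) := pathP_ i3; apply; rewrite size_rcons. Qed.

Lemma E_inc i k m : i < 3 -> k < L i -> incident m (E i k) = (m == N i k) || (m == N i k.+1).
Proof.
move=> i3 lk; have h := N_adj i3 lk; have [_ h1 h2] := egP v0 h.
exact: inc_two (hadj_side h) h1 h2.
Qed.

Lemma N_inj i k l : i < 3 -> k <= L i -> l <= L i -> N i k = N i l -> k = l.
Proof.
move=> i3 lk ll /eqP; rewrite nth_uniq ?uniqP_ //= ?size_rcons ?ltnS //; exact: eqP.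
Qed.

Lemma N_cases i k : k <= L i -> [\/ k = 0 /\ N i k = s, k = L i /\ N i k = t | 0 < k < L i /\ N i k \in P i].
Proof.
rewrite /L /N; case: k => [|k]; first by constructor 1.
rewrite ltnS leq_eqVlt => /orP[/eqP->|lk].
  by constructor 2; rewrite /= nth_rcons ltnn eqxx.
by constructor 3; rewrite /= ltnS lk nth_rcons lk mem_nth.
Qed.

Lemma s_t_notin i : i < 3 -> [/\ s != t, s \notin P i & t \notin P i].
Proof.
move=> /uniqP_; rewrite cons_uniq rcons_uniq mem_rcons inE negb_or -andbA.
by case/and4P.
Qed.

Lemma N_cross i j k l : i < 3 -> j < 3 -> i != j -> k <= L i -> l <= L j ->
  N i k = N j l -> k = 0 /\ l = 0 \/ k = L i /\ l = L j.
Proof.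
move=> i3 j3 ij lk ll e; have [st' si ti] := s_t_notin i3; have [_ sj tj] := s_t_notin j3.
case: (N_cases lk) => -[hk nk]; case: (N_cases ll) => -[hl nl]; try by [left|right].
- by move: st'; rewrite -nk -nl e eqxx.
- by move: sj; rewrite -nk e nl.
- by move: st'; rewrite -nk -nl e eqxx.
- by move: tj; rewrite -nk e nl.
- by move: si; rewrite -nl -e nk.
- by move: ti; rewrite -nl -e nk.
by move: ij; rewrite (disjP i3 j3 nk) ?eqxx // e.
Qed.

Lemma L_ge2 i : i < 3 -> 2 <= L i.
Proof.
move=> i3; rewrite /L; have := pathP_ i3; case: (P i) => //=.
by rewrite andbT => /hadj_side; rewrite st eqxx.
Qed.

Lemma E_common i j k l : i < 3 -> j < 3 -> k < L i -> l < L j ->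
  [exists m, incident m (E i k) && incident m (E j l)] <->
  [\/ N i k = N j l, N i k = N j l.+1, N i k.+1 = N j l | N i k.+1 = N j l.+1].
Proof.
move=> i3 j3 lk ll; split=> [/existsP[m]|].
  rewrite !E_inc // => /andP[/orP[]/eqP-> /orP[]/eqP->];
    by [constructor 1|constructor 2|constructor 3|constructor 4].
have ex m : (m == N i k) || (m == N i k.+1) -> (m == N j l) || (m == N j l.+1) ->
    [exists m, incident m (E i k) && incident m (E j l)].
  by move=> h1 h2; apply/existsP; exists m; rewrite !E_inc // h1 h2.
by case=> e; [apply: (ex (N i k)) | apply: (ex (N i k)) | apply: (ex (N i k.+1)) | apply: (ex (N i k.+1))];
   rewrite -?e ?eqxx ?orbT.
Qed.

(** Distinct paths share only the nodes [s] and [t], so their edges meet only if both are first or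
    both are last. They cannot coincide, since each path has at least two edges. *)
Lemma E_cross i j k l : i < 3 -> j < 3 -> i != j -> k < L i -> l < L j ->
  E i k <> E j l /\
  (adjacent T (E i k) (E j l) <-> (k = 0 /\ l = 0) \/ (k.+1 = L i /\ l.+1 = L j)).
Proof.
move=> i3 j3 ij lk ll; have Li := L_ge2 i3.
have cr k' l' : k' <= L i -> l' <= L j -> N i k' = N j l' -> k' = 0 /\ l' = 0 \/ k' = L i /\ l' = L j.
  exact: N_cross.
have ne : E i k <> E j l.
  move=> e; have h m : (m == N i k) || (m == N i k.+1) = (m == N j l) || (m == N j l.+1).
    by rewrite -!E_inc // e.
  move: (h (N i k)) (h (N i k.+1)); rewrite !eqxx orbT /=.
  move=> /esym/orP[]/eqP/cr h1 /esym/orP[]/eqP/cr h2;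
    move: (h1 (ltnW lk)) (h2 lk); rewrite ?(ltnW ll) ?ll => /(_ isT) {}h1 /(_ isT) {}h2; clear - Li lk ll h1 h2; lia.
split=> //; rewrite adj_inc; last exact/eqP.
apply: (iff_trans (E_common i3 j3 lk ll)); split.
  case=> /cr h; [have {}h := h (ltnW lk) (ltnW ll)|have {}h := h (ltnW lk) ll|have {}h := h lk (ltnW ll)|have {}h := h lk ll];
  clear - lk ll h; lia.
case=> -[e1 e2]; first by constructor 1; rewrite e1 e2.
constructor 4; rewrite e1 e2.
by case: (N_cases (leqnn (L i))) => [[]//|[_ ->]|[]]; rewrite ?ltnn ?andbF //;
   case: (N_cases (leqnn (L j))) => [[]//|[_ ->]|[]]; rewrite ?ltnn ?andbF.
Qed.

Lemma E_same i k l : i < 3 -> k < L i -> l < L i -> k <> l ->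
  E i k <> E i l /\ (adjacent T (E i k) (E i l) <-> k.+1 = l \/ l.+1 = k).
Proof.
move=> i3 lk ll kl.
have inj k' l' : k' <= L i -> l' <= L i -> N i k' = N i l' -> k' = l'.
  exact: N_inj.
have ne : E i k <> E i l.
  move=> e; have h m : (m == N i k) || (m == N i k.+1) = (m == N i l) || (m == N i l.+1).
    by rewrite -!E_inc // e.
  move: (h (N i k)) (h (N i k.+1)); rewrite !eqxx orbT /=.
  move=> /esym/orP[]/eqP/inj h1 /esym/orP[]/eqP/inj h2;
    move: (h1 (ltnW lk)) (h2 lk); rewrite ?(ltnW ll) ?ll => /(_ isT) {}h1 /(_ isT) {}h2; clear - kl h1 h2; lia.
split=> //; rewrite adj_inc; last exact/eqP.
apply: (iff_trans (E_common i3 i3 lk ll)); split.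
  case=> /inj h; [have {}h := h (ltnW lk) (ltnW ll)|have {}h := h (ltnW lk) ll|have {}h := h lk (ltnW ll)|have {}h := h lk ll];
  clear - kl h; lia.
by case=> e; [constructor 3 | constructor 2]; rewrite e.
Qed.

Lemma mem_pp i x : x \in pp i -> exists2 k, k < L i & x = E i k.
Proof.
by case/(nthP v0) => k; rewrite size_pp => lk <-; exists k; rewrite ?nth_pp.
Qed.

Lemma pp_uniq i : i < 3 -> uniq (pp i).
Proof.
move=> i3; apply/(uniqP v0) => k l; rewrite !inE size_pp => lk ll.
rewrite !nth_pp // => e; apply/eqP/negPn/negP => /eqP kl.
by case: (E_same i3 lk ll kl).
Qed.

(** The edges at [s] and the edges at [t] are the two triangles. As [s] and [t] are on the same
    side, each path has an even number of edges. The theta need not be induced: a chord is another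
    vertex of the trigraph. *)
Lemma theta_odd_prism : is_odd_prism T (pp 0) (pp 1) (pp 2).
Proof.
have ev i : i < 3 -> ~~ odd (size (pp i)).
  move=> i3; have := hadj_path_parity (pathP_ i3); rewrite last_rcons st size_rcons size_pp /L.
  by case: (t.1); case: (odd _).
split; last by rewrite !ev.
have nE i k x : i < 3 -> k < L i -> nth x (pp i) k = E i k.
  by move=> i3 lk; rewrite (set_nth_default v0) ?size_pp // nth_pp.
apply: (@prism_of_family _ _ pp (fun i => E i 0) (fun i => E i (L i).-1)).
- move=> i i3; have := nE i 0 v0 i3 (ltn0Sn _); have := size_pp i; case: (pp i) => //= x l _ ->.
  by [].
- by move=> i i3; rewrite -(nth_last) size_pp nE.
- by move=> i i3; rewrite size_pp L_ge2 // pp_uniq.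
- move=> i j x y i3 j3 ij /mem_pp[k lk ->] /mem_pp[l ll ->].
  have [ne ad] := E_cross i3 j3 ij lk ll; split=> //.
  have inj i' k' l' : i' < 3 -> k' < L i' -> l' < L i' -> E i' k' = E i' l' -> k' = l'.
    move=> i'3 lk' ll' e; apply/eqP/negPn/negP => /eqP kl.
    by case: (E_same i'3 lk' ll' kl).
  apply: (iff_trans ad); split.
    case=> -[e1 e2]; [left|right]; first by rewrite e1 e2.
    by rewrite -e1 -e2.
  case=> -[/inj e1 /inj e2]; [left|right].
    by rewrite e1 // e2.
  by rewrite e1 // e2.
move=> i x y i3 /mem_pp[k lk ->] /mem_pp[l ll ->] ne.
have kl : k <> l by move=> e; rewrite e eqxx in ne.
have [_ ad] := E_same i3 lk ll kl; apply: (iff_trans ad); split.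
  case=> e; [exists k | exists l]; rewrite size_pp -e in lk ll *; split => //;
    rewrite !nE //; by [left|right].
have inj k' l' : k' < L i -> l' < L i -> E i k' = E i l' -> k' = l'.
  move=> lk' ll' e; apply/eqP/negPn/negP => /eqP kl'.
  by case: (E_same i3 lk' ll' kl').
case=> m [lm]; rewrite size_pp in lm; rewrite !nE // 1?ltnW //.
have lm' := ltnW lm.
case=> -[h1 h2]; [left|right].
  by rewrite -(inj _ _ lm' lk h1) -(inj _ _ lm ll h2).
by rewrite -(inj _ _ lm' ll h1) -(inj _ _ lm lk h2).
Qed.

End Theta.

Hypothesis noPrism : forall p1 p2 p3, ~ is_odd_prism T p1 p2 p3.

Lemma no_theta W (s t : node) P1 P2 P3 : s.1 = t.1 ->
  path (root_adj W) s (rcons P1 t) -> path (root_adj W) s (rcons P2 t) -> path (root_adj W) s (rcons P3 t) ->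
  uniq (s :: t :: P1 ++ P2 ++ P3) -> False.
Proof.
move=> st h1 h2 h3 un.
have [v0 _] : exists v0 : V, True.
  case: P1 h1 {un} => [|m P1] /= /andP[/andP[_ /existsP[v _]] _]; by exists v.
(* The third path [P 2] is the default value of [nth]. *)
pose P i := nth P3 [:: P1; P2] i.
have pP i : i < 3 -> path (root_adj W) s (rcons (P i) t) by case: i => [|[|[|]]].
move: un; rewrite /= !inE !mem_cat !negb_or !cat_uniq.
case/and3P => /and4P[nst s1 s2 s3] /and3P[t1 t2 t3] /and3P[u1 /hasPn n1 /and3P[u2 /hasPn n2 u3]].
have uP i : i < 3 -> uniq (s :: rcons (P i) t).
  by case: i => [|[|[|]]] //= _; rewrite mem_rcons inE negb_or rcons_uniq nst /= ?s1 ?s2 ?s3 ?t1 ?t2 ?t3.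
have n12 k : k \in P1 -> k \in P2 -> False.
  by move=> k1 k2; move: (n1 k); rewrite mem_cat k2 k1 => /(_ isT).
have n13 k : k \in P1 -> k \in P3 -> False.
  by move=> k1 k2; move: (n1 k); rewrite mem_cat k2 k1 orbT => /(_ isT).
have n23 k : k \in P2 -> k \in P3 -> False.
  by move=> k1 k2; move: (n2 k k2); rewrite /= k1.
apply: (noPrism (theta_odd_prism v0 st pP uP _)).
by move=> [|[|[|i]]] [|[|[|j]]] k //= _ _ h h'; exfalso; eauto.
Qed.

End Rook.

(** * Line trigraphs *)

Section Line.
Variables (V I : finType) (T : trigraph V) (en : bool -> V -> I).
Hypothesis en_inj : forall u v, en false u = en false v -> en true u = en true v -> u = v.
Hypothesis enP : forall u v, u != v ->
  adjacent T u v = (en false u == en false v) || (en true u == en true v).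
Hypothesis strong3 : forall X : {set V}, clique T X -> 3 <= #|X| -> strong_clique T X.

Implicit Types (u v w x y z : V) (W D : {set V}).
Notation node := (bool * I)%type.
Notation adj := (adjacent T).
Notation share := (share_side en).
Notation inc := (incident en).
Notation hadj := (root_adj en).

Let adj_sh := adjacent_share enP.
Let sh_adj := share_adj enP.
Let adj_shP := adj_share enP.
Let sh_excl := share_excl en_inj.
Let sh_trans := @share_trans V I en.
Let shC := @shareC V I en.
Let tri := triangle_strong strong3.

(** Along an induced path consecutive edges of the root graph meet alternately on the two sides. *)
Lemma turn o u w z : share o u w -> adj w z -> ~~ adj u z -> u != z -> share (~~ o) w z.
Proof.
move=> uw wz nuz uz; move: wz; rewrite (adj_sh o) => /orP[wz|//].
by case/negP: nuz; apply: (sh_adj (o := o)); apply: sh_trans wz uz.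
Qed.

(** An induced path of the full realization: unlike in [tpath], nonconsecutive vertices are strongly
    antiadjacent. *)
Definition rpath s := ipath adj (nonrel adj) s.

Lemma nonrelC : symmetric (nonrel adj).
Proof. by move=> u v; rewrite /nonrel eq_sym adjacentC. Qed.

Lemma rpath_rev s : rpath (rev s) = rpath s.
Proof. by apply: ipath_rev; [exact: adjacentC | exact: nonrelC]. Qed.

Lemma rpath_stop w t s : rpath (w :: t :: s) -> adj w (last t s) -> s = [::].
Proof.
case: s => // t' s /and3P[_ h _] a.
by have := allP h (last t' s) (mem_last _ _); rewrite /nonrel a andbF.
Qed.

(* In an internal vertex [v] of a path both of its sides are already used by its
   neighbours on the path, so a third vertex adjacent to [v] closes a triangle. *)
Lemma semi_mid p v n z : adj p v -> adj v n -> p != n -> ~~ adj p n ->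
  antiadjacent T v z -> z != p -> z != n -> ~~ adj v z.
Proof.
move=> pv vn pn npn avz zp zn; apply/negP => vz; have [o ovz] := adj_shP vz.
have third q : adj v q -> z != q -> share o v q -> False.
  move=> vq zq oq; move: avz; rewrite antiadjacentE (tri (z := q)) ?andbF //.
  by apply: (sh_adj (o := o)); apply: (sh_trans _ oq zq); rewrite shC.
have vp : adj v p by rewrite adjacentC.
case: (boolP (share o v p)) => [/(third _ vp zp)//|n1].
case: (boolP (share o v n)) => [/(third _ vn zn)//|n2].
case/negP: npn; apply: (sh_adj (o := ~~ o)); apply: (sh_trans (v := v) _ _ pn).
  by move: vp; rewrite shC (adj_sh o) (negbTE n1).
by move: vn; rewrite (adj_sh o) (negbTE n2).
Qed.

(** If [x] and [z] were adjacent, [x], [y], [z] would be a triangle, hence strong, although [x] and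
    [z] are antiadjacent. *)
Lemma dist2 x y z l : uniq (x :: y :: z :: l) -> tpath T (x :: y :: z :: l) -> ~~ adj x z.
Proof.
move=> un /and3P[xy /andP[xz _] h]; apply/negP => axz.
have yz : adj y z by case: l h {un} => [|? ?] /andP[].
move: xz; rewrite antiadjacentE (tri (z := y)) ?andbF //.
by rewrite adjacentC.
Qed.

Lemma tail_pure p u s : uniq (p :: u :: s) -> tpath T (p :: u :: s) -> rpath (u :: s).
Proof.
elim: s p u => // v t IH p u un tp.
have npv := dist2 un tp; case/and3P: (tp) => pu _ tu.
have un' : uniq (u :: v :: t) by case/andP: un.
apply/and3P; split; [by case/and3P: tu| |exact: (IH u)].
apply/allP => z zt; rewrite /nonrel.
have zu : u != z by apply: contraTneq un' => ->; rewrite /= inE zt orbT.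
rewrite zu /=; apply: (semi_mid (n := v) pu) => //.
- by case/and3P: tu.
- by apply: contraTneq un => ->; rewrite /= !inE eqxx orbT.
- by case/and3P: tu => _ /allP/(_ _ zt).
- by apply: contraTneq un => <-; rewrite /= !inE zt !orbT.
by apply: contraTneq un' => <-; rewrite /= zt /= andbF.
Qed.

(** By [tail_pure], applied to the path and to its reverse, only the two ends could be a
    nonconsecutive switchable pair. *)
Lemma tpath_pure u s : uniq (u :: s) -> strongly_anti T u (last u s) -> tpath T (u :: s) -> rpath (u :: s).
Proof.
case: s => // v t; case/lastP: t => [|t l] un ul tp; first by case/and3P: tp => h _ _; apply/and3P.
apply/and3P; split; [by case/and3P: tp| |exact: tail_pure tp].
have : rpath (u :: v :: t).
  rewrite -rpath_rev; case E: (rev (u :: v :: t)) => [|w r] //.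
  apply: (@tail_pure l); rewrite -E -rev_rcons.
    by rewrite rev_uniq.
  by rewrite /tpath ipath_rev //; [exact: adjacentC | exact: antiadjacentC].
case/and3P => _ h _; rewrite all_rcons h andbT /nonrel.
by move: ul; rewrite /= last_rcons strongly_antiE.
Qed.

(** Convexity with respect to induced paths: parity needs to be checked only for paths inside [W] to
    obtain an even pair of the whole trigraph. *)
Definition pclosed W := forall u s, uniq (u :: s) -> rpath (u :: s) -> u \in W -> last u s \in W ->
  {subset s <= W}.

Lemma line_even W u v : pclosed W -> u \in W -> v \in W -> u != v -> ~~ adj u v ->
  (forall s, uniq (u :: s) -> rpath (u :: s) -> {subset s <= W} -> last u s = v -> ~~ odd (size s)) ->
  even_pair T u v.
Proof.
move=> pW uW vW ne nuv h.
have sa : strongly_anti T u v by rewrite strongly_antiE ne.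
apply: even_pairP => // s us un tp ls.
have un' : uniq (u :: s) by rewrite /= us.
have rp : rpath (u :: s) by apply: tpath_pure; rewrite ?ls.
by apply: h => //; apply: (pW u) => //; rewrite ls.
Qed.

Lemma pclosedT : pclosed [set: V].
Proof. by move=> u s _ _ _ _ z _; rewrite inE. Qed.

Definition simplicial W x := [forall a in W, forall b in W, [&& adj x a, adj x b & a != b] ==> adj a b].

Lemma simplicialP W x : reflect (forall a b, a \in W -> b \in W -> adj x a -> adj x b -> a != b -> adj a b)
  (simplicial W x).
Proof.
apply: (iffP forall_inP) => h.
  by move=> a b aW bW xa xb ab; have /forall_inP/(_ b bW) := h a aW; rewrite xa xb ab.
move=> a aW; apply/forall_inP => b bW; apply/implyP => /and3P[xa xb ab]; exact: h.
Qed.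

Lemma non_simplicial W x : ~~ simplicial W x ->
  exists a b, [/\ a \in W, b \in W, adj x a, adj x b & a != b /\ ~~ adj a b].
Proof.
rewrite negb_forall => /existsP[a]; rewrite negb_imply negb_forall => /andP[aW /existsP[b]].
rewrite !negb_imply => /and3P[bW /and3P[xa xb ab] nab].
by exists a, b.
Qed.

(** An inner vertex of an induced path has two nonadjacent neighbours on it, so it is not
    simplicial. *)
Lemma strip W x : pclosed W -> simplicial W x -> pclosed (W :\ x).
Proof.
move=> pW /simplicialP sx u s un rp; rewrite !in_setD1 => /andP[ux uW] /andP[lx lW].
have sub := pW _ _ un rp uW lW; move=> z zs; rewrite in_setD1 sub // andbT.
apply/eqP => e; rewrite {z}e in zs.
have [s1 [s2 e]] : exists s1 s2, s = s1 ++ x :: s2 by case/splitPr: zs => s1 s2; exists s1, s2.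
case: s2 e => [|n s2] e; first by rewrite e last_cat /= eqxx in lx.
have [s0 [p e']] : exists s0 p, u :: s1 = rcons s0 p.
  by exists (belast u s1), (last u s1); rewrite lastI.
have rp' : rpath (rcons s0 p ++ x :: n :: s2) by rewrite -e' cat_cons -e.
have nW : n \in W by apply: sub; rewrite e mem_cat !inE eqxx !orbT.
have pW' : p \in W.
  have : p \in u :: s1 by rewrite e' mem_rcons mem_head.
  by rewrite inE => /orP[/eqP->//|ps]; apply: sub; rewrite e mem_cat ps.
move: rp'; rewrite cat_rcons => /ipath_cat/andP[_ /and3P[px /andP[/andP[pn npn] _] h]].
have xn : adj x n by case: (s2) h => [|? ?] /andP[].
by case/negP: npn; apply: sx => //; rewrite adjacentC.
Qed.

(** Since sides alternate, the first side and the parity of the length determine the side on which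
    the last step takes place. *)
Lemma rpath_parity u w s o : uniq (u :: w :: s) -> rpath (u :: w :: s) -> share o u w ->
  exists2 y, y \in u :: w :: s & share (o (+) odd (size s)) y (last w s).
Proof.
elim: s u w o => [|w' s IH] u w o un rp ouw.
  by exists u; rewrite ?mem_head //= addbF.
case/and3P: (rp) => _ /andP[/andP[ne nuw'] _] rp'.
have ww' : adj w w' by case: (s) rp' => [|? ?] /andP[].
have [|y yin yl] := IH w w' (~~ o) _ rp' (turn ouw ww' nuw' ne); first by case/andP: un.
exists y; first by rewrite inE yin orbT.
by move: yl; rewrite /= addbN addNb.
Qed.

(** On side [o] only [x] and [z] meet, and on the other side only [z] and [y]. A path from [x] to
    [y] avoiding [z] thus leaves [x] on side [~~ o] and reaches [y] on side [o], so by alternation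
    its length is even; through [z] the length is two. *)
Lemma even_mid W x z y o : pclosed W -> x \in W -> y \in W -> share o x z -> share (~~ o) z y ->
  (forall v, v \in W -> share o v z -> v = x) -> (forall v, v \in W -> share (~~ o) v z -> v = y) ->
  even_pair T x y.
Proof.
move=> pW xW yW xz zy ox oy.
have xny : x != y.
  by apply/eqP => e; case/negP: (sh_excl xz); rewrite e shC.
have nxy : ~~ adj x y.
  apply/negP; rewrite (adj_sh o) => /orP[h|h].
    have := ox y yW; rewrite shC in h; rewrite (sh_trans h xz) //.
      by move=> /(_ isT) e; rewrite e eqxx in xny.
    by case/andP: zy; rewrite eq_sym.
  have := oy x xW; rewrite shC in zy; rewrite (sh_trans h zy) //.
    by move=> /(_ isT) e; rewrite e eqxx in xny.
  by case/andP: xz.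
apply: (line_even pW) => // -[|w s] // un rp sub ls.
have xw : adj x w by case: (s) rp => [|? ?] /andP[].
have wW : w \in W by apply: sub; rewrite mem_head.
have [o1 o1xw] := adj_shP xw.
case: (eqVneq w z) => [e|wz].
  subst w; case: s un rp sub ls => [|w2 s] un rp sub ls.
    by move: zy; rewrite -ls /= => /andP[]; rewrite eqxx.
  have rp2 : rpath (z :: w2 :: s) by case/and3P: rp.
  have zl : adj z (last w2 s) by move: ls => /= ->; exact: sh_adj zy.
  by rewrite (rpath_stop rp2 zl).
have e1 : o1 = ~~ o.
  case: (eqVneq o1 o) => [e1|]; last by case: (o1); case: (o).
  rewrite e1 shC in o1xw; have := ox w wW (sh_trans o1xw xz wz) => e2.
  by move: un; rewrite e2 /= inE eqxx.
rewrite e1 in o1xw; have [y' y'in] := rpath_parity un rp o1xw.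
have -> : last w s = y by [].
move=> h; case E: (odd (size s)) h => h; first by rewrite /= E.
rewrite addbF in h.
have y'W : y' \in W by move: y'in; rewrite inE => /orP[/eqP->//|]; apply: sub.
case: (eqVneq y' z) => [e|y'z]; last first.
  rewrite [share _ z y]shC in zy.
  by have e2 := oy _ y'W (sh_trans h zy y'z); move: h; rewrite e2 => /andP[]; rewrite eqxx.
have xz' : adj x z := sh_adj xz.
move: y'in; rewrite e !inE [z == x]eq_sym (negbTE (adjacent_neq xz')) [z == w]eq_sym (negbTE wz) /=.
move=> zs; case: (s) zs rp => // w2 s' zs /and3P[_ h' _].
by have := allP h' _ zs; rewrite /nonrel xz' andbF.
Qed.

Definition nodes W : {set node} := [set k | [exists v in W, inc k v]].

Lemma nodesP W k : reflect (exists2 v, v \in W & inc k v) (k \in nodes W).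
Proof. rewrite inE; exact: exists_inP. Qed.

Lemma hadj_inc W k l v : v \in W -> k.1 != l.1 -> inc k v -> inc l v -> hadj W k l.
Proof. by move=> vW ne h1 h2; rewrite /root_adj ne; apply/exists_inP; exists v; rewrite ?h1 ?h2. Qed.

Lemma hadjP W k l : hadj W k l -> exists2 v, v \in W & inc k v && inc l v.
Proof. by case/andP => _ /exists_inP. Qed.

Lemma inc_adj k u v : u != v -> inc k u -> inc k v -> adj u v.
Proof. by move=> ne h1 h2; rewrite (adj_inc enP) //; apply/existsP; exists k; rewrite h1 h2. Qed.

(** The edges [a b] and [c d] are the only neighbours in [W] of the edge [b c], which is the middle
    vertex in [even_mid]. *)
Lemma chain_pair W (K : {set node}) a b c d : pclosed W -> is_chain (hadj W) K a b c d ->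
  exists x y, [/\ x \in W, y \in W, inc b x, inc c y & even_pair T x y].
Proof.
move=> pW [bK cK [ab [bc cd]] [ac bd] [Nb Nc]].
have [x xW /andP[ax bx]] := hadjP ab; have [z zW /andP[bz cz]] := hadjP bc.
have [y yW /andP[cy dy]] := hadjP cd.
have sab := hadj_side ab; have sbc := hadj_side bc; have scd := hadj_side cd.
exists x, y; split=> //.
have c1 : c.1 = ~~ b.1 by move: sbc; case: (b.1); case: (c.1).
have bnc : b != c by apply: contraNneq sbc => ->.
have xz : share b.1 x z.
  rewrite /share_side; move/eqP: (bx) => ->; move/eqP: (bz) => ->; rewrite eqxx andbT.
  apply: contraTneq cz => <-; rewrite (inc_two _ sab ax bx) negb_or eq_sym ac.
  by rewrite eq_sym.
have zy : share (~~ b.1) z y.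
  rewrite /share_side -c1; move/eqP: (cy) => ->; move/eqP: (cz) => ->; rewrite eqxx andbT.
  apply: contraTneq bz => ->; rewrite (inc_two _ scd cy dy) negb_or bnc.
  by [].
apply: (even_mid pW xW yW xz zy) => v vW /andP[vz /eqP e].
  have bv : inc b v by rewrite /incident e; exact: bz.
  pose m := (~~ b.1, en (~~ b.1) v).
  have mv : inc m v by exact: inc_node.
  have bm : b.1 != m.1 by rewrite /m /=; case: (b.1).
  case: (Nb m (hadj_inc vW bm bv mv)) => em.
    by apply: (inc_eq en_inj (k := a) (l := b)) => //; rewrite -em.
  by case/eqP: vz; apply: (inc_eq en_inj (k := b) (l := c)) => //; rewrite -em.
have cv : inc c v by rewrite /incident c1 e -c1; exact: cz.
pose m := (b.1, en (b.1) v).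
have mv : inc m v by exact: inc_node.
have cm : c.1 != m.1 by rewrite /m /= c1; case: (b.1).
case: (Nc m (hadj_inc vW cm cv mv)) => em.
  by case/eqP: vz; apply: (inc_eq en_inj (k := b) (l := c)) => //; rewrite -em.
by apply: (inc_eq en_inj (k := c) (l := d)) => //; rewrite -em.
Qed.

Hypothesis noPrism : forall p1 p2 p3, ~ is_odd_prism T p1 p2 p3.

(** The chain is sought among nodes missed by [D], so that the resulting pair avoids [D]. Such nodes
    have degree at least two, because an edge of [W] outside [D] is not simplicial and so meets
    further edges at both ends. *)
Lemma outer_pair W D p q : pclosed W -> p \in nodes D -> q \in nodes D ->
  (forall v k, v \in W -> v \notin D -> inc k v -> k \in nodes D -> k = p \/ k = q) ->
  connect (inside (hadj W) (~: (nodes W :\: nodes D))) p q ->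
  (forall v, v \in W -> v \notin D -> ~~ simplicial W v) ->
  2 <= #|nodes W :\: nodes D| ->
  exists x y, [/\ x \in W, y \in W, x \notin D, y \notin D & even_pair T x y].
Proof.
move=> pW pD qD int conn ns K2; set K := nodes W :\: nodes D in K2 conn *.
have KP k : k \in K -> exists2 v, v \in W & inc k v /\ v \notin D.
  rewrite in_setD => /andP[kD /nodesP[v vW kv]]; exists v => //; split=> //.
  by apply: contraNN kD => vD; apply/nodesP; exists v.
have offD k v : k \in K -> inc k v -> v \notin D.
  rewrite in_setD => /andP[kD _] kv; apply: contraNN kD => vD; apply/nodesP; by exists v.
have lK : leafless (hadj W) K.
  move=> k /KP[v vW [kv vD]]; have [a [b [aW bW va vb [ab nab]]]] := non_simplicial (ns _ vW vD).
  have [w wW vw] : exists2 w, w \in W & share k.1 v w.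
    case: (boolP (share k.1 v a)) => h1; first by exists a.
    exists b => //; move: vb; rewrite (adj_sh k.1) => /orP[//|h2].
    move: va; rewrite (adj_sh k.1) (negbTE h1) /= => h3.
    by case/negP: nab; apply: (sh_adj (o := ~~ k.1)); apply: (sh_trans _ h2 ab); rewrite shC.
  have kw : inc k w by case/andP: vw => _ /eqP; rewrite /incident => <-.
  exists (~~ k.1, en (~~ k.1) v), (~~ k.1, en (~~ k.1) w).
  have sk i : k.1 != (~~ k.1, i : I).1 by rewrite /=; case: (k.1).
  split.
  - apply: contraNneq (sh_excl vw) => -[e]; rewrite /share_side e eqxx andbT.
    by case/andP: vw.
  - exact: (hadj_inc vW (sk _) kv (inc_node _ _ _)).
  - exact: (hadj_inc wW (sk _) kw (inc_node _ _ _)).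
have [|||a [b [c [d ch]]]] := @chain_exists _ (hadj W) fst (hadjC en W) (@hadj_side _ _ en W)
  (no_theta enP noPrism (W := W)) K p q lK K2 _ _ _ conn.
- by rewrite in_setD pD.
- by rewrite in_setD qD.
- move=> k u kK /hadjP[v vW /andP[kv uv]]; have vD := offD _ _ kK kv.
  case: (boolP (u \in nodes D)) => uD.
    by case: (int _ _ vW vD uv uD) => ->; rewrite eqxx ?orbT.
  by rewrite in_setD uD /=; apply/orP; left; apply/nodesP; exists v.
have [x [y [xW yW bx cy ev]]] := chain_pair pW ch.
case: ch => bK cK _ _ _; exists x, y; split=> //; by [apply: (offD b) | apply: (offD c)].
Qed.

(** Two disjoint edges outside [D] have four ends, and [D] can meet them only in [p] and [q]. *)
Lemma outer_nodes W D p q u v :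
  (forall v k, v \in W -> v \notin D -> inc k v -> k \in nodes D -> k = p \/ k = q) ->
  u \in W -> v \in W -> u \notin D -> v \notin D -> u != v -> ~~ adj u v ->
  2 <= #|nodes W :\: nodes D|.
Proof.
move=> int uW vW uD vD ne nuv.
pose n o w : node := (o, en o w).
have nn o o' : n o u != n o' v.
  by apply: contraNneq nuv => e; apply: (inc_adj (k := n o u) ne); [|rewrite e]; exact: inc_node.
have nn' o o' : n o v != n o' u by rewrite eq_sym nn.
have nu w : n true w != n false w by [].
have nu' w : n false w != n true w by [].
have c4 : #|[set n true u; n false u; n true v; n false v]| = 4.
  rewrite setUC cardsU1 setUC cardsU1 cards2 nu !inE !negb_or.
  by rewrite ?nn' ?nu ?nu'.
have : [set n true u; n false u; n true v; n false v] \subset (nodes W :\: nodes D) :|: [set p; q].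
  have h w o : w \in W -> w \notin D -> n o w \in (nodes W :\: nodes D) :|: [set p; q].
    move=> wW wD; have i := inc_node en o w.
    have nW : n o w \in nodes W by apply/nodesP; exists w.
    rewrite in_setU in_setD nW andbT; case: (boolP (n o w \in nodes D)) => //= nD.
    by rewrite in_set2; have [e|e] := int _ _ wW wD i nD; rewrite /n e eqxx ?orbT.
  by apply/subsetP => k; rewrite !in_setU !in_set1 -!orbA => /or4P[]/eqP->; rewrite -?in_set2 -?in_setU; apply: h.
move/subset_leq_card; rewrite c4 => h; have := leq_trans h (leq_card_setU _ _).
rewrite cards2 => h2; rewrite -(leq_add2r 2); apply: (leq_trans h2).
by rewrite leq_add2l; case: (p != q).
Qed.

Lemma stop_even u w s : rpath (u :: w :: s) -> ~~ adj u (last w s) -> adj w (last w s) -> ~~ odd (size (w :: s)).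
Proof.
case: s => [|t s] rp na aw; first by move: aw => /adjacent_neq; rewrite eqxx.
by have -> : s = [::] by apply: (@rpath_stop w t) => //; case/and3P: rp.
Qed.

Lemma clique_plus_even W x y : pclosed W -> x \in W -> y \in W -> x != y -> ~~ adj x y ->
  (forall a b, a \in W -> b \in W -> a != x -> b != x -> a != b -> adj a b) -> even_pair T x y.
Proof.
move=> pW xW yW xy nxy cl; apply: (line_even pW) => // -[|w s] // un rp sub ls.
have wx : w != x by apply: contraTneq un => ->; rewrite /= inE eqxx.
have xw : adj x w by case: (s) rp => [|? ?] /andP[].
have wy : w != y by apply: contraNneq nxy => <-.
apply: (stop_even rp); rewrite [last w s]ls //.
by apply: cl => //; [apply: sub; rewrite mem_head | rewrite eq_sym].
Qed.

Lemma nonclique_cases W (P : pred V) :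
  (exists u v, [/\ u \in W, v \in W, P u, P v & u != v /\ ~~ adj u v]) \/
  (forall u v, u \in W -> v \in W -> P u -> P v -> u != v -> adj u v).
Proof.
have [/existsP[u /existsP[v /and5P[uW vW Pu Pv /andP[ne nuv]]]]|] :=
  boolP [exists u, exists v, [&& u \in W, v \in W, P u, P v & (u != v) && ~~ adj u v]].
  by left; exists u, v.
rewrite negb_exists => /forallP h; right => u v uW vW Pu Pv ne.
by move: (h u); rewrite negb_exists => /forallP/(_ v); rewrite uW vW Pu Pv ne /= negbK.
Qed.

(** A simplicial vertex is removed as long as a nonadjacent pair survives; otherwise [W] is a clique
    plus one vertex. Without simplicial vertices [outer_pair] applies. *)
Lemma line_pair W u v : pclosed W -> u \in W -> v \in W -> u != v -> ~~ adj u v ->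
  exists x y, [/\ x \in W, y \in W & even_pair T x y].
Proof.
move: {2}#|W| (leqnn #|W|) => n; elim: n W u v => [|n IH] W u v cW pW uW vW ne nuv.
  by move: cW; rewrite leqn0 cards_eq0 => /eqP e0; rewrite e0 inE in uW.
have [/existsP[x /andP[xW sx]]|] := boolP [exists x, (x \in W) && simplicial W x].
  case: (nonclique_cases (W :\ x) predT) => [[a [b [aW bW _ _ [ab nab]]]]|cl].
    have c' : #|W :\ x| <= n by move: cW; rewrite (cardsD1 x) xW add1n ltnS.
    have [y [z [yW zW ev]]] := IH _ _ _ c' (strip pW sx) aW bW ab nab.
    by exists y, z; split=> //; [move: yW | move: zW]; rewrite in_setD1 => /andP[].
  have cl' a b : a \in W -> b \in W -> a != x -> b != x -> a != b -> adj a b.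
    by move=> aW bW ax bx; apply: cl; rewrite ?in_setD1 ?ax ?bx.
  case: (eqVneq u x) => [e|ux].
    by exists u, v; split=> //; apply: (clique_plus_even pW) => //; rewrite e.
  case: (eqVneq v x) => [e|vx].
    exists v, u; split=> //; apply: (clique_plus_even pW) => //; rewrite 1?eq_sym // 1?adjacentC // e //.
  by case/negP: nuv; apply: cl'.
rewrite negb_exists => /forallP ns.
have {}ns x : x \in W -> ~~ simplicial W x by move=> xW; move: (ns x); rewrite xW.
have [a [b [aW bW ua ub [ab nab]]]] := non_simplicial (ns _ uW).
(* The single edge [u] is taken as the part [D], with its ends as the cut. *)
pose p : node := (true, en true u); pose q : node := (false, en false u).
have int w k : w \in W -> w \notin [set u] -> inc k w -> k \in nodes [set u] -> k = p \/ k = q.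
  move=> _ _ _ /nodesP[w']; rewrite in_set1 => /eqP->.
  by rewrite (inc_two k (k := p) (l := q) (v := u)) ?inc_node // => /orP[]/eqP; [left|right].
have mD o : (o, en o u) \in nodes [set u] by apply/nodesP; exists u; rewrite ?set11 ?inc_node.
have [||x [y [xW yW _ _ ev]]] := @outer_pair W [set u] p q pW (mD _) (mD _) int _ (fun v vW _ => ns v vW).
- apply: connect1; rewrite /inside !in_setC !in_setD !mD /=.
  by apply: (@hadj_inc W p q u) => //; exact: inc_node.
- by apply: (outer_nodes int aW bW) => //; rewrite in_set1 eq_sym; [exact: adjacent_neq ua | exact: adjacent_neq ub].
by exists x, y.
Qed.

End Line.

(** * Line trigraphs: even pairs that avoid the switchable component *)

Section LineSwitchable.
Variables (V I : finType) (T : trigraph V) (en : bool -> V -> I).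
Hypothesis en_inj : forall u v, en false u = en false v -> en true u = en true v -> u = v.
Hypothesis enP : forall u v, u != v ->
  adjacent T u v = (en false u == en false v) || (en true u == en true v).
Hypothesis strong3 : forall X : {set V}, clique T X -> 3 <= #|X| -> strong_clique T X.
Hypothesis noPrism : forall p1 p2 p3, ~ is_odd_prism T p1 p2 p3.

Implicit Types (u v w x y z : V) (W D : {set V}).
Notation node := (bool * I)%type.
Notation adj := (adjacent T).
Notation share := (share_side en).
Notation inc := (incident en).
Notation hadj := (root_adj en).
Notation nodes := (nodes en).
Notation rpath := (rpath T).
Notation pclosed := (pclosed T).

Let adj_sh := adjacent_share enP.
Let sh_adj := share_adj enP.
Let adj_shP := adj_share enP.
Let sh_excl := share_excl en_inj.
Let sh_trans := @share_trans V I en.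
Let shC := @shareC V I en.
Let turn := turn enP.

Lemma share_neq o u v : share o u v -> u != v.
Proof. by case/andP. Qed.

Lemma rpath_next w t s : rpath (w :: t :: s) -> adj w t.
Proof. by case/andP. Qed.

Lemma rpath_skip w t z s : rpath (w :: t :: z :: s) -> w != z /\ ~~ adj w z.
Proof. by case/and3P => _ /andP[/andP[]]. Qed.

Lemma rpath_tl w s : rpath (w :: s) -> rpath s.
Proof. by case: s => // t s /and3P[]. Qed.

Section Light.
Variables (W : {set V}) (a c b : V) (o : bool).
Hypotheses (aW : a \in W) (bW : b \in W) (cW : c \in W).
Hypotheses (ca : share o c a) (cb : share (~~ o) c b) (ab : a != b) (nab : ~~ adj a b).
Hypothesis cN : forall w, w \in W -> adj c w -> w = a \/ w = b.
Notation D := [set a; c; b].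

Lemma light_off w : w \in W -> w \notin D -> ~~ adj w c.
Proof.
move=> wW; apply: contraNN; rewrite adjacentC => /(cN wW)[]->; rewrite !inE eqxx ?orbT //.
Qed.

(* A path entering the switchable component at [a] leaves it at [b]. *)
Lemma light_branch x y s : uniq (x :: a :: s) -> rpath (x :: a :: s) -> {subset s <= W} ->
  x \in W -> x \notin D -> y \notin D -> last a s = y -> ~~ adj x y ->
  (forall u v, u \in W -> v \in W -> u \notin D -> v \notin D -> u != x -> v != x -> u != v -> adj u v) ->
  [\/ adj x b, adj y b | forall w, w \in W -> w \notin D -> w != x -> ~~ adj x w -> ~~ adj w b] ->
  ~~ odd (size (a :: s)).
Proof.
move=> un rp sub xW xD yD ls nxy cl cond.
have ac : share o a c by rewrite shC.
have xa := rpath_next rp.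
have xnc := light_off xW xD.
have xa' : share (~~ o) x a.
  move: xa; rewrite (adj_sh o) => /orP[h|//]; case/negP: xnc.
  apply: (sh_adj (o := o)); apply: (sh_trans h ac).
  by apply: contraNneq xD => ->; rewrite !inE eqxx orbT.
case: s un rp sub ls => [|w s] un rp sub ls.
  by move: yD; rewrite -ls /= !inE eqxx.
have [xw nxw] := rpath_skip rp; have rp1 := rpath_tl rp.
have wW : w \in W by apply: sub; rewrite mem_head.
have aw := turn xa' (rpath_next rp1) nxw xw; rewrite negbK in aw.
have wc : w = c.
  apply/eqP/negPn/negP => wc; have cw := sh_trans ca aw; rewrite eq_sym wc in cw.
  have [e|e] := cN wW (sh_adj (cw isT)); first by move: aw; rewrite e => /share_neq; rewrite eqxx.
  by case/negP: nab; rewrite -e; apply: sh_adj aw.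
subst w; case: s un rp rp1 sub ls => [|w s] un rp rp1 sub ls.
  by move: yD; rewrite -ls /= !inE eqxx orbT.
have rp2 := rpath_tl rp1; have w2W : w \in W by apply: sub; rewrite !inE eqxx orbT.
have wb : w = b.
  case: (cN w2W (rpath_next rp2)) => // e.
  by move: un; rewrite e /= !inE eqxx ?orbT /= ?andbF.
subst w; case: s un rp rp1 rp2 sub ls => [|w s] un rp rp1 rp2 sub ls.
  by move: yD; rewrite -ls /= !inE eqxx orbT.
have rp3 := rpath_tl rp2; have wW' : w \in W by apply: sub; rewrite !inE eqxx !orbT.
have bw := rpath_next rp3.
(* If the path stops at [w], it is [x], [a], [c], [b], [w], of length four. Each alternative of
   [cond] excludes a longer one. *)
case: s un rp rp1 rp2 rp3 sub ls => // t s un rp rp1 rp2 rp3 sub ls.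
have yin : y \in t :: s by rewrite -ls /=; apply: mem_last.
case: cond => [xb|yb|far_].
- by case/and3P: rp => _ /and4P[_ /andP[_ h] _ _] _; rewrite xb in h.
- case/and3P: rp3 => _ /allP/(_ _ yin); rewrite /nonrel adjacentC yb andbF //.
- have wx : w != x by apply: contraTneq un => ->; rewrite /= !inE eqxx ?orbT /= ?andbF.
  have wD : w \notin D.
    rewrite !inE; apply/norP; split; last by apply: contraTneq un => ->; rewrite /= !inE eqxx ?orbT /= ?andbF.
    by apply/norP; split; apply: contraTneq un => ->; rewrite /= !inE eqxx ?orbT /= ?andbF.
  have nxw' : ~~ adj x w by case/and3P: rp => _ /and4P[_ _ /andP[] ].
  by have := far_ w wW' wD wx nxw'; rewrite adjacentC bw.
Qed.

End Light.

(** Off [x] and the component all vertices are pairwise adjacent, so a path from [x] to [y] has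
    length two unless its second vertex is [a] or [b]; then it runs through the component and
    [light_branch] applies. *)
Lemma light_special W a c b o x y0 : pclosed W -> a \in W -> b \in W -> c \in W ->
  share o c a -> share (~~ o) c b -> a != b -> ~~ adj a b ->
  (forall w, w \in W -> adj c w -> w = a \/ w = b) ->
  x \in W -> x \notin [set a; c; b] -> y0 \in W -> y0 \notin [set a; c; b] -> y0 != x -> ~~ adj x y0 ->
  (forall u v, u \in W -> v \in W -> u \notin [set a; c; b] -> v \notin [set a; c; b] ->
     u != x -> v != x -> u != v -> adj u v) ->
  exists y, [/\ y \in W, y \notin [set a; c; b] & even_pair T x y].
Proof.
move=> pW aW bW cW ca cb ab nab cN xW xD y0W y0D y0x nxy0 cl.
(* The vertex [y] is chosen, if possible, so that [x] and [y] are attached to different ends of the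
   component; if this fails for every candidate, the failure itself serves as the third alternative
   of [light_branch]. *)
pose C y := adj x a && adj y b || adj x b && adj y a.
have [y [yW yD yx nxy Cy]] : exists y, [/\ y \in W, y \notin [set a; c; b], y != x, ~~ adj x y &
   C y \/ forall w, w \in W -> w \notin [set a; c; b] -> w != x -> ~~ adj x w -> ~~ C w].
  have [/existsP[y /and5P[yW yD yx nxy Cy]]|] := boolP [exists y, [&& y \in W, y \notin [set a; c; b], y != x, ~~ adj x y & C y]].
    by exists y; split=> //; left.
  rewrite negb_exists => /forallP h; exists y0; split=> //; right=> w wW wD wx nxw.
  by move: (h w); rewrite wW wD wx nxw.
exists y; split=> //; apply: (line_even enP strong3 pW) => //; first by rewrite eq_sym.
move=> [|z s] // un rp sub ls.
have xz := rpath_next rp; have zW : z \in W by apply: sub; rewrite mem_head.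
have subs : {subset s <= W} by move=> w ws; apply: sub; rewrite inE ws orbT.
case: (boolP (z \in [set a; c; b])) => zD; last first.
  apply: (stop_even rp); rewrite [last z s]ls //; apply: cl => //.
    by apply: contraTneq un => ->; rewrite /= inE eqxx ?orbT /= ?andbF.
  by apply: contraNneq nxy => <-.
have sDE : [set b; c; a] = [set a; c; b].
  by apply/setP => w; rewrite !inE; case: (w == a); case: (w == b); case: (w == c).
have ls' : last z s = y by [].
move: zD; rewrite !inE -orbA => /or3P[]/eqP e; subst z.
- apply: (@light_branch W a c b o ca nab cN x y s) => //.
  case: Cy => [/orP[/andP[_ yb]|/andP[xb _]]|h]; [by constructor 2|by constructor 1|constructor 3].
  by move=> w wW wD wx nxw; have := h w wW wD wx nxw; rewrite /C xz /= negb_or => /andP[].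
- by case/negP: (light_off cN xW xD).
- have nba : ~~ adj b a by rewrite adjacentC.
  have cN' w : w \in W -> adj c w -> w = b \/ w = a by move=> wW /(cN _ wW)[]; auto.
  apply: (@light_branch W b c a (~~ o) cb nba cN' x y s); rewrite ?sDE //.
  case: Cy => [/orP[/andP[xa _]|/andP[_ ya]]|h]; [by constructor 1|by constructor 2|constructor 3].
  by move=> w wW wD wx nxw; have := h w wW wD wx nxw; rewrite /C xz /= negb_or => /andP[].
Qed.

Lemma light_pair W a c b o u v : pclosed W -> a \in W -> b \in W -> c \in W ->
  share o c a -> share (~~ o) c b -> a != b -> ~~ adj a b ->
  (forall w, w \in W -> adj c w -> w = a \/ w = b) ->
  u \in W -> v \in W -> u \notin [set a; c; b] -> v \notin [set a; c; b] -> u != v -> ~~ adj u v ->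
  exists x y, [/\ x \notin [set a; c; b], y \notin [set a; c; b] & even_pair T x y].
Proof.
move: {2}#|W| (leqnn #|W|) => n; elim: n W u v => [|n IH] W u v cW pW aW bW ccW ca cb ab nab cN uW vW uD vD ne nuv.
  by move: cW; rewrite leqn0 cards_eq0 => /eqP e0; rewrite e0 inE in uW.
set D := [set a; c; b] in uD vD *.
have [/existsP[x /and3P[xW xD sx]]|] := boolP [exists x, [&& x \in W, x \notin D & simplicial T W x]].
  have inW z : z \in D -> z \in W -> z \in W :\ x.
    by move=> zD zW; rewrite in_setD1 zW andbT; apply: contraNneq xD => <-.
  case: (nonclique_cases T (W :\ x) [pred z | z \notin D]) => [[s [t [sW tW sD tD [st nst]]]]|cl].
    have c' : #|W :\ x| <= n by move: cW; rewrite (cardsD1 x) xW add1n ltnS.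
    apply: (IH _ s t c' (strip pW sx)) => //; try by apply: inW; rewrite // !inE eqxx ?orbT.
    by move=> w; rewrite in_setD1 => /andP[_]; apply: cN.
  have cl' s t : s \in W -> t \in W -> s \notin D -> t \notin D -> s != x -> t != x -> s != t -> adj s t.
    by move=> sW tW sD tD sx' tx; apply: cl; rewrite ?in_setD1 ?sx' ?tx.
  have [y [yW yD yx nxy]] : exists y, [/\ y \in W, y \notin D, y != x & ~~ adj x y].
    case: (eqVneq u x) => [e|ux]; first by exists v; split=> //; rewrite -e // eq_sym.
    case: (eqVneq v x) => [e|vx]; first by exists u; split=> //; rewrite -e // adjacentC.
    by case/negP: nuv; apply: cl'.
  have [y' [_ y'D ev]] := light_special pW aW bW ccW ca cb ab nab cN xW xD yW yD yx nxy cl'.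
  by exists x, y'.
rewrite negb_exists => /forallP ns.
have {}ns x : x \in W -> x \notin D -> ~~ simplicial T W x.
  by move=> xW xD; move: (ns x); rewrite xW xD.
(* In the root graph [a], [c], [b] form a path from [p] to [q] whose inner nodes meet no other edge
   of [W]. *)
pose p : node := (~~ o, en (~~ o) a); pose q : node := (o, en o b).
have aD : a \in D by rewrite !inE eqxx.
have bD : b \in D by rewrite !inE eqxx !orbT.
have cD : c \in D by rewrite !inE eqxx !orbT.
have nD z i : z \in D -> inc i z -> i \in nodes D by move=> zD iz; apply/nodesP; exists z.
have two z i : inc i z -> i = (o, en o z) \/ i = (~~ o, en (~~ o) z).
  rewrite (inc_two i (k := (o, en o z)) (l := (~~ o, en (~~ o) z)) (v := z)) ?inc_node //=.
    by case/orP => /eqP; [left|right].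
  by case: (o).
have noc w i : w \in W -> w \notin D -> inc i w -> inc i c -> False.
  move=> wW wD iw ic; have wc : w != c by apply: contraNneq wD => ->.
  by case/negP: (light_off cN wW wD); apply: (inc_adj enP wc iw ic).
have int w k : w \in W -> w \notin D -> inc k w -> k \in nodes D -> k = p \/ k = q.
  move=> wW wD kw /nodesP[d dD kd].
  move: dD; rewrite !inE -orbA => /or3P[]/eqP e; subst d; last 2 first.
  - by case: (noc w k).
  - case: (two _ _ kd) => [|e]; first by right.
    by case: (noc w k wW wD kw); rewrite e /incident /=; case/andP: cb.
  - case: (two _ _ kd) => [e|]; last by left.
    by case: (noc w k wW wD kw); rewrite e /incident /=; case/andP: ca.
have [||||x [y [_ _ xD yD ev]]] := @outer_pair V I T en en_inj enP strong3 noPrism W D p q pW _ _ int _ ns.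
- by apply: (nD a) => //; exact: inc_node.
- by apply: (nD b) => //; exact: inc_node.
- have st z i j : z \in W -> z \in D -> i.1 != j.1 -> inc i z -> inc j z ->
      inside (hadj W) (~: (nodes W :\: nodes D)) i j.
    move=> zW zD ij iz jz; rewrite /inside !in_setC !in_setD (nD z i) // (nD z j) //=.
    exact: (hadj_inc zW ij iz jz).
  have oo : (o == ~~ o) = false by case: (o).
  have oo' : (~~ o == o) = false by case: (o).
  apply: (connect_trans (y := (o, en o c))).
    apply: connect1; apply: (st a) => //=; rewrite ?oo' //; first exact: inc_node.
    by rewrite /incident /= eq_sym; case/andP: ca.
  apply: (connect_trans (y := (~~ o, en (~~ o) c))).
    by apply: connect1; apply: (st c) => //=; rewrite ?oo //; exact: inc_node.
  apply: connect1; apply: (st b) => //=; rewrite ?oo' //; last exact: inc_node.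
  by rewrite /incident /= eq_sym; case/andP: cb.
- exact: (outer_nodes enP int uW vW).
by exists x, y.
Qed.

(** * A small component in a line trigraph *)

Section Small.
Variables (W : {set V}) (a b : V) (o : bool).
Hypotheses (pW : pclosed W) (aW : a \in W) (bW : b \in W).
Hypotheses (ab : share o a b) (aN : forall w, w \in W -> share o w a -> w = b).
Notation D := [set a; b].

Lemma small_aN w : w \in W -> w != b -> ~~ share o w a.
Proof. by move=> wW; apply: contraNN => /(aN wW) ->. Qed.

Lemma small_bN w : w \in W -> w != a -> ~~ share o w b.
Proof.
move=> wW wa; apply/negP => wb; have ba : share o b a by rewrite shC.
have := aN wW (sh_trans wb ba wa) => e.
by move: wb; rewrite e => /share_neq; rewrite eqxx.
Qed.

Lemma small_offa w : w \in W -> w \notin D -> adj w a -> share (~~ o) w a.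
Proof.
move=> wW; rewrite !inE negb_or => /andP[wa wb]; rewrite (adj_sh o).
by rewrite (negbTE (small_aN wW wb)).
Qed.

Lemma small_offb w : w \in W -> w \notin D -> adj w b -> share (~~ o) w b.
Proof.
move=> wW; rewrite !inE negb_or => /andP[wa wb]; rewrite (adj_sh o).
by rewrite (negbTE (small_bN wW wa)).
Qed.

Lemma small_notboth w : w \in W -> w \notin D -> adj w a -> ~~ adj w b.
Proof.
move=> wW wD wa; apply/negP => wb; have h1 := small_offa wW wD wa; have h2 := small_offb wW wD wb.
by case/negP: (sh_excl ab); rewrite shC in h1; apply: sh_trans h1 h2 (share_neq ab).
Qed.

Variables (x y : V).
Hypotheses (xW : x \in W) (yW : y \in W) (xD : x \notin D) (yD : y \notin D).
Hypotheses (yx : y != x) (nxy : ~~ adj x y) (nxa : ~~ adj x a) (nya : ~~ adj y a).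
Hypothesis cla : forall u v, u \in W -> v \in W -> u \notin D -> v \notin D -> u != x -> v != x ->
  ~~ adj u a -> ~~ adj v a -> u != v -> adj u v.
Hypothesis clb : forall u v, u \in W -> v \in W -> u \notin D -> v \notin D -> u != x -> v != x ->
  ~~ adj u b -> ~~ adj v b -> u != v -> adj u v.

(** No vertex off the pair sees both [a] and [b], so by [cla] and [clb] every vertex other than [x]
    and off the pair is adjacent to [y]. A path to [y] has length two, or is [x], [b], [a], [w],
    [y]. *)
Lemma small_special1 : ~~ adj y b -> even_pair T x y.
Proof.
move=> nyb.
have ady w : w \in W -> w \notin D -> w != x -> w != y -> adj w y.
  move=> wW wD wx wy; case: (boolP (adj w a)) => wa; last exact: cla.
  by apply: clb => //; apply: small_notboth.
apply: (line_even enP strong3 pW) => //; first by rewrite eq_sym.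
move=> [|z s] // un rp sub ls; have ls' : last z s = y by [].
have xz := rpath_next rp; have zW : z \in W by apply: sub; rewrite mem_head.
have zx : z != x by rewrite eq_sym (adjacent_neq xz).
have zy : z != y by apply: contraNneq nxy => <-.
case: (boolP (z \in D)) => zD; last first.
  by apply: (stop_even rp); rewrite ls' //; apply: ady.
have zb : z = b.
  by move: zD; rewrite !inE => /orP[]/eqP // e; case/negP: nxa; rewrite -e.
subst z; case: s un rp sub ls ls' => [|w s] un rp sub ls ls'.
  by move: zy; rewrite -ls' eqxx.
have [xw nxw] := rpath_skip rp; have rp1 := rpath_tl rp.
have wW : w \in W by apply: sub; rewrite !inE eqxx orbT.
have bw := turn (small_offb xW xD xz) (rpath_next rp1) nxw xw; rewrite negbK shC in bw.
have wa : w = a by apply/eqP; apply: contraTT bw; apply: small_bN.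
subst w; case: s un rp rp1 sub ls ls' => [|w s] un rp rp1 sub ls ls'.
  by move: yD; rewrite -ls' /= !inE eqxx.
have rp2 := rpath_tl rp1; have wW2 : w \in W by apply: sub; rewrite !inE eqxx !orbT.
have wx : w != x by apply: contraTneq un => ->; rewrite /= !inE eqxx ?orbT /= ?andbF.
have wD : w \notin D.
  by rewrite !inE; apply/norP; split; apply: contraTneq un => ->; rewrite /= !inE eqxx ?orbT /= ?andbF.
have wy : w != y by apply: contraNneq nya => <-; rewrite adjacentC; apply: rpath_next rp2.
have rp3 := rpath_tl rp2.
case: s un rp rp1 rp2 rp3 sub ls ls' => [|t s] un rp rp1 rp2 rp3 sub ls ls'.
  by move: wy; rewrite -ls' eqxx.
have -> : s = [::] by apply: (rpath_stop rp3); rewrite [last _ _]ls'; apply: ady.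
by [].
Qed.

Hypothesis yb : adj y b.

Lemma small_nxb : ~~ adj x b.
Proof.
apply/negP => xb; have h1 := small_offb xW xD xb; have h2 := small_offb yW yD yb.
case/negP: nxy; apply: (sh_adj (o := ~~ o)); rewrite shC in h2.
by apply: (sh_trans h1 h2); rewrite eq_sym.
Qed.

(** The second vertex [z] of a path from [x] to [g'] either is adjacent to [g'], which gives length
    two, or sees [b]. In the latter case there is a theta between the far ends [p] of [a] and [q] of
    [b]. *)
Lemma small_bad g g' : g \in W -> g' \in W -> g \notin D -> g' \notin D -> adj g a -> adj g' a ->
  adj x g -> adj g' y -> ~~ adj x g' -> ~~ adj g y -> even_pair T x g'.
Proof.
move=> gW g'W gD g'D ga g'a xg g'y nxg' ngy.
have nxb := small_nxb.
have xg'n : x != g' by apply: contraTneq g'y => <-.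
have sga := small_offa gW gD ga; have sg'a := small_offa g'W g'D g'a.
have syb := small_offb yW yD yb.
have xo w : w \in W -> w \notin D -> adj x w -> adj w a \/ adj w b -> share o x w.
  move=> wW wD xw h; move: xw; rewrite (adj_sh o) => /orP[//|sw]; case: h => h.
    case/negP: nxa; apply: (sh_adj (o := ~~ o)); apply: (sh_trans sw (small_offa wW wD h)).
    by apply: contraNneq xD => ->; rewrite !inE eqxx.
  case/negP: nxb; apply: (sh_adj (o := ~~ o)); apply: (sh_trans sw (small_offb wW wD h)).
  by apply: contraNneq xD => ->; rewrite !inE eqxx orbT.
have sxg := xo _ gW gD xg (or_introl ga).
have sg'y : share o g' y.
  move: g'y; rewrite (adj_sh o) => /orP[//|s1].
  case/negP: (small_notboth g'W g'D g'a); apply: (sh_adj (o := ~~ o)); apply: (sh_trans s1 syb).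
  by apply: contraNneq g'D => ->; rewrite !inE eqxx orbT.
apply: (line_even enP strong3 pW) => // -[|z s] // un rp sub ls.
have ls' : last z s = g' by [].
have xz := rpath_next rp; have zW : z \in W by apply: sub; rewrite mem_head.
have zx : z != x by rewrite eq_sym (adjacent_neq xz).
have zD : z \notin D.
  by rewrite !inE; apply/norP; split; apply: contraTneq xz => ->.
have zg' : z != g' by apply: contraNneq nxg' => <-.
case: (boolP (adj z b)) => zb; last first.
  apply: (stop_even rp); rewrite ls' //; apply: clb => //; first by rewrite eq_sym.
  exact: small_notboth.
have sxz := xo _ zW zD xz (or_intror zb); have szb := small_offb zW zD zb.
pose p : node := (~~ o, en (~~ o) a); pose q : node := (~~ o, en (~~ o) b).
have eo u v : share o u v -> en o u = en o v by case/andP => _ /eqP.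
have eno u v : share (~~ o) u v -> en (~~ o) u = en (~~ o) v by case/andP => _ /eqP.
exfalso.
have hp v1 v2 k : v1 \in W -> v2 \in W -> inc p v1 -> inc q v2 -> k.1 = o -> inc k v1 -> inc k v2 ->
    path (hadj W) p (rcons [:: k] q).
  move=> v1W v2W h1 h2 ko h3 h4; rewrite /= andbT.
  rewrite (@hadj_inc V I en W p k v1) ?(@hadj_inc V I en W k q v2) //= ko; by case: (o).
(* The three paths of the theta use the edge pairs [a], [b], then [g], [z], and [g'], [y]. *)
apply: (@no_theta V I T en enP noPrism W p q [:: (o, en o a)] [:: (o, en o g)] [:: (o, en o y)]) => //.
- apply: (hp a b) => //; rewrite /incident //=; by rewrite (eo _ _ ab).
- apply: (hp g z) => //; rewrite /incident //=; [by rewrite (eno _ _ sga) | by rewrite (eno _ _ szb)|].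
  by rewrite -(eo _ _ sxz) -(eo _ _ sxg).
- apply: (hp g' y) => //; rewrite /incident //=; [by rewrite (eno _ _ sg'a) | by rewrite (eno _ _ syb)|].
  by rewrite (eo _ _ sg'y).
have n1 : en (~~ o) a != en (~~ o) b.
  by have := sh_excl ab; rewrite /share_side (share_neq ab).
have n2 : en o a != en o g.
  move: gD; rewrite !inE negb_or => /andP[ga' gb].
  by have := small_aN gW gb; rewrite /share_side ga' eq_sym.
have n3 : en o a != en o y.
  move: yD; rewrite !inE negb_or => /andP[ya' yb'].
  by have := small_aN yW yb'; rewrite /share_side ya' eq_sym.
have n4 : en o g != en o y.
  apply: contraNneq ngy => e; apply: (sh_adj (o := o)); rewrite /share_side e eqxx andbT.
  by apply: contraTneq xg => ->.
have oo : (~~ o == o) = false by case: (o).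
by rewrite /= !inE !xpair_eqE !oo /= !eqxx /= (negbTE n1) (negbTE n2) (negbTE n3) (negbTE n4).
Qed.

(** If [small_bad] does not apply, a path from [x] to [y] whose second vertex [z] misses [y] has [z]
    adjacent to [a]. It continues as [x], [z], [a], [b], [y] or as [x], [z], [w], [t], [y] with [w]
    adjacent to [a] and [t] not; both have length four. *)
Lemma small_special2 : exists y', [/\ y' \in W, y' \notin D & even_pair T x y'].
Proof.
have nxb := small_nxb.
have [/existsP[g /existsP[g' /and5P[gW g'W gD g'D /and5P[ga g'a xg g'y /andP[n1 n2]]]]]|] :=
  boolP [exists g, exists g', [&& g \in W, g' \in W, g \notin D, g' \notin D &
     [&& adj g a, adj g' a, adj x g, adj g' y & ~~ adj x g' && ~~ adj g y]]].
  by exists g'; split=> //; apply: (small_bad gW g'W).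
rewrite negb_exists => /forallP nobad.
have {}nobad g g' : g \in W -> g' \in W -> g \notin D -> g' \notin D -> adj g a -> adj g' a ->
    adj x g -> adj g' y -> ~~ adj x g' -> adj g y.
  move=> gW g'W gD g'D ga g'a xg g'y n1; move: (nobad g); rewrite negb_exists => /forallP/(_ g').
  by rewrite gW g'W gD g'D ga g'a xg g'y n1 /= negbK.
exists y; split=> //.
apply: (line_even enP strong3 pW) => //; first by rewrite eq_sym.
move=> [|z s] // un rp sub ls; have ls' : last z s = y by [].
have xz := rpath_next rp; have zW : z \in W by apply: sub; rewrite mem_head.
have zx : z != x by rewrite eq_sym (adjacent_neq xz).
have zy : z != y by apply: contraNneq nxy => <-.
have zD : z \notin D.
  by rewrite !inE; apply/norP; split; apply: contraTneq xz => ->.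
case: (boolP (adj z y)) => nzy; first by apply: (stop_even rp); rewrite ls'.
have za : adj z a by apply: contraNT nzy => nza; apply: cla.
have nzb := small_notboth zW zD za.
have sza := small_offa zW zD za.
have sxz : share o x z.
  move: (xz); rewrite (adj_sh o) => /orP[//|s1].
  case/negP: nxa; apply: (sh_adj (o := ~~ o)); apply: (sh_trans s1 sza).
  by apply: contraNneq xD => ->; rewrite !inE eqxx.
case: s un rp sub ls ls' => [|w s] un rp sub ls ls'; first by move: zy; rewrite -ls' eqxx.
have [xw nxw] := rpath_skip rp; have rp1 := rpath_tl rp.
have wW : w \in W by apply: sub; rewrite !inE eqxx orbT.
have szw := turn sxz (rpath_next rp1) nxw xw.
case: (eqVneq w a) => [e|wa].
  subst w; case: s un rp rp1 sub ls ls' => [|w s] un rp rp1 sub ls ls'.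
    by move: yD; rewrite -ls' /= !inE eqxx.
  have [zw nzw] := rpath_skip rp1; have rp2 := rpath_tl rp1.
  have wW2 : w \in W by apply: sub; rewrite !inE eqxx !orbT.
  have := turn sza (rpath_next rp2) nzw zw; rewrite negbK shC => /(aN wW2) e.
  subst w; case: s un rp rp1 rp2 sub ls ls' => [|t s] un rp rp1 rp2 sub ls ls'.
    by move: yD; rewrite -ls' /= !inE eqxx orbT.
  have rp3 := rpath_tl rp2.
  have -> : s = [::] by apply: (rpath_stop rp3); rewrite [last _ _]ls' adjacentC.
  by [].
have swa : share (~~ o) w a by rewrite shC in szw; apply: sh_trans szw sza wa.
have adwa := sh_adj swa.
have wD : w \notin D.
  rewrite !inE negb_or wa; apply/negP => /eqP e.
  by case/negP: (sh_excl ab); rewrite shC -e.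
have wy : w != y by apply: contraNneq nya => <-.
case: s un rp rp1 sub ls ls' => [|t s] un rp rp1 sub ls ls'; first by move: wy; rewrite -ls' eqxx.
have rp2 := rpath_tl rp1; have [zt nzt] := rpath_skip rp1.
have tW : t \in W by apply: sub; rewrite !inE eqxx !orbT.
have nwy : ~~ adj w y.
  apply/negP => awy; case/negP: nzy; exact: (nobad z w).
have swt := turn szw (rpath_next rp2) nzt zt; rewrite negbK in swt.
have ty : t != y by apply: contraNneq nwy => <-; apply: sh_adj swt.
have tx : t != x by apply: contraTneq un => ->; rewrite /= !inE eqxx ?orbT /= ?andbF.
have tD : t \notin D.
  rewrite !inE; apply/norP; split; first by apply: contraNneq nzt => ->.
  by apply/negP => /eqP e; case/negP: (small_bN wW wa); rewrite -e.
have nxt : ~~ adj x t by case/and3P: rp => _ /and3P[_ /andP[] ].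
have nta : ~~ adj t a.
  apply/negP => ta; have sta := small_offa tW tD ta; rewrite shC in sta.
  by case/negP: (sh_excl swt); apply: (sh_trans swa sta); apply: share_neq swt.
case: s un rp rp1 rp2 sub ls ls' => [|t' s] un rp rp1 rp2 sub ls ls'; first by move: ty; rewrite -ls' eqxx.
have aty : adj t y by apply: cla.
have rp3 := rpath_tl rp2.
have -> : s = [::] by apply: (rpath_stop rp3); rewrite [last _ _]ls'.
by [].
Qed.

End Small.

Lemma small_special W a b o x y : pclosed W -> a \in W -> b \in W -> share o a b ->
  (forall w, w \in W -> share o w a -> w = b) -> x \in W -> y \in W ->
  x \notin [set a; b] -> y \notin [set a; b] -> y != x -> ~~ adj x y -> ~~ adj x a -> ~~ adj y a ->
  (forall u v, u \in W -> v \in W -> u \notin [set a; b] -> v \notin [set a; b] -> u != x -> v != x ->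
    ~~ adj u a -> ~~ adj v a -> u != v -> adj u v) ->
  (forall u v, u \in W -> v \in W -> u \notin [set a; b] -> v \notin [set a; b] -> u != x -> v != x ->
    ~~ adj u b -> ~~ adj v b -> u != v -> adj u v) ->
  exists y', [/\ y' \in W, y' \notin [set a; b] & even_pair T x y'].
Proof.
move=> pW aW bW ab aN xW yW xD yD yx nxy nxa nya cla clb.
case: (boolP (adj y b)) => yb.
  exact: (small_special2 pW aW bW ab aN xW yW xD yD yx nxy nxa nya cla clb yb).
by exists y; split=> //; apply: (small_special1 pW ab aN xW yW).
Qed.

(** The last condition on [u], [v] is carried through the induction: when no such pair survives the
    removal of a simplicial vertex, the vertices missing [a], and likewise those missing [b], form
    cliques, as [small_special] requires. *)
Lemma small_pair W a b o u v : pclosed W -> a \in W -> b \in W -> share o a b ->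
  (forall w, w \in W -> share o w a -> w = b) ->
  u \in W -> v \in W -> u \notin [set a; b] -> v \notin [set a; b] -> u != v -> ~~ adj u v ->
  ~~ adj u a && ~~ adj v a || ~~ adj u b && ~~ adj v b ->
  exists x y, [/\ x \notin [set a; b], y \notin [set a; b] & even_pair T x y].
Proof.
move: {2}#|W| (leqnn #|W|) => n; elim: n W a b u v => [|n IH] W a b u v cW pW aW bW ab aN uW vW uD vD ne nuv off.
  by move: cW; rewrite leqn0 cards_eq0 => /eqP e0; rewrite e0 inE in uW.
wlog off_a : a b aW bW ab aN uD vD off / ~~ adj u a && ~~ adj v a.
  move=> wl; case/orP: (off) => offa; first exact: (wl a b).
  have bN w : w \in W -> share o w b -> w = a.
    by move=> wW wb; apply/eqP; apply: contraTT wb; apply: (small_bN ab aN).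
  have DC : [set a; b] = [set b; a] by rewrite setUC.
  by rewrite DC; apply: wl => //; rewrite -?DC // 1?shC // orbC.
set D := [set a; b] in uD vD *.
have [/existsP[x /and3P[xW xD sx]]|] := boolP [exists x, [&& x \in W, x \notin D & simplicial T W x]].
  have inW z : z \in D -> z \in W -> z \in W :\ x.
    by move=> zD zW; rewrite in_setD1 zW andbT; apply: contraNneq xD => <-.
  have step s t d : s \in W :\ x -> t \in W :\ x -> d \in D -> s \notin D -> t \notin D -> s != t -> ~~ adj s t ->
      ~~ adj s d -> ~~ adj t d -> exists x y, [/\ x \notin D, y \notin D & even_pair T x y].
    move=> sW tW dD sD tD st nst nsd ntd.
    have c' : #|W :\ x| <= n by move: cW; rewrite (cardsD1 x) xW add1n ltnS.
    apply: (IH _ a b s t c' (strip pW sx)) => //; try by apply: inW; rewrite // !inE eqxx ?orbT.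
      by move=> w; rewrite in_setD1 => /andP[_]; apply: aN.
    by move: dD nsd ntd; rewrite !inE => /orP[]/eqP-> -> ->; rewrite ?orbT.
  case: (nonclique_cases T (W :\ x) [pred z | (z \notin D) && ~~ adj z a]) => [[s [t [sW tW /andP[sD sa] /andP[tD ta] [st nst]]]]|cla].
    by apply: (step s t a) => //; rewrite !inE eqxx.
  case: (nonclique_cases T (W :\ x) [pred z | (z \notin D) && ~~ adj z b]) => [[s [t [sW tW /andP[sD sa] /andP[tD ta] [st nst]]]]|clb].
    by apply: (step s t b) => //; rewrite !inE eqxx orbT.
  have cla' s t : s \in W -> t \in W -> s \notin D -> t \notin D -> s != x -> t != x ->
      ~~ adj s a -> ~~ adj t a -> s != t -> adj s t.
    by move=> sW tW sD tD sx' tx sa ta; apply: cla; rewrite ?in_setD1 ?sx' ?tx //= ?sD ?tD.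
  have clb' s t : s \in W -> t \in W -> s \notin D -> t \notin D -> s != x -> t != x ->
      ~~ adj s b -> ~~ adj t b -> s != t -> adj s t.
    by move=> sW tW sD tD sx' tx sa ta; apply: clb; rewrite ?in_setD1 ?sx' ?tx //= ?sD ?tD.
  case/andP: off_a => ua va.
  have [y [yW yD yx nxy [nxa nya]]] : exists y, [/\ y \in W, y \notin D, y != x, ~~ adj x y & ~~ adj x a /\ ~~ adj y a].
    case: (eqVneq u x) => [e|ux]; first by exists v; split=> //; rewrite -e // eq_sym.
    case: (eqVneq v x) => [e|vx]; first by exists u; split=> //; rewrite -e // adjacentC.
    by case/negP: nuv; apply: cla'.
  have [y' [_ y'D ev]] := small_special pW aW bW ab aN xW yW xD yD yx nxy nxa nya cla' clb'.
  by exists x, y'.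
rewrite negb_exists => /forallP ns.
have {}ns x : x \in W -> x \notin D -> ~~ simplicial T W x.
  by move=> xW xD; move: (ns x); rewrite xW xD.
(* In the root graph [a] and [b] form a path from [p] to [q] whose middle node meets no other edge
   of [W]. *)
pose p : node := (~~ o, en (~~ o) a); pose q : node := (~~ o, en (~~ o) b).
have aD : a \in D by rewrite !inE eqxx.
have bD : b \in D by rewrite !inE eqxx !orbT.
have nD z i : z \in D -> inc i z -> i \in nodes D by move=> zD iz; apply/nodesP; exists z.
have two z i : inc i z -> i = (o, en o z) \/ i = (~~ o, en (~~ o) z).
  rewrite (inc_two i (k := (o, en o z)) (l := (~~ o, en (~~ o) z)) (v := z)) ?inc_node //=.
    by case/orP => /eqP; [left|right].
  by case: (o).
have eab : en o a = en o b by case/andP: ab => _ /eqP.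
have noq w : w \in W -> w \notin D -> inc (o, en o a) w -> False.
  rewrite !inE negb_or => wW /andP[wa wb] iw.
  by case/negP: (small_aN aN wW wb); rewrite /share_side wa; exact: iw.
have int w k : w \in W -> w \notin D -> inc k w -> k \in nodes D -> k = p \/ k = q.
  move=> wW wD kw /nodesP[d dD kd].
  move: dD; rewrite !inE => /orP[]/eqP e; subst d; case: (two _ _ kd) => e; try by [left|right].
    by case: (noq w wW wD); rewrite -e.
  by case: (noq w wW wD); rewrite eab -e.
have [||||x [y [_ _ xD yD ev]]] := @outer_pair V I T en en_inj enP strong3 noPrism W D p q pW _ _ int _ ns.
- by apply: (nD a) => //; exact: inc_node.
- by apply: (nD b) => //; exact: inc_node.
- have st z i j : z \in W -> z \in D -> i.1 != j.1 -> inc i z -> inc j z ->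
      inside (hadj W) (~: (nodes W :\: nodes D)) i j.
    move=> zW zD ij iz jz; rewrite /inside !in_setC !in_setD (nD z i) // (nD z j) //=.
    exact: (hadj_inc zW ij iz jz).
  have oo : (o == ~~ o) = false by case: (o).
  have oo' : (~~ o == o) = false by case: (o).
  apply: (connect_trans (y := (o, en o a))).
    by apply: connect1; apply: (st a) => //=; rewrite ?oo' //; exact: inc_node.
  apply: connect1; apply: (st b) => //=; rewrite ?oo //; last exact: inc_node.
  by rewrite /incident /= eab.
- exact: (outer_nodes enP int uW vW).
by exists x, y.
Qed.

End LineSwitchable.

(** The coordinates are moved to a finite type because [chain_exists] is an induction on the size of
    a set of nodes; [M] bounds both coordinates of every vertex. *)
Lemma line_coordinates (V : finType) (T : trigraph V) : full_real_line_of_bipartite T ->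
  exists (I : finType) (en : bool -> V -> I),
    (forall u v, en false u = en false v -> en true u = en true v -> u = v) /\
    (forall u v, u != v -> adjacent T u v = (en false u == en false v) || (en true u == en true v)).
Proof.
case=> f [f_inj fP].
pose M := \max_(v : V) maxn (f v).1 (f v).2.
have bound v : (f v).1 <= M /\ (f v).2 <= M.
  have h : maxn (f v).1 (f v).2 <= M := leq_bigmax v.
  by split; apply: leq_trans h; rewrite ?leq_maxl ?leq_maxr.
exists 'I_M.+1, (fun o v => inord (if o then (f v).2 else (f v).1)).
have inordE i j : i <= M -> j <= M -> ((inord i : 'I_M.+1) == inord j) = (i == j).
  by move=> iM jM; rewrite -val_eqE /= !inordK.
split=> u v; have [u1 u2] := bound u; have [v1 v2] := bound v.
  move=> /eqP; rewrite inordE // => /eqP e1 /eqP; rewrite inordE // => /eqP e2.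
  by apply: f_inj; move: e1 e2; case: (f u) => ? ?; case: (f v) => ? ? /= -> ->.
move=> ne; rewrite !inordE //; apply/idP/orP => [/(fP _ _ ne)|h].
  by case=> ->; [left|right].
by apply/(fP _ _ ne); case: h => /eqP; [left|right].
Qed.

Section LinePairs.
Variables (V : finType) (T : trigraph V).

Lemma not_clique (X : {set V}) : ~ clique T X ->
  exists u v, [/\ u \in X, v \in X, u != v & ~~ adjacent T u v].
Proof.
case: (nonclique_cases T X predT) => [[u [v [uX vX _ _ [ne nuv]]]] _|h nc]; first by exists u, v.
by case: nc => u v uX vX ne; apply: h.
Qed.

Lemma line_pairs : line_trigraph T -> Dspec T -> (forall p1 p2 p3, ~ is_odd_prism T p1 p2 p3) ->
  (complete T \/ has_even_pair T) /\ (favorable T -> has_free_even_pair T).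
Proof.
case=> /line_coordinates[I [en [en_inj enP]]] strong3 ds noPrism.
have one : complete T \/ has_even_pair T.
  case: (complete_or T) => [|[u [v]]]; [by left|rewrite strongly_antiE => /andP[ne nuv]; right].
  have [x [y [_ _ ev]]] := line_pair en_inj enP strong3 noPrism (pclosedT (T := T)) (in_setT u) (in_setT v) ne nuv.
  by exists x, y.
split=> // fav.
case: ds => [D0 _|x y sxy DE Nxy sw|c x y xy cx cy DE cN sa _].
- by apply: Dset0_free => //; case: one => // /(favorable_not_complete fav).
- have [o oxy] : exists o, share_side en o x y by apply: (adj_share enP); rewrite adjacentW sxy orbT.
  (* A third edge at the common end of [x] and [y] would complete a triangle, and triangles contain
     no switchable pair. *)
  have aN w : w \in [set: V] -> share_side en o w x -> w = y.
    move=> _ wx; apply/eqP/negPn/negP => wy.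
    have wy' := share_trans wx oxy wy.
    move: sxy; rewrite semiadjE antiadjacentE (triangle_strong strong3 (z := w)) ?andbF //.
    + exact: (share_adj enP oxy).
    + by rewrite adjacentC (share_adj enP wx).
    + by rewrite adjacentC (share_adj enP wy').
  have fin u v d : d \in [set x; y] -> u \in ~: (Dset T :|: N T d) -> v \in ~: (Dset T :|: N T d) -> u != v ->
      ~~ adjacent T u v -> has_free_even_pair T.
    move=> dD; rewrite !in_setC !in_setU DE ![_ \in N T _]inE !negb_or => /andP[uD ud] /andP[vD vd] ne nuv.
    have [|x' [y' [x'D y'D ev]]] := small_pair en_inj enP strong3 noPrism (pclosedT (T := T)) (in_setT x) (in_setT y) oxy aN
      (in_setT u) (in_setT v) uD vD ne nuv.
      move: dD ud vd; rewrite !inE ![adjacent T d _]adjacentC => /orP[]/eqP-> -> ->; by rewrite ?orbT.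
    by exists x', y'; rewrite DE.
  case: fav => _ _ /(_ x y sw sxy)[]/not_clique[u [v [uX vX ne nuv]]].
    by apply: (fin u v x) => //; rewrite set21.
  by apply: (fin u v y) => //; rewrite set22.
- case: fav => _ [u [v [uv uD vD]]] _.
  move: uv sa; rewrite !strongly_antiE => /andP[ne nuv] /andP[_ nxy].
  have [acx acy] : adjacent T c x /\ adjacent T c y by rewrite !adjacentW cx cy !orbT.
  have [o ocx] := adj_share enP acx.
  have ocy : share_side en (~~ o) c y.
    move: acy; rewrite (adjacent_share enP o) => /orP[h|//]; case/negP: nxy.
    by apply: (share_adj enP (o := o)); apply: (share_trans _ h xy); rewrite shareC.
  have cN' w : w \in [set: V] -> adjacent T c w -> w = x \/ w = y.
    move=> _ cw; case: (boolP (w \in [set c; x; y])) => [|/cN].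
      rewrite !inE -orbA => /or3P[]/eqP; [|by left|by right].
      by move=> e; move: cw; rewrite e => /adjacent_neq; rewrite eqxx.
    by rewrite strongly_antiE cw andbF.
  have sE : [set c; x; y] = [set x; c; y] by rewrite [[set c; x]]setUC.
  rewrite DE sE in uD vD.
  have [x' [y' [x'D y'D ev]]] := light_pair en_inj enP strong3 noPrism (pclosedT (T := T)) (in_setT x) (in_setT y) (in_setT c)
     ocx ocy xy nxy cN' (in_setT u) (in_setT v) uD vD ne nuv.
  by exists x', y'; rewrite DE sE.
Qed.

End LinePairs.

Lemma perm_swap13 (U : eqType) (x y z : U) p : perm_eq [:: z, y, x & p] [:: x, y, z & p].
Proof. by apply/permP => Q /=; lia. Qed.

(** * Longest paths in bipartite graphs without cycles of length at least six *)

Section LongestPath.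
Variables (U : finType) (e : rel U) (sd : U -> bool).
Hypotheses (eC : symmetric e) (e_sd : forall x y, e x y -> sd x != sd y).
Hypothesis noCycle : forall cs, uniq cs -> cycle e cs -> 6 <= size cs -> False.

(** Maximality puts the neighbour [w] of the first vertex on the path, at an odd distance along it.
    Distance five or more would close a cycle of length at least six, so the distance is one or
    three. *)
Lemma longest_nbr x y z p w : uniq (x :: y :: z :: p) -> path e x (y :: z :: p) ->
  (forall x' p', uniq (x' :: p') -> path e x' p' -> size p' <= (size p).+2) ->
  e x w -> w = y \/ ohead p = Some w.
Proof.
move=> un pa mx xw; case: (boolP (w \in x :: y :: z :: p)) => [|wn]; last first.
  have := mx w (x :: y :: z :: p); rewrite cons_uniq wn un /= eC xw => h.
  by have := h isT pa; rewrite ltnn.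
case/and3P: (pa) => /e_sd xy /e_sd yz zp.
have swx := e_sd xw.
rewrite !inE => /or4P[/eqP e1|/eqP->|/eqP e1|wp]; [|by left| |].
- by rewrite e1 eqxx in swx.
- by move: xy yz swx; rewrite e1; case: (sd x); case: (sd y); case: (sd z).
have [l1 [l2 e1]] : exists l1 l2, p = l1 ++ w :: l2 by case/splitPr: wp => l1 l2; exists l1, l2.
case: l1 e1 => [|k1 l1] e1; first by right; rewrite e1.
case: l1 e1 => [|k2 l1] e1.
  move: zp; rewrite e1 /= => /and3P[/e_sd h1 /e_sd h2 _].
  by move: xy yz swx h1 h2; case: (sd x); case: (sd y); case: (sd z); case: (sd k1); case: (sd w).
exfalso; set L := [:: y, z, k1, k2 & rcons l1 w].
have eL : [:: y, z & p] = L ++ l2 by rewrite e1 /L /= cat_rcons.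
rewrite eL in un pa; move: pa; rewrite cat_path => /andP[pL _].
apply: (@noCycle (x :: L)); last by rewrite /= size_rcons.
  by move: un; rewrite -cat_cons cat_uniq => /and3P[].
by rewrite /cycle rcons_path pL /= last_rcons eC.
Qed.

(** The first two edges [x y] and [y z] of a longest path serve: a neighbour of [x] other than [y]
    is the fourth vertex, and after a rotation so is a neighbour of [z] other than [y]. The given
    cherry ensures that a longest path has at least two edges. *)
Lemma bounded_cherry m0 s0 t0 : s0 != t0 -> e m0 s0 -> e m0 t0 ->
  exists m s t, [/\ s != t, e m s, e m t &
    forall a b, a != m -> b != m -> a != b -> e t a -> e s b -> False].
Proof.
move=> st0 ms0 mt0.
pose P n := [exists x : U, exists p : n.-tuple U, uniq (x :: p) && path e x p].
have PI x p : uniq (x :: p) -> path e x p -> P (size p).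
  by move=> un pa; apply/existsP; exists x; apply/existsP; exists (in_tuple p); rewrite /= in un *; rewrite un pa.
have P2 : P 2.
  apply: (@PI s0 [:: m0; t0]); last by rewrite /= eC ms0 mt0.
  have nm u v : e u v -> u != v by move=> /e_sd; apply: contraNneq => ->.
  by rewrite /= !inE negb_or [s0 == m0]eq_sym (nm _ _ ms0) st0 (nm _ _ mt0).
have bP n : P n -> n <= #|U|.
  case/existsP => x /existsP[p /andP[un _]].
  have h := card_uniqP un; rewrite /= size_tuple in h.
  by apply: ltnW; rewrite -h max_card.
have [n Pn mx] := ex_maxnP (ex_intro _ 2 P2) bP.
have n2 := mx _ P2.
case/existsP: Pn => x /existsP[[p /= /eqP sp] /andP[un pa]].
case: p sp un pa => [|y [|z p]] /= sp un pa; try by move: n2; rewrite -sp.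
have mx' x' p' : uniq (x' :: p') -> path e x' p' -> size p' <= (size p).+2.
  by move=> h1 h2; rewrite sp; apply: mx; apply: PI h1 h2.
have nb := @longest_nbr x y z p _ un pa mx'.
case/and3P: (pa) => xy yz zp.
exists y, x, z; split=> //; first by case/andP: un; rewrite !inE !negb_or => /and3P[].
  by rewrite eC.
move=> a b ay byy ab za xb; case: (nb b xb) => [e1|]; first by rewrite e1 eqxx in byy.
case: p sp un pa mx' zp {nb} => //= k p sp un pa mx' zp [e1]; subst k.
(* The rotation: with [x] adjacent to the fourth vertex [b], reversing the first three vertices
   gives another longest path, starting at [z]. *)
have un' : uniq [:: z, y, x, b & p] by rewrite (perm_uniq (perm_swap13 _ _ _ _)).
have pa' : path e z [:: y, x, b & p].
  by move: zp => /= /andP[_ zp]; rewrite /= eC yz eC xy xb zp.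
have [e1|[e1]] := longest_nbr un' pa' mx' za; first by rewrite e1 eqxx in ay.
by rewrite e1 eqxx in ab.
Qed.

End LongestPath.

(** * Complements of line trigraphs *)

Lemma ipath_uniq (V : eqType) (a n : rel V) s : (forall u v, a u v -> u != v) ->
  (forall u v, n u v -> u != v) -> ipath a n s -> uniq s.
Proof.
move=> ha hn; elim: s => // x [|y t] IH // /and3P[xy xt /IH un].
rewrite cons_uniq un andbT inE negb_or ha //=.
by apply/negP => xin; have := hn _ _ (allP xt _ xin); rewrite eqxx.
Qed.

Section CycleHole.
Variables (V I : finType) (S : trigraph V) (en : bool -> V -> I).
Hypothesis enP : forall u v, u != v ->
  adjacent S u v = (en false u == en false v) || (en true u == en true v).
Variable W : {set V}.
Notation node := (bool * I)%type.
Notation hadj := (root_adj en W).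
Notation adj := (adjacent S).
Notation inc := (incident en).
Implicit Types (k l m : node).

Lemma eg_inc v0 k l m : hadj k l -> inc m (eg en W v0 k l) = (m == k) || (m == l).
Proof. by move=> h; have [_ h1 h2] := egP v0 h; apply: inc_two (hadj_side h) h1 h2. Qed.

Lemma eg_adj v0 k l m : hadj k l -> hadj l m -> k != m -> adj (eg en W v0 k l) (eg en W v0 l m).
Proof.
move=> kl lm km; have lk : k != l by apply: contraTneq kl => ->; rewrite /root_adj eqxx.
rewrite (adj_inc enP); first by apply/existsP; exists l; rewrite !eg_inc // !eqxx orbT.
apply/eqP => /(congr1 (inc k)); rewrite !eg_inc // eqxx /=.
by rewrite (negbTE lk) (negbTE km).
Qed.

Lemma eg_nonadj v0 k l k' l' : hadj k l -> hadj k' l' -> k != k' -> k != l' -> l != k' -> l != l' ->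
  nonrel adj (eg en W v0 k l) (eg en W v0 k' l').
Proof.
move=> kl kl' h1 h2 h3 h4; have ne : eg en W v0 k l != eg en W v0 k' l'.
  by apply/eqP => /(congr1 (inc k)); rewrite !eg_inc // eqxx (negbTE h1) (negbTE h2).
rewrite /nonrel ne (adj_inc enP ne); apply/negP => /existsP[m]; rewrite !eg_inc //.
by case/andP => /orP[]/eqP->; rewrite ?(negbTE h1) ?(negbTE h2) ?(negbTE h3) ?(negbTE h4).
Qed.

Lemma mem_pairmap_eg v0 k s x : path hadj k s -> x \in pairmap (eg en W v0) k s ->
  exists a b, [/\ x = eg en W v0 a b, a \in k :: s, b \in s & hadj a b].
Proof.
elim: s k => //= l s IH k /andP[kl ps]; rewrite inE => /orP[/eqP->|/(IH _ ps)[a [b [-> aS bS ab]]]].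
  by exists k, l; rewrite !inE !eqxx.
by exists a, b; rewrite !inE in aS *; rewrite aS bS !orbT.
Qed.

Lemma ipath_edges v0 k s : uniq (k :: s) -> path hadj k s ->
  ipath adj (nonrel adj) (pairmap (eg en W v0) k s).
Proof.
elim: s k => // l [|m s] IH k un pa //.
case/and3P: (pa) => kl lm pm.
have un' : uniq (l :: m :: s) by case/andP: un.
apply/and3P; split; last by apply: IH un' _; case/andP: pa.
  by apply: eg_adj => //; apply: contraTneq un => ->; rewrite /= !inE eqxx orbT.
apply/allP => x /(mem_pairmap_eg pm)[a [b [-> aS bS ab]]].
have neq z : z \in m :: s -> k != z /\ l != z.
  move=> zS; case/and3P: un => k1 l1 _; split.
    by apply: contraNneq k1 => ->; rewrite inE zS orbT.
  by apply: contraNneq l1 => ->.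
have bS' : b \in m :: s by rewrite inE bS orbT.
have [ka la] := neq _ aS; have [kb lb] := neq _ bS'.
exact: eg_nonadj.
Qed.

(** The edges of the cycle in cyclic order form the hole, closed by the edge [y] from the last node
    to the first. Chords do no harm: they are other vertices of [S]. *)
Lemma cycle_hole cs : uniq cs -> cycle hadj cs -> 6 <= size cs -> exists s, is_hole S s.
Proof.
case: cs => // k cs; case/lastP: cs => // cs kl; case: cs => // k1 cs un cc sz.
rewrite /= size_rcons /= in sz.
move: (cc); rewrite /cycle rcons_path last_rcons => /andP[pa kkl].
have [v0 _] : exists v0 : V, True by case/andP: kkl => _ /existsP[v]; exists v.
have pE : pairmap (eg en W v0) k (rcons (k1 :: cs) kl) =
    eg en W v0 k k1 :: rcons (pairmap (eg en W v0) k1 cs) (eg en W v0 (last k1 cs) kl).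
  by rewrite /= -!cats1 pairmap_cat.
have ip := ipath_edges v0 un pa; rewrite pE in ip.
have uE : uniq (eg en W v0 k k1 :: rcons (pairmap (eg en W v0) k1 cs) (eg en W v0 (last k1 cs) kl)).
  by apply: ipath_uniq ip => [u v /adjacent_neq|u v /andP[]].
have /and3P[kk1 pcs lkl] : [&& hadj k k1, path hadj k1 cs & hadj (last k1 cs) kl].
  by move: pa; rewrite /= rcons_path.
have mem z : z \in k1 :: cs -> k != z /\ kl != z.
  move=> zS; move: un; rewrite cons_uniq rcons_uniq mem_rcons inE negb_or => /and3P[/andP[_ h1] h2 _].
  by split; [apply: contraNneq h1 => -> | apply: contraNneq h2 => ->].
have [nk1 nkl1] := mem _ (mem_head _ _); have [nkl nkll] := mem _ (mem_last k1 cs).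
pose x := eg en W v0 k k1; pose l := eg en W v0 (last k1 cs) kl; pose q := pairmap (eg en W v0) k1 cs.
rewrite -/x -/l -/q in ip uE.
pose y := eg en W v0 kl k.
have yx : adj y x by apply: eg_adj => //; rewrite eq_sym.
have yl : adj y l by rewrite adjacentC; apply: eg_adj => //; rewrite eq_sym.
have yq : all (nonrel adj y) q.
  apply/allP => z /(mem_pairmap_eg pcs)[a [b [-> aS bS ab]]].
  have bS' : b \in k1 :: cs by rewrite inE bS orbT.
  have [n1 n2] := mem _ aS; have [n3 n4] := mem _ bS'.
  exact: eg_nonadj.
have sub : subrel (nonrel adj) (antiadjacent S).
  by move=> u v /andP[ne nuv]; apply: strongly_antiW; rewrite strongly_antiE ne.
exists (y :: x :: rcons q l); apply: mk_hole => //.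
- by apply: sub_ipath ip.
- by apply: sub_all yq => z; apply: sub.
- rewrite cons_uniq uE andbT inE mem_rcons inE !negb_or (adjacent_neq yx) (adjacent_neq yl) /=.
  by apply/negP => /(allP yq); rewrite /nonrel eqxx.
by rewrite size_pairmap; move: sz; clear; lia.
Qed.

End CycleHole.

Section CoLine.
Variables (V I : finType) (T : trigraph V) (en : bool -> V -> I).
Notation S := (compl T).
Hypothesis en_inj : forall u v, en false u = en false v -> en true u = en true v -> u = v.
Hypothesis enP : forall u v, u != v ->
  adjacent S u v = (en false u == en false v) || (en true u == en true v).
Hypothesis strong3 : forall X : {set V}, clique S X -> 3 <= #|X| -> strong_clique S X.
Implicit Types (u v w x y z g h : V).
Notation share := (share_side en).
Notation anti := (antiadjacent T).

Lemma anti_share o u v : anti u v = share o u v || share (~~ o) u v.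
Proof. by rewrite -adjacent_compl (adjacent_share enP o). Qed.

Lemma share_anti o u v : share o u v -> anti u v.
Proof. by rewrite (anti_share o) => ->. Qed.

Lemma anti_triangle x y z : anti x y -> anti x z -> anti y z -> ~~ adjacent T x y.
Proof.
rewrite -!adjacent_compl => xy xz yz; have := triangle_strong strong3 xy xz yz.
by rewrite strongly_adj_compl strongly_antiE => /andP[].
Qed.

Lemma anti_triangle_share o x y z : share o x y -> anti x z -> anti y z -> share o x z.
Proof.
move=> xy; rewrite (anti_share o) => /orP[//|xz]; rewrite (anti_share o) => /orP[yz|yz].
  by apply: share_trans xy yz _; case/andP: xz.
case/negP: (share_excl en_inj xy); apply: (share_trans xz); first by rewrite shareC.
by case/andP: xy.
Qed.

(* The complement of a path with at least six vertices contains a diamond. *)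
Lemma co_line_even u v : strongly_anti T u v ->
  (forall a b, adjacent T u a -> adjacent T a b -> adjacent T b v ->
     anti u b -> anti a v -> False) -> even_pair T u v.
Proof.
move=> uv no4; apply: even_pairP => // s _ _.
case: s => [|a [|b [|c [|d s]]]] //= p lv; rewrite ?lv //.
- by case/andP: p => h _; move: uv; rewrite -lv strongly_antiE h andbF.
- by case/and3P: p => ua /and3P[ub _ _] /and3P[ab /andP[ac _] /andP[bc _]]; subst c; case: (no4 a b).
case/and3P: p => ua /and4P[ub uc ud us] /and3P[ab /and3P[ac ad as_] p].
(* Length four is even; beyond it there are at least six vertices, and [u], [a] are both
   antiadjacent to the antiadjacent pair [c], [e]. *)
case: s us as_ p lv => [|e s] us as_ p lv //.
have ce : anti c e.
  by case/and3P: p => _ _ /and3P[_ /andP[]].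
case/andP: us => ue _; case/andP: as_ => ae _.
have [o oce] : exists o, share o c e by apply: (adj_share enP); rewrite adjacent_compl.
have uc' : share o c u by apply: (anti_triangle_share oce); rewrite antiadjacentC.
have ac' : share o c a by apply: (anti_triangle_share oce); rewrite antiadjacentC.
have una := adjacent_neq ua.
have ua' : share o u a by rewrite shareC in uc'; apply: share_trans uc' ac' una.
by move: (anti_triangle (share_anti ua') uc ac); rewrite ua.
Qed.

(** The vertices [u], [v] are the edges [m s] and [m t] of a bounded cherry. A path [u], [a], [b],
    [v] would give disjoint edges [a] at [t] and [b] at [s] that avoid [m], which [bounded_cherry]
    excludes. *)
Lemma co_line_pair0 : (forall s, ~ is_antihole T s) -> (forall u v, ~~ semiadj T u v) ->
  ~ complete T -> has_even_pair T.
Proof.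
move=> noAH ns nc; have [u0 [v0 uv0]] := not_complete_anti nc.
have anN u v : u != v -> adjacent T u v = ~~ anti u v.
  move=> ne; rewrite adjacentE ne antiadjacentW (negbTE (ns _ _)) orbF //.
have sA u v : anti u v -> strongly_anti T u v.
  by rewrite antiadjacentW (negbTE (ns _ _)) orbF.
have [o oc] : exists o, share o u0 v0.
  by apply: (adj_share enP); rewrite adjacent_compl strongly_antiW.
pose H := root_adj en [set: V].
have noC cs : uniq cs -> cycle H cs -> 6 <= size cs -> False.
  by move=> h1 h2 h3; have [s hs] := cycle_hole enP h1 h2 h3; apply: (noAH s).
have hE k l v : k.1 != l.1 -> incident en k v -> incident en l v -> H k l.
  by move=> ne h1 h2; apply: hadj_inc ne h1 h2; rewrite inE.
have flip i j : (o, i : I).1 != (~~ o, j : I).1 by case: (o).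
have [|||m [s [t [st ms mt bnd]]]] := @bounded_cherry _ H fst (@hadjC V I en setT) (@hadj_side V I en setT) noC
   (o, en o u0) (~~ o, en (~~ o) u0) (~~ o, en (~~ o) v0).
- apply: contraNneq (share_excl en_inj oc) => -[e]; rewrite /share_side e eqxx andbT; by case/andP: oc.
- by apply: (hE _ _ u0) => //; exact: inc_node.
- apply: (hE _ _ v0) => //; last exact: inc_node.
  by case/andP: oc => _ /eqP e; rewrite /incident /= e.
have [u _ /andP[mu su]] := hadjP ms; have [v _ /andP[mv tv]] := hadjP mt.
have ss : s.1 = ~~ m.1 by have := hadj_side ms; case: (m.1); case: (s.1).
have tt : t.1 = ~~ m.1 by have := hadj_side mt; case: (m.1); case: (t.1).
have ne : u != v.
  have kE (k : bool * I) w : k.1 = ~~ m.1 -> incident en k w -> k = (~~ m.1, en (~~ m.1) w).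
    by case: k => k1 k2 /= -> /eqP /= <-.
  by apply: contraNneq st => e; rewrite (kE s u) // (kE t v) // e.
have suv : share m.1 u v by rewrite /share_side ne; move/eqP: mu => ->; move/eqP: mv => ->; rewrite eqxx.
exists u, v; apply: co_line_even; first exact/sA/(share_anti suv).
move=> a b ua ab bv ub av.
have nau : ~~ anti u a by rewrite -anN ?ua ?(adjacent_neq ua).
have nbv : ~~ anti b v by rewrite -anN ?bv ?(adjacent_neq bv).
have nab : ~~ anti a b by rewrite -anN ?ab ?(adjacent_neq ab).
have side w x y : anti w y -> share m.1 x y -> ~~ anti w x -> w != x -> share (~~ m.1) w y.
  move=> wy xy nwx wx; move: wy; rewrite (anti_share m.1) => /orP[h|//].
  by case/negP: nwx; apply: (share_anti (o := m.1)); apply: (share_trans h _ wx); rewrite shareC.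
have av' : share (~~ m.1) a v.
  apply: (side a u v av suv); first by rewrite antiadjacentC.
  by rewrite eq_sym (adjacent_neq ua).
have bu' : share (~~ m.1) b u.
  by apply: (side b v u) => //; [rewrite antiadjacentC | rewrite shareC | exact: adjacent_neq bv].
have flip_m (k : bool * I) i : k.1 = ~~ m.1 -> k.1 != (m.1, i : I).1 by move=> ->; case: (m.1).
have other w x : share (~~ m.1) w x -> incident en m x -> (m.1, en m.1 w) != m.
  move=> wx mx; apply: contraNneq (share_excl en_inj wx) => e.
  by rewrite negbK /share_side; case/andP: wx => -> _; move/eqP: mx => ->; have /= -> := congr1 snd e.
apply: (bnd (m.1, en m.1 a) (m.1, en m.1 b)).
- exact: other av' mv.
- exact: other bu' mu.
- apply: contraNneq nab => -[e]; apply: (share_anti (o := m.1)).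
  by rewrite /share_side e eqxx andbT (adjacent_neq ab).
- apply: (hE _ _ a); [exact: flip_m| |exact: inc_node].
  by rewrite /incident tt; case/andP: av' => _ /eqP ->; rewrite -tt; exact: tv.
- apply: (hE _ _ b); [exact: flip_m| |exact: inc_node].
  by rewrite /incident ss; case/andP: bu' => _ /eqP ->; rewrite -ss; exact: su.
Qed.

Section SmallCo.
Variables (x y : V).
Hypotheses (sxy : semiadj T x y) (DE : Dset T = [set x; y]) (Nxy : N T x :&: N T y = set0).

(** A third edge at the common end of [x] and [y] would give three pairwise antiadjacent vertices,
    and such triples contain no switchable pair. *)
Lemma semi_class : exists o, share o x y /\ forall w, w != x -> w != y -> ~~ share o w x.
Proof.
have [axy nxy] : adjacent T x y /\ anti x y by move: sxy; rewrite semiadjE => /andP.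
have [o oxy] : exists o, share o x y by apply: (adj_share enP); rewrite adjacent_compl.
exists o; split=> // w wx wy; apply/negP => h.
have h' := share_trans h oxy wy.
have xw : anti x w by rewrite antiadjacentC (share_anti h).
have yw : anti y w by rewrite antiadjacentC (share_anti h').
by move: (anti_triangle nxy xw yw); rewrite axy.
Qed.

Lemma near_D w : w != x -> w != y -> anti w x \/ anti w y.
Proof.
move=> wx wy; case: (boolP (anti w x)) => nwx; first by left.
right; apply: contraNT nwx => nwy; apply/negPn/negP => nwx.
have adj u : w != u -> ~~ anti w u -> adjacent T u w.
  by move=> ne; rewrite antiadjacentE ne negbK adjacentC; apply: strongly_adjW.
by move/setP/(_ w): Nxy; rewrite !inE !adj.
Qed.

Lemma off_D w u : w != x -> w != y -> anti w u -> strongly_anti T w u.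
Proof. by move=> wx wy; apply: notin_Dset_anti; rewrite DE !inE negb_or wx. Qed.

(** On a path [g], [a], [b], [x], a vertex [a] other than [y] would meet [x] in the same end as [g]
    does and so be antiadjacent to [g]. Hence [a] is [y], and [b] is a common neighbour of [x] and
    [y]. *)
Lemma co_line_small1 g : g != x -> g != y -> anti g x -> even_pair T g x.
Proof.
move=> gx gy agx; have [o [oxy cl]] := semi_class.
have sgx : share (~~ o) g x.
  by move: agx; rewrite (anti_share o) (negbTE (cl _ gx gy)).
apply: co_line_even; first exact: off_D.
move=> a b ga ab bx gb ax.
have ax' := antiadjacent_neq ax; have gna := adjacent_neq ga.
have ay : a = y.
  apply/eqP/negPn/negP => ay; move: (ax); rewrite (anti_share o) (negbTE (cl _ ax' ay)) /= => sax.
  have sag : share (~~ o) a g by rewrite shareC in sgx; apply: (share_trans sax sgx); rewrite eq_sym.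
  by case/negP: (anti_triangle (share_anti sag) ax agx); rewrite adjacentC.
by move/setP/(_ b): Nxy; rewrite !inE (adjacentC T x) bx -ay ab.
Qed.

(** On a path [g], [a], [b], [h], both [a] and [b] meet [y] in its end other than the one shared
    with [x]. So [a], [b], [y] are pairwise antiadjacent, which makes [a] and [b] strongly
    antiadjacent. *)
Lemma co_line_small2 g h : g != x -> g != y -> h != x -> h != y -> g != h ->
  anti g x -> anti h x -> anti g h -> even_pair T g h.
Proof.
move=> gx gy hx hy gh agx ahx agh; have [o [oxy cl]] := semi_class.
have sgx : share (~~ o) g x by move: agx; rewrite (anti_share o) (negbTE (cl _ gx gy)).
have shx : share (~~ o) h x by move: ahx; rewrite (anti_share o) (negbTE (cl _ hx hy)).
have sgh : share (~~ o) g h by rewrite shareC in shx; apply: share_trans sgx shx gh.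
apply: co_line_even; first exact: off_D.
(* The vertex [a] meets [h'] on side [o], hence cannot meet [x] there or on the other side; by
   [near_D] it is antiadjacent to [y]. *)
have key a g' h' : share (~~ o) g' h' -> share (~~ o) g' x -> share (~~ o) h' x -> adjacent T g' a -> anti a h' ->
    [/\ a != y & share (~~ o) a y].
  move=> sgh' sgx' shx' ga ah.
  have sah : share o a h'.
    move: (ah); rewrite (anti_share o) => /orP[//|sah].
    have gna := adjacent_neq ga.
    have sag : share (~~ o) a g' by rewrite shareC in sgh'; apply: (share_trans sah sgh'); rewrite eq_sym.
    case/negP: (anti_triangle (share_anti sag) ah (share_anti sgh')); by rewrite adjacentC.
  have nax : a != x by apply: contraNneq (share_excl en_inj sah) => ->; rewrite shareC.
  have yx : share o y x by rewrite shareC.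
  have h'x : h' != x by case/andP: shx'.
  have nay : a != y.
    apply: contraTneq sah => ->; apply/negP => yh'.
    rewrite shareC in yh'; case/negP: (share_excl en_inj (share_trans yh' yx h'x)).
    exact: shx'.
  split=> //; case: (near_D nax nay) => [|].
    rewrite (anti_share o) (negbTE (cl _ nax nay)) /= => sax.
    rewrite shareC in shx'; case/negP: (share_excl en_inj sah); apply: (share_trans sax shx').
    exact: antiadjacent_neq ah.
  rewrite (anti_share o) => /orP[say|//].
  by case/negP: (cl _ nax nay); apply: share_trans say yx nax.
move=> a b ga ab bh gb ah.
have [nay say] := key a g h sgh sgx shx ga ah.
have [nby sby] : b != y /\ share (~~ o) b y.
  apply: (key b h g) => //; first by rewrite shareC.
    by rewrite adjacentC.
  by rewrite antiadjacentC.
have sab : share (~~ o) a b by rewrite shareC in sby; apply: share_trans say sby (adjacent_neq ab).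
by case/negP: (anti_triangle (share_anti sab) (share_anti say) (share_anti sby)).
Qed.

End SmallCo.
End CoLine.

Lemma co_line_pairs (V : finType) (T : trigraph V) : line_trigraph (compl T) -> Dspec T ->
  (forall s, ~ is_antihole T s) ->
  (complete T \/ has_even_pair T) /\ (favorable T -> has_free_even_pair T).
Proof.
case=> /line_coordinates[I [en [en_inj enP]]] strong3 ds noAH.
have [cT|nc] := complete_dec T.
  by split; [left | move=> /favorable_not_complete].
case: ds => [D0 ns|x y sxy DE Nxy sw|c x y xy cx cy DE cN sa _].
- have h := co_line_pair0 en_inj enP strong3 noAH ns nc.
  by split; [right | move=> _; apply: Dset0_free].
- have syx : semiadj T y x by rewrite semiadjC.
  have DE' : Dset T = [set y; x] by rewrite setUC.
  have Nyx : N T y :&: N T x = set0 by rewrite setIC.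
  split; [right|move=> fav].
    have [u [v uv]] := not_complete_anti nc.
    have axy : adjacent T x y by rewrite adjacentW sxy orbT.
    have [w wx wy] : exists2 w, w != x & w != y.
      case: (boolP ((u != x) && (u != y))) => [/andP[]|]; first by exists u.
      case: (boolP ((v != x) && (v != y))) => [/andP[]|]; first by exists v.
      rewrite !negb_and !negbK => hv hu; move: uv; rewrite strongly_antiE => /andP[ne].
      by case/orP: hu => /eqP eu; case/orP: hv => /eqP ev; subst u v;
        rewrite ?eqxx // ?axy // ?(adjacentC T y) ?axy // in ne *.
    case: (near_D Nxy wx wy) => h.
      by exists w, x; apply: (co_line_small1 en_inj enP strong3 sxy DE Nxy).
    by exists w, y; apply: (co_line_small1 en_inj enP strong3 syx DE' Nyx).
  have extract d : d \in [set x; y] -> ~ clique T (~: (Dset T :|: N T d)) -> exists g h,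
     [/\ g \notin Dset T, h \notin Dset T, g != h, antiadjacent T g h & antiadjacent T g d /\ antiadjacent T h d].
    move=> dD /not_clique[g [h []]]; rewrite !in_setC !in_setU ![_ \in N T _]inE !negb_or.
    case/andP => gD ngd /andP[hD nhd] gh ngh; exists g, h.
    have an u v : u != v -> ~~ adjacent T u v -> antiadjacent T u v.
      by move=> ne nuv; apply: strongly_antiW; rewrite strongly_antiE ne.
    have neD u : u \notin Dset T -> u != d by apply: contraNneq => ->; rewrite DE.
    by split; rewrite ?an // 1?adjacentC // ?neD.
  case: (fav) => _ _ /(_ x y sw sxy)[] /extract; rewrite ?set21 ?set22.
    case=> // g [h [gD hD gh agh [agx ahx]]]; exists g, h; split=> //.
    move: gD hD; rewrite DE !inE !negb_or => /andP[gx gy] /andP[hx hy].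
    exact: (co_line_small2 en_inj enP strong3 sxy DE Nxy).
  case=> // g [h [gD hD gh agh [agx ahx]]]; exists g, h; split=> //.
  move: gD hD; rewrite DE !inE !negb_or => /andP[gx gy] /andP[hx hy].
  exact: (co_line_small2 en_inj enP strong3 syx DE' Nyx).
(* The vertices of a light component are pairwise antiadjacent, but a triangle of the complement
   contains no switchable pair. *)
- have acx : antiadjacent T c x by rewrite antiadjacentW cx orbT.
  have acy : antiadjacent T c y by rewrite antiadjacentW cy orbT.
  by have := anti_triangle strong3 acx acy (strongly_antiW sa); rewrite adjacentW cx orbT.
Qed.

Unset Implicit Arguments.

Theorem theorem4p1 (V : finType) (T : trigraph V) :
  in_F T -> basic T ->
  (forall p1 p2 p3 : seq V, ~ is_odd_prism T p1 p2 p3) ->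
  (forall s : seq V, ~ is_antihole T s) ->
  (complete T \/ exists u v : V, even_pair T u v) /\
  (favorable T ->
     exists u v : V, [/\ even_pair T u v, u \notin Dset T & v \notin Dset T]).
Proof.
move=> /in_F_Dspec ds bas noPrism noAH.
case: bas => [[A [h1 h2]]|[cb|[lt|[clt|[X gp]]]]].
- by split; [exact: bip_even_pair h1 h2 | exact: bip_free_even_pair h1 h2 ds].
- exact: co_bip_pairs.
- exact: line_pairs.
- exact: co_line_pairs.
- exact: doubled_pairs gp noAH ds.
Qed.
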